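(* Assume that the initial data $(u_0^{\varepsilon},v_0^{\varepsilon})_{\varepsilon>0}$ are bounded independently of $\varepsilon$ in $BV(\mathbb{R})$ and that $N_0:=\max\{\sup_{\varepsilon>0}\|u_0^\varepsilon\|_\infty,\sup_{\varepsilon>0}\|v_0^\varepsilon\|_\infty\}<\infty$. Let $\mathcal{R}\in C^1(\mathbb{R}\times\mathbb{R},\mathbb{R})$ satisfy the equilibrium and derivative assumptions (E) and (D) of the context, and let the characteristic speed $\sqrt a>0$ and the parameter $\beta>0$ be chosen as in (P) of the context. Then, for $\varepsilon>0$ fixed, the numerical solution $(u_h^\varepsilon,v_h^\varepsilon)$ defined by the splitting scheme of the context with cell-averaged initial data converges in $L^1_{loc}(\mathbb{R}^+\times\mathbb{R})$, as $h=(\Delta t,\Delta x)\to(0,0)$, to a weak solution $(u^\varepsilon,v^\varepsilon)$ of the relaxation Cauchy problem $$\partial_t u^\varepsilon+\partial_x v^\varepsilon=0,\qquad \partial_t v^\varepsilon+a\,\partial_x u^\varepsilon=-\tfrac1\varepsilon\mathcal{R}(u^\varepsilon,v^\varepsilon),\qquad (u^\varepsilon,v^\varepsilon)(0,\cdot)=(u_0^\varepsilon,v_0^\varepsilon).$$ More precisely, $$\|u_h^\varepsilon(t)-u^\varepsilon(t)\|_1+\|v_h^\varepsilon(t)-v^\varepsilon(t)\|_1\le\frac{C_t}{\varepsilon}\left(\Delta t\Bigl(\frac{\|\delta^0\|_1}{\varepsilon}+1\Bigr)+\Delta x^{1/2}\right),$$ where $\delta^0=v_0^\varepsilon-A(u_0^\varepsilon)$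 and $C_t$ is a constant depending on $t$ but not on $h$ or $\varepsilon$.
   Context: (E) $\mathcal{R}(u,v)=0\iff v=A(u)$, where $A:\mathbb{R}\to\mathbb{R}$ is locally Lipschitz with $A(0)=0$. (D) $\nabla\mathcal{R}$ is uniformly bounded in $v$ and locally bounded in $u$: for every $U_0>0$ there are constants $g(U_0),\beta_0(U_0),H(U_0)$ such that for all $(u,v)\in[-U_0,U_0]\times\mathbb{R}$, $|\partial_u\mathcal{R}(u,v)|\le g(U_0)$ and $0<\beta_0(U_0)\le\partial_v\mathcal{R}(u,v)\le H(U_0)$. For $N,\alpha>0$ put $U(N,\alpha)=(1+\frac1{\sqrt\alpha})N$, $F(N,\alpha)=\sup_{|\xi|\le U(N,\alpha)}|A(\xi)|$, $V(N,\alpha)=U(N,\alpha)+\frac1{\sqrt\alpha}F(N,\alpha)$. (P) For a given $a_0>0$: $\sqrt a>\max\bigl\{\sqrt{a_0},\,g(V(N_0,a_0))/\beta_0(V(N_0,a_0))\bigr\}$ and $\beta=H(V(N_0,a_0))$. Grid: uniform cells $C_j=]x_{j-1/2},x_{j+1/2}[$ of length $\Delta x$, $j\in\mathbb{Z}$; $t^n=n\Delta t$; CFL condition $0<\lambda:=\sqrt a\,\Delta t/\Delta x<1$; $h=(\Delta t,\Delta x)$. Splitting scheme: $u_j^0=\frac1{\Delta x}\int_{C_j}u_0^\varepsilon\,dx$, $v_j^0=\frac1{\Delta x}\int_{C_j}v_0^\varepsilon\,dx$. Transport step: $$u_j^{n+1/2}=u_j^n-\tfrac{\Delta t}{2\Delta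 x}\bigl[(v_{j+1}^n-v_{j-1}^n)-\sqrt a(u_{j+1}^n-2u_j^n+u_{j-1}^n)\bigr],$$ $$v_j^{n+1/2}=v_j^n-\tfrac{\Delta t}{2\Delta x}\bigl[a(u_{j+1}^n-u_{j-1}^n)-\sqrt a(v_{j+1}^n-2v_j^n+v_{j-1}^n)\bigr].$$ Relaxation step: $u_j^{n+1}=u_j^{n+1/2}$ and $$v_j^{n+1}=v_j^{n+1/2}-\bigl(v_j^{n+1/2}-A(u_j^{n+1/2})\bigr)\Bigl[1-\bigl(1+\tfrac{\beta\Delta t}{\varepsilon}\bigr)e^{-\beta\Delta t/\varepsilon}\Bigr]-\tfrac{\Delta t}{\varepsilon}e^{-\beta\Delta t/\varepsilon}\,\mathcal{R}(u_j^{n+1/2},v_j^{n+1/2}).$$ The numerical solution is $u_h^\varepsilon(t,x)=\sum_{n,j}u_j^n\mathbf 1_{C_j}(x)\mathbf 1_{[t^n,t^{n+1}[}(t)$, $v_h^\varepsilon(t,x)=\sum_{n,j}v_j^n\mathbf 1_{C_j}(x)\mathbf 1_{[t^n,t^{n+1}[}(t)$. The norm $\|\cdot\|_1$ is the $L^1(\mathbb{R})$ norm.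
   Formalization: The constant C_t is independent of h and of ε only on each bounded range 0 < ε ≤ ε_max (it may depend on ε_max); uniformity over all ε > 0 is false, since the factor 1/ε tends to 0 as ε → ∞ while the discretization error does not. *)

(* Defs.v *)
From HB Require Import structures.
From mathcomp Require Import all_boot all_order all_algebra.
From mathcomp Require Import all_classical all_reals all_analysis.

Set Implicit Arguments.
Unset Strict Implicit.
Unset Printing Implicit Defensive.

Import Order.TTheory GRing.Theory Num.Theory.
Import numFieldNormedType.Exports.

Local Open Scope classical_set_scope.
Local Open Scope ring_scope.

Definition compact_support (R : realType) (T : topologicalType) (phi : T -> R)
    : Prop :=
  compact (closure [set p | phi p != 0]).

Definition C1_line (R : realType) (phi : R -> R) : Prop :=
  (forall x, derivable phi x 1) /\ continuous (derive1 phi).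

Definition d1 (R : realType) (f : R * R -> R) (p : R * R) : R :=
  'D_((1, 0) : R * R) f p.

Definition d2 (R : realType) (f : R * R -> R) (p : R * R) : R :=
  'D_((0, 1) : R * R) f p.

Definition C1_plane (R : realType) (f : R * R -> R) : Prop :=
  [/\ forall p, differentiable f p, continuous (d1 f) & continuous (d2 f)].

Definition norm1 (R : realType) (f : R -> R) : \bar R :=
  'N[@lebesgue_measure R]_1%:E[EFin \o f]%E.

Definition norm_infty (R : realType) (f : R -> R) : \bar R :=
  'N[@lebesgue_measure R]_+oo[EFin \o f]%E.

(* Variation of f on the whole line in the sense of distributions; it does
   not depend on the representative of f modulo null sets, unlike the
   pointwise total_variation of the library. *)
Definition variation (R : realType) (f : R -> R) : \bar R :=
  ereal_sup [set (\int[@lebesgue_measure R]_x (f x * derive1 phi x))%:E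
            | phi in [set phi : R -> R | [/\ C1_line phi, compact_support phi
                                          & forall x, `|phi x| <= 1]]].

Definition bounded_in_BV (R : realType) (f : R -> R -> R) : Prop :=
  (forall eps : R, 0 < eps ->
     (@lebesgue_measure R).-integrable setT (EFin \o f eps)) /\
  exists M : R, forall eps : R, 0 < eps ->
    (norm1 (f eps) + variation (f eps) <= M%:E)%E.

Definition sup_norm_family (R : realType) (f : R -> R -> R) : \bar R :=
  ereal_sup [set norm_infty (f eps) | eps in [set eps : R | 0 < eps]].

Definition locally_lipschitz (R : realType) (A : R -> R) : Prop :=
  forall x : R, exists2 B : set R, nbhs x B & [lipschitz A y | y in B].

Definition equilibrium (R : realType) (calR : R * R -> R) (A : R -> R) : Prop :=
  [/\ locally_lipschitz A, A 0 = 0 & forall u v : R, calR (u, v) = 0 <-> v = A u].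

Definition gradient_bounds (R : realType) (calR : R * R -> R)
    (g beta0 H : R -> R) : Prop :=
  forall U0 : R, 0 < U0 -> forall u v : R, - U0 <= u <= U0 ->
    [/\ `|d1 calR (u, v)| <= g U0,
        0 < beta0 U0,
        beta0 U0 <= d2 calR (u, v) &
        d2 calR (u, v) <= H U0].

Definition Ubound (R : realType) (N alpha : R) : R :=
  (1 + (Num.sqrt alpha)^-1) * N.

Definition Fbound (R : realType) (A : R -> R) (N alpha : R) : R :=
  sup [set `|A xi| | xi in [set xi | `|xi| <= Ubound N alpha]].

Definition Vbound (R : realType) (A : R -> R) (N alpha : R) : R :=
  Ubound N alpha + (Num.sqrt alpha)^-1 * Fbound A N alpha.

Definition parameter_choice (R : realType) (A g beta0 H : R -> R)
    (N0 a0 a beta : R) : Prop :=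
  let V := Vbound A N0 a0 in
  Num.max (Num.sqrt a0) (g V / beta0 V) < Num.sqrt a /\ beta = H V.

Definition interface (R : realType) (dx : R) (j : int) : R :=
  (j%:~R + 2^-1) * dx.

(* C_j, with interface dx j = x_{j+1/2} = (j + 1/2) dx *)
Definition cell (R : realType) (dx : R) (j : int) : set R :=
  `]interface dx (j - 1), interface dx j[.

Definition cell_average (R : realType) (dx : R) (f : R -> R) (j : int) : R :=
  dx^-1 * \int[@lebesgue_measure R]_(x in cell dx j) f x.

(* A grid state associates to each cell j the pair (u_j, v_j). *)
Definition transport_step (R : realType) (a dt dx : R) (s : int -> R * R)
    (j : int) : R * R :=
  let u i := (s i).1 in
  let v i := (s i).2 in
  (u j - dt / (2 * dx) * ((v (j + 1) - v (j - 1))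
                          - Num.sqrt a * (u (j + 1) - 2 * u j + u (j - 1))),
   v j - dt / (2 * dx) * (a * (u (j + 1) - u (j - 1))
                          - Num.sqrt a * (v (j + 1) - 2 * v j + v (j - 1)))).

Definition relaxation_step (R : realType) (calR : R * R -> R) (A : R -> R)
    (beta eps dt : R) (s : R * R) : R * R :=
  let e := expR (- (beta * dt / eps)) in
  (s.1,
   s.2 - (s.2 - A s.1) * (1 - (1 + beta * dt / eps) * e)
       - dt / eps * e * calR s).

Fixpoint scheme (R : realType) (calR : R * R -> R) (A : R -> R)
    (a beta eps dt dx : R) (u0 v0 : R -> R) (n : nat) : int -> R * R :=
  match n with
  | 0%N => fun j => (cell_average dx u0 j, cell_average dx v0 j)
  | m.+1 => fun j =>
      relaxation_step calR A beta eps dt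
        (transport_step a dt dx
           (scheme calR A a beta eps dt dx u0 v0 m) j)
  end.

Definition reconstruct (R : realType) (dt dx : R) (w : nat -> int -> R)
    (p : R * R) : R :=
  \sum_(nj \in [set: nat * int])
     w nj.1 nj.2 * \1_(cell dx nj.2) p.2
       * \1_(`[nj.1%:R * dt, nj.1.+1%:R * dt[ : set R) p.1.

Definition num_u (R : realType) (calR : R * R -> R) (A : R -> R)
    (a beta eps dt dx : R) (u0 v0 : R -> R) : R * R -> R :=
  reconstruct dt dx (fun n j => (scheme calR A a beta eps dt dx u0 v0 n j).1).

Definition num_v (R : realType) (calR : R * R -> R) (A : R -> R)
    (a beta eps dt dx : R) (u0 v0 : R -> R) : R * R -> R :=
  reconstruct dt dx (fun n j => (scheme calR A a beta eps dt dx u0 v0 n j).2).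

Definition admissible_mesh (R : realType) (a : R) : set (R * R) :=
  [set h | [/\ 0 < h.1, 0 < h.2,
               0 < Num.sqrt a * h.1 / h.2 & Num.sqrt a * h.1 / h.2 < 1]].

Definition lebesgue_plane (R : realType) :=
  (@lebesgue_measure R \x @lebesgue_measure R)%E.

Definition closed_half_plane (R : realType) : set (R * R) :=
  [set p | 0 <= p.1].

Definition bounded_measurable (R : realType) (u : R * R -> R) : Prop :=
  measurable_fun setT u /\
  exists M : R, {ae @lebesgue_plane R,
    forall p, closed_half_plane p -> `|u p| <= M}.

(* Test functions live on the whole plane and are only integrated over
   t >= 0, so they need not vanish at t = 0: this carries the initial data. *)
Definition weak_solution (R : realType) (calR : R * R -> R) (a eps : R)
    (u0 v0 : R -> R) (u v : R * R -> R) : Prop :=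
  [/\ bounded_measurable u, bounded_measurable v &
      forall phi : R * R -> R, C1_plane phi -> compact_support phi ->
      \int[@lebesgue_plane R]_(p in @closed_half_plane R)
          (u p * d1 phi p + v p * d2 phi p)
      + \int[@lebesgue_measure R]_x (u0 x * phi (0, x)) = 0
      /\
      \int[@lebesgue_plane R]_(p in @closed_half_plane R)
          (v p * d1 phi p + a * (u p * d2 phi p)
             - eps^-1 * calR (u p, v p) * phi p)
      + \int[@lebesgue_measure R]_x (v0 x * phi (0, x)) = 0].

(* Convergence in L^1 on the compact subsets of t >= 0 as (dt, dx) -> (0, 0)
   along the meshes satisfying the CFL condition. *)
Definition cvg_L1loc (R : realType) (a : R) (uh : R * R -> R * R -> R)
    (u : R * R -> R) : Prop :=
  forall K : set (R * R), compact K -> K `<=` @closed_half_plane R ->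
    (fun h => \int[@lebesgue_plane R]_(p in K) `|uh h p - u p|%:E)%E
      @ within (admissible_mesh a) (nbhs ((0, 0) : R * R)) --> 0%E.

(* Main.v *)
(* In the Riemann coordinates p = u + v/s, q = u - v/s, with s = sqrt a, transport
   is a pair of opposite shifts. The choice of a and beta makes both
   (u, v) |-> (u, v - R(u, v) / beta) and the relaxation step contractions for
   |p| + |q| that conserve p + q. Such maps are order preserving, so comparison
   with x-independent states confines u to [-U, U], where the gradient bounds hold;
   they also contract L^1 and do not increase the L^1 modulus of translations,
   which is the form in which the BV bound is used.

   The exact solution is the limit of the splittings f |-> shift (f + mu tau (M f - f))
   with mu = beta / eps and tau = 2^-k / mu. They form a Cauchy sequence because one
   step 2 tau and two steps tau differ by O(mu tau^2). The grid scheme is compared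
   first with the scheme transporting exactly: j upwind steps average shifts over a
   binomial law of variance O(j dx^2), hence an error O(sqrt dx). Writing the
   relaxation step as e^-b f + K f with K Lipschitz of constant 1 - e^-b keeps this
   error from being amplified. The exactly transported scheme is then compared with
   the exact solution by consistency. If sqrt dx >= eps the estimate already follows
   from the L^1 bounds; otherwise dt <= dx / s <= eps sqrt dx / s absorbs the powers
   of eps. The weak form is obtained from the identity
   r_k (t + tau, x + c tau) = r_k (t, x) + tau h_k (t, x) by a discrete integration by
   parts against the test function. *)

Require Import Defs.
From HB Require Import structures.
From mathcomp Require Import all_boot all_order all_algebra.
From mathcomp Require Import all_classical all_reals all_analysis.
From mathcomp Require Import measurable_realfun ess_sup_inf ring lra.

Set Implicit Arguments.
Unset Strict Implicit.
Unset Printing Implicit Defensive.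

Import Order.TTheory GRing.Theory Num.Theory.
Import numFieldNormedType.Exports.

Local Open Scope classical_set_scope.
Local Open Scope ring_scope.

(** * Splitting schemes in a seminormed space *)

(** The difficulty is stiffness: [mu = beta / eps] is unbounded as [eps] tends to [0], and a plain
    Lipschitz estimate of the source would bring in [expR (mu * t)]. Estimates are therefore
    arranged so that local errors pass through contractions and merely add up; only polynomial
    factors in [mu] remain. Contractivity rests on derivative bounds valid for all arguments,
    whereas those of [calR] are local in [u]. So [u] is truncated inside [calR], and the invariant
    interval shows afterwards that neither the scheme nor the limit ever meets the truncation.
    Functions are kept as functions rather than classes modulo null sets: relaxation acts pointwise,
    the truncated source agrees with the original only under pointwise bounds, and the solution must
    be measurable in [(t, x)]. Limits are hence pointwise limits superior, and the general estimates
    are stated for a seminorm. The variation in the hypotheses is distributional; a duality argument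
    converts it into a bound on translations, which nonlinear maps can preserve. *)

Section SplittingInSeminormedSpace.
Context (R : realType) (V : lmodType R) (nm : V -> R).
Hypothesis nmD : forall f g, nm (f + g) <= nm f + nm g.
Hypothesis nmZ : forall c f, nm (c *: f) = `|c| * nm f.

Lemma seminorm0 : nm 0 = 0.
Proof. by rewrite -(scale0r 0) nmZ normr0 mul0r. Qed.

Lemma seminormN f : nm (- f) = nm f.
Proof. by rewrite -scaleN1r nmZ normrN1 mul1r. Qed.

Lemma seminorm_distC f g : nm (f - g) = nm (g - f).
Proof. by rewrite -seminormN opprB. Qed.

Lemma seminorm_ge0 f : 0 <= nm f.
Proof.
have := nmD f (- f); rewrite subrr seminorm0 seminormN -mulr2n.
by rewrite pmulrn_lge0.
Qed.

Lemma seminormB f g : nm (f - g) <= nm f + nm g.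
Proof. by rewrite -(seminormN g); exact: nmD. Qed.

Lemma seminorm_triangle h f g : nm (f - g) <= nm (f - h) + nm (h - g).
Proof. by rewrite -(subrKA h f (- g)). Qed.

Definition seminorm_lip (th : R) (K : V -> V) :=
  forall f g, nm (K f - K g) <= th * nm (f - g).

Lemma seminorm_lip1 K : seminorm_lip 1 K ->
  forall f g, nm (K f - K g) <= nm (f - g).
Proof. by move=> lK f g; rewrite (le_trans (lK _ _))// mul1r. Qed.

Lemma seminorm_lip1_iter K n : seminorm_lip 1 K -> seminorm_lip 1 (iter n K).
Proof.
move=> lK; elim: n => [|n IH] f g; first by rewrite mul1r.
by rewrite !iterS (le_trans (seminorm_lip1 lK _ _)).
Qed.

Lemma iter_displacement K n f : seminorm_lip 1 K ->
  nm (iter n K f - f) <= n%:R * nm (K f - f).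
Proof.
move=> lK; elim: n => [|n IH]; first by rewrite subrr seminorm0 mul0r.
rewrite (le_trans (seminorm_triangle (K f) _ _))// -natr1 mulrDl mul1r lerD2r.
by rewrite iterS (le_trans (seminorm_lip1 lK _ _)).
Qed.

Variables Sh Tr : R -> {linear V -> V}.
Hypothesis Sh0 : forall f, Sh 0 f = f.
Hypothesis ShD : forall y z f, Sh (y + z) f = Sh y (Sh z f).
Hypothesis nmSh : forall y f, nm (Sh y f) = nm f.
Hypothesis TrSh : forall y z f, Tr y (Sh z f) = Sh z (Tr y f).
Hypothesis nmShTr : forall y f, nm (Sh y f - f) = nm (Tr y f - f).

(** In the application [Tr] moves both components the same way and so commutes with pointwise
    nonlinear maps, which [Sh] does not; [nmShTr] carries the bound over to [Sh]. *)
Definition bv_modulus (B : R) (f : V) :=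
  forall y, nm (Tr y f - f) <= B * `|y|.

Lemma bv_modulus_ge0 B f : bv_modulus B f -> 0 <= B.
Proof.
by move=> /(_ 1); rewrite normr1 mulr1; apply: le_trans; exact: seminorm_ge0.
Qed.

Lemma bv_modulusSh B f y : bv_modulus B f -> nm (Sh y f - f) <= B * `|y|.
Proof. by move=> Bf; rewrite nmShTr; exact: Bf. Qed.

Lemma bv_modulus_Sh B f y : bv_modulus B f -> bv_modulus B (Sh y f).
Proof. by move=> Bf z; rewrite TrSh -linearB nmSh. Qed.

Lemma bv_modulus_lip th K B f : 0 <= th -> seminorm_lip th K ->
  (forall y g, K (Tr y g) = Tr y (K g)) ->
  bv_modulus B f -> bv_modulus (th * B) (K f).
Proof.
move=> th0 lK KT Bf y; rewrite -KT (le_trans (lK _ _))// -mulrA.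
exact: ler_wpM2l.
Qed.

Lemma shift_isom_dist y f g : nm (Sh y f - Sh y g) = nm (f - g).
Proof. by rewrite -linearB nmSh. Qed.

Lemma seminorm_convex c f g : 0 <= c <= 1 ->
  nm ((1 - c) *: f + c *: g) <= (1 - c) * nm f + c * nm g.
Proof.
case/andP=> c0 c1; rewrite (le_trans (nmD _ _))// !nmZ !ger0_norm//.
by rewrite subr_ge0.
Qed.

(** * Upwind transport compared with exact transport *)

Section Upwind.
Variables lam dx : R.
Hypothesis lam01 : 0 <= lam <= 1.

Definition upwind (f : V) : V := (1 - lam) *: f + lam *: Sh dx f.

Lemma upwindB f g : upwind f - upwind g = upwind (f - g).
Proof. by rewrite /upwind (raddfB (Sh dx))/= !scalerBr opprD addrACA. Qed.

Lemma iter_upwindB j f g :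
  iter j upwind f - iter j upwind g = iter j upwind (f - g).
Proof. by elim: j => // j IH; rewrite !iterS upwindB IH. Qed.

Lemma upwind_lincomb c f g : upwind (c *: f + g) = c *: upwind f + upwind g.
Proof.
rewrite /upwind linearP/= !scalerDr !scalerA addrACA.
by rewrite (mulrC c) (mulrC c).
Qed.

Lemma iter_upwind_lincomb j c f g : iter j upwind (c *: f + g) =
  c *: iter j upwind f + iter j upwind g.
Proof. by elim: j => // j IH; rewrite !iterS IH upwind_lincomb. Qed.

Lemma upwind_le f : nm (upwind f) <= nm f.
Proof.
by rewrite (le_trans (seminorm_convex _ _ lam01))// nmSh -mulrDl subrK mul1r.
Qed.

Lemma iter_upwind_le j f : nm (iter j upwind f) <= nm f.
Proof. by elim: j => // j IH; rewrite iterS (le_trans (upwind_le _)). Qed.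

Lemma upwind_lip : seminorm_lip 1 upwind.
Proof. by move=> f g; rewrite upwindB mul1r upwind_le. Qed.

(* [upwind] is the average of [Sh] over a Bernoulli displacement; its second
   moment about the mean displacement [lam * dx] adds up linearly. *)
Lemma upwind_second_moment B f j del y : bv_modulus B f -> 0 < del ->
  nm (Sh y (iter j upwind f) - f) <=
  B * (((y + j%:R * (lam * dx)) ^+ 2 + j%:R * (lam * (1 - lam) * dx ^+ 2))
       / (2 * del) + del / 2).
Proof.
move=> Bf del0; have B0 := bv_modulus_ge0 Bf; elim: j y => [|j IH] y.
  rewrite !mul0r !addr0 (le_trans (bv_modulusSh _ Bf))// ler_wpM2l//.
  (* Young's inequality: a second moment now controls the linear modulus, at a length scale [del]
     that stays free until the mesh is known. *)
  rewrite -subr_ge0.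
  have -> : y ^+ 2 / (2 * del) + del / 2 - `|y| =
            (`|y| - del) ^+ 2 / (2 * del).
    rewrite -[y ^+ 2]real_normK ?num_real//; field; lra.
  by rewrite divr_ge0 ?sqr_ge0// mulr_ge0// ltW.
have -> : Sh y (iter j.+1 upwind f) - f =
    (1 - lam) *: (Sh y (iter j upwind f) - f) +
    lam *: (Sh (y + dx) (iter j upwind f) - f).
  rewrite iterS {1}/upwind linearD !linearZ/= -ShD !scalerBr addrACA -opprD.
  by rewrite -[in RHS]scalerDl subrK scale1r.
rewrite (le_trans (seminorm_convex _ _ lam01))//.
case/andP: lam01 => l0 l1.
have IH1 := ler_wpM2l (_ : 0 <= 1 - lam) (IH y).
have IH2 := ler_wpM2l l0 (IH (y + dx)).
apply: (le_trans (lerD (IH1 _) IH2)); first by rewrite subr_ge0.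
rewrite le_eqVlt; apply/orP; left; apply/eqP.
rewrite -natr1; field; lra.
Qed.

(** Shifting back by the mean displacement cancels the squared mean in the second moment and leaves
    the variance alone. *)
Lemma upwind_transport_error B f j del : bv_modulus B f -> 0 < del ->
  nm (iter j upwind f - Sh (j%:R * (lam * dx)) f) <=
  B * (j%:R * (lam * (1 - lam) * dx ^+ 2) / (2 * del) + del / 2).
Proof.
move=> Bf del0; rewrite -(nmSh (- (j%:R * (lam * dx)))) linearB/= -ShD addNr Sh0.
by rewrite (le_trans (upwind_second_moment _ _ Bf del0))// addNr expr0n/= add0r.
Qed.

(* The relaxation step is split as [rho *: f + K f], so that the stiff part of
   the Duhamel formula has total mass one and no Gronwall factor appears. *)
Lemma upwind_relaxation_error (rho th : R) (K : V -> V) B err J w0 :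
  0 <= rho -> 0 <= th -> rho + th = 1 -> seminorm_lip th K ->
  (forall y g, K (Tr y g) = Tr y (K g)) -> bv_modulus B w0 ->
  (forall j f C, bv_modulus C f -> (j <= J)%N ->
     nm (iter j upwind f - Sh (j%:R * (lam * dx)) f) <= C * err) ->
  forall n j, (j + n <= J)%N ->
  nm (iter j upwind (iter n (fun f => rho *: upwind f + K (upwind f)) w0)
      - Sh (j%:R * (lam * dx))
          (iter n (fun f => rho *: Sh (lam * dx) f + K (Sh (lam * dx) f)) w0))
  <= (1 + n%:R * th) * (B * err).
Proof.
move=> rho0 th0 rho_th lK KT Bw0 herr.
set Rl := fun f => rho *: f + K f.
have lRl : seminorm_lip 1 Rl.
  move=> f g; rewrite /Rl opprD addrACA -scalerBr (le_trans (nmD _ _))//.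
  by rewrite nmZ ger0_norm// -rho_th mulrDl lerD2l.
have RlT y g : Rl (Tr y g) = Tr y (Rl g) by rewrite /Rl linearP/= KT.
have BRl C f : bv_modulus C f -> bv_modulus C (Rl f).
  by move=> Cf; rewrite -(mul1r C); exact: bv_modulus_lip.
pose w n := iter n (fun f => Rl (upwind f)) w0.
pose e n := iter n (fun f => Rl (Sh (lam * dx) f)) w0.
have Be n : bv_modulus B (e n).
  by elim: n => // n IH; rewrite /e iterS; apply: BRl; exact: bv_modulus_Sh.
suff : forall n j, (j + n <= J)%N ->
  nm (iter j upwind (w n) - Sh (j%:R * (lam * dx)) (e n))
  <= (1 + n%:R * th) * (B * err) by [].
(* The linear part [rho] of the last step gives one more transport step applied to step [n], hence
   the general [j]. The part through [K] costs [th] times the error at [j = 1], plus a fresh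
   transport error for a function of modulus [th * B]. With [rho + th = 1] the total grows by
   [th * (B * err)] only. *)
elim=> [|n IH] j jn.
  by rewrite mul0r addr0 mul1r herr// -(addn0 j).
have jn' : (j.+1 + n <= J)%N by rewrite addSn -addnS.
have h1n : (1 + n <= J)%N by rewrite (leq_trans _ jn)// add1n leq_addl.
have jJ : (j <= J)%N by rewrite (leq_trans _ jn)// leq_addr.
have wS : w n.+1 = rho *: upwind (w n) + K (upwind (w n)) by [].
have eS : e n.+1 = rho *: Sh (lam * dx) (e n) + K (Sh (lam * dx) (e n)) by [].
rewrite {}wS {}eS; have Be' := Be n.
have := IH _ jn'; have := IH _ h1n; move: Be'.
move: (w n) (e n) => w' e' Be'; rewrite mul1r /= => IH1 IHj.
rewrite iter_upwind_lincomb linearP/=.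
rewrite opprD addrACA -scalerBr.
rewrite (le_trans (nmD _ _))// nmZ ger0_norm//.
have h1 : nm (iter j upwind (upwind w') - Sh (j%:R * (lam * dx)) (Sh (lam * dx) e'))
    <= (1 + n%:R * th) * (B * err).
  rewrite -iterSr -ShD.
  by have -> : j%:R * (lam * dx) + lam * dx = j.+1%:R * (lam * dx)
    by rewrite -natr1 mulrDl mul1r.
have h2 : nm (iter j upwind (K (upwind w')) -
              Sh (j%:R * (lam * dx)) (K (Sh (lam * dx) e')))
    <= th * ((1 + n%:R * th) * (B * err)) + th * (B * err).
  rewrite (le_trans (seminorm_triangle
    (iter j upwind (K (Sh (lam * dx) e'))) _ _))// lerD//.
    rewrite iter_upwindB (le_trans (iter_upwind_le _ _))//.
    by rewrite (le_trans (lK _ _))// ler_wpM2l.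
  rewrite (mulrA th); apply: herr => //; apply: bv_modulus_lip => //.
  exact: bv_modulus_Sh.
apply: (le_trans (lerD (ler_wpM2l rho0 h1) h2)).
rewrite le_eqVlt; apply/orP; left; apply/eqP.
have -> : rho = 1 - th by rewrite -rho_th addrK.
by rewrite -natr1; ring.
Qed.

End Upwind.

(** * Contractivity and consistency of relaxation-transport splittings *)

Section Splitting.
Variable M : V -> V.
Hypothesis lM : seminorm_lip 1 M.
Hypothesis MT : forall y g, M (Tr y g) = Tr y (M g).
Hypothesis M0 : M 0 = 0.
Variables mu sp : R.
Hypothesis mu0 : 0 <= mu.
Hypothesis sp0 : 0 <= sp.

Definition splitting (tau : R) (f : V) : V :=
  Sh (sp * tau) (f + (mu * tau) *: (M f - f)).

Lemma contraction_le K f : seminorm_lip 1 K -> K 0 = 0 -> nm (K f) <= nm f.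
Proof.
by move=> lK K0; have := seminorm_lip1 lK f 0; rewrite K0 !subr0.
Qed.

Lemma relax_gap_dist f g : nm ((M f - f) - (M g - g)) <= 2 * nm (f - g).
Proof.
have -> : (M f - f) - (M g - g) = (M f - M g) - (f - g).
  by rewrite !opprD addrACA.
rewrite (le_trans (seminormB _ _))// mulr_natl mulr2n lerD2r.
exact: seminorm_lip1.
Qed.

Lemma relax_gap_le f : nm (M f - f) <= 2 * nm f.
Proof. by have := relax_gap_dist f 0; rewrite M0 !subr0. Qed.

Lemma bv_modulus_gap B f : bv_modulus B f -> bv_modulus (2 * B) (M f - f).
Proof.
move=> Bf; apply: (bv_modulus_lip (K := fun f => M f - f)) => //.
  exact: relax_gap_dist.
by move=> y g; rewrite MT linearB.
Qed.

Section Step.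
Variable tau : R.
Hypothesis tau0 : 0 <= tau.
Hypothesis mutau1 : mu * tau <= 1.

(** For [mu * tau <= 1] the Euler relaxation is a convex combination of the identity and [M], hence
    a contraction however large [mu] is. *)
Lemma splitting_lip : seminorm_lip 1 (splitting tau).
Proof.
move=> f g; rewrite /splitting shift_isom_dist mul1r.
have -> : f + (mu * tau) *: (M f - f) - (g + (mu * tau) *: (M g - g)) =
  (1 - mu * tau) *: (f - g) + (mu * tau) *: (M f - M g).
  rewrite opprD addrACA -scalerBr scalerBl scale1r -addrA.
  rewrite addrA -[RHS]addrA; congr (_ + _).
  rewrite -scalerN -scalerDr; congr (_ *: _).
  by rewrite !opprB addrACA [RHS]addrACA (addrC g).
rewrite (le_trans (seminorm_convex _ _ _))//; first by rewrite mulr_ge0.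
have := ler_wpM2l (mulr_ge0 mu0 tau0) (seminorm_lip1 lM f g).
by lra.
Qed.

Lemma splitting0 : splitting tau 0 = 0.
Proof. by rewrite /splitting M0 subr0 scaler0 addr0 linear0. Qed.

Lemma splitting_Tr y g : splitting tau (Tr y g) = Tr y (splitting tau g).
Proof. by rewrite /splitting MT -raddfB -linearZZ -raddfD TrSh. Qed.

Lemma iter_splitting_le i f : nm (iter i (splitting tau) f) <= nm f.
Proof.
apply: contraction_le; first exact/seminorm_lip1_iter/splitting_lip.
by elim: i => // i IH; rewrite iterS IH splitting0.
Qed.

Lemma iter_splitting_bv i B f : bv_modulus B f ->
  bv_modulus B (iter i (splitting tau) f).
Proof.
move=> Bf; rewrite -(mul1r B); apply: bv_modulus_lip => //.
  exact/seminorm_lip1_iter/splitting_lip.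
by move=> y; elim: i => // i IH g; rewrite !iterS IH splitting_Tr.
Qed.

Lemma splitting_displacement B0 B1 f : nm f <= B0 -> bv_modulus B1 f ->
  nm (splitting tau f - f) <= 2 * tau * (mu * B0 + sp * B1).
Proof.
move=> fB0 fB1; rewrite /splitting linearD/= addrAC addrC.
have B1_ge0 := bv_modulus_ge0 fB1.
have B0_ge0 : 0 <= B0 by rewrite (le_trans _ fB0)// seminorm_ge0.
rewrite (le_trans (nmD _ _))//.
rewrite nmSh nmZ ger0_norm ?mulr_ge0//.
have h1 := relax_gap_le f.
have h2 := bv_modulusSh (sp * tau) fB1.
rewrite ger0_norm ?mulr_ge0// in h2.
have h3 : mu * tau * nm (M f - f) <= mu * tau * (2 * B0).
  by rewrite ler_wpM2l ?mulr_ge0// (le_trans h1)// ler_wpM2l.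
have h4 : 0 <= sp * B1 * tau by rewrite !mulr_ge0.
by lra.
Qed.

(** The expansion depends on [i] and [tau] only through the elapsed time [i * tau], so steps of
    different lengths can be compared through it. The constant [4] makes the induction close: the
    square grows by [8 i + 4], while the new terms need [4 i] in front of [mu * B0] and [6 i + 2] in
    front of [sp * B1]. *)
Lemma iter_splitting_expansion B0 B1 f i : nm f <= B0 -> bv_modulus B1 f ->
  nm (iter i (splitting tau) f
      - (Sh (i%:R * (sp * tau)) f + (i%:R * (mu * tau)) *: (M f - f)))
  <= 4 * (i%:R * tau) ^+ 2 * mu * (mu * B0 + sp * B1).
Proof.
move=> fB0 fB1; have B1_ge0 := bv_modulus_ge0 fB1.
have B0_ge0 : 0 <= B0 by rewrite (le_trans _ fB0)// seminorm_ge0.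
elim: i => [|i IH].
  by rewrite !mul0r Sh0 scale0r addr0 subrr seminorm0 expr0n/= mulr0 !mul0r.
rewrite iterS; move: IH; set g := iter i _ f => IH.
have gf : nm (g - f) <= i%:R * (2 * tau * (mu * B0 + sp * B1)).
  rewrite (le_trans (iter_displacement _ _ splitting_lip))// ler_wpM2l//.
  exact: splitting_displacement.
set b := mu * tau; set y := sp * tau.
have b0 : 0 <= b by rewrite mulr_ge0.
have y0 : 0 <= y by rewrite mulr_ge0.
(* The previous error is transported isometrically. What is added is the effect of the shift on the
   accumulated relaxation, and the replacement of the gap at [g], shifted, by the gap at [f]. *)
have -> : splitting tau g - (Sh (i.+1%:R * y) f + (i.+1%:R * b) *: (M f - f)) =
  Sh y (g - (Sh (i%:R * y) f + (i%:R * b) *: (M f - f)))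
  + ((i%:R * b) *: (Sh y (M f - f) - (M f - f))
     + b *: ((Sh y (M g - g) - Sh y (M f - f)) + (Sh y (M f - f) - (M f - f)))).
  rewrite /splitting -/b -/y; move: (M f - f) (M g - g) => u v.
  rewrite subrKA (raddfD (Sh y) g) (raddfB (Sh y) g) (raddfD (Sh y))/=.
  rewrite !linearZZ -ShD -natr1.
  rewrite [in LHS]mulrDl [in LHS]mulrDl !mul1r (addrC y) scalerDl !scalerBr.
  rewrite !opprD -!addrA; congr (_ + _).
  rewrite addKr addrCA; congr (_ + _).
  by rewrite addrCA.
have hgap : nm (Sh y (M f - f) - (M f - f)) <= 2 * B1 * y.
  have := bv_modulusSh y (bv_modulus_gap fB1).
  by rewrite (ger0_norm y0).
have hg : nm (Sh y (M g - g) - Sh y (M f - f)) <= 2 * nm (g - f).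
  by rewrite shift_isom_dist relax_gap_dist.
rewrite (le_trans (nmD _ _))// nmSh (le_trans (lerD IH (nmD _ _)))//.
rewrite !nmZ !ger0_norm ?mulr_ge0//.
have h1 : i%:R * b * nm (Sh y (M f - f) - (M f - f)) <= i%:R * b * (2 * B1 * y).
  by rewrite ler_wpM2l ?mulr_ge0.
have h2 : b * nm ((Sh y (M g - g) - Sh y (M f - f)) + (Sh y (M f - f) - (M f - f)))
    <= b * (2 * (i%:R * (2 * tau * (mu * B0 + sp * B1))) + 2 * B1 * y).
  rewrite ler_wpM2l// (le_trans (nmD _ _))// lerD// (le_trans hg)//.
  by rewrite ler_wpM2l.
apply: (le_trans (lerD (lexx _) (lerD h1 h2))).
rewrite -[i.+1%:R]natr1 -subr_ge0 /b /y; set n := i%:R.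
have -> : 4 * ((n + 1) * tau) ^+ 2 * mu * (mu * B0 + sp * B1) -
  (4 * (n * tau) ^+ 2 * mu * (mu * B0 + sp * B1) +
   (n * (mu * tau) * (2 * B1 * (sp * tau)) +
    mu * tau * (2 * (n * (2 * tau * (mu * B0 + sp * B1))) + 2 * B1 * (sp * tau)))) =
  mu * tau ^+ 2 * ((4 * n + 4) * (mu * B0) + (2 * n + 2) * (sp * B1)) by ring.
have n0 : 0 <= n by rewrite /n.
by rewrite !(mulr_ge0, addr_ge0, sqr_ge0).
Qed.

Variables (Z : V -> V) (dt eta B0 B1 : R) (f0 : V) (m : nat -> nat).
Hypothesis lZ : seminorm_lip 1 Z.
Hypothesis dt0 : 0 <= dt.
Hypothesis eta0 : 0 <= eta.
Hypothesis f0B0 : nm f0 <= B0.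
Hypothesis f0B1 : bv_modulus B1 f0.
Hypothesis cZ : forall f, nm f <= B0 -> bv_modulus B1 f ->
  nm (Z f - (Sh (sp * dt) f + (mu * dt) *: (M f - f)))
  <= 4 * dt ^+ 2 * mu * (mu * B0 + sp * B1).
Hypothesis m0 : m 0%N = 0%N.
Hypothesis mS : forall n, (m n <= m n.+1)%N.
Hypothesis m_eta : forall n, `|(m n.+1 - m n)%:R * tau - dt| <= eta.

Lemma consistent_splitting_error n :
  nm (iter n Z f0 - iter (m n) (splitting tau) f0) <=
  n%:R * (8 * (dt + eta) ^+ 2 * mu * (mu * B0 + sp * B1)
          + 2 * eta * (mu * B0 + sp * B1)).
Proof.
have B1_ge0 := bv_modulus_ge0 f0B1.
have B0_ge0 : 0 <= B0 by rewrite (le_trans _ f0B0)// seminorm_ge0.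
elim: n => [|n IH]; first by rewrite m0 subrr seminorm0 mul0r.
set D := mu * B0 + sp * B1 in IH *.
have D0 : 0 <= D by rewrite addr_ge0// mulr_ge0.
rewrite iterS -(subnK (mS n)) iterD.
move: IH; set g := iter (m n) _ f0 => IH.
have gB0 : nm g <= B0 by rewrite (le_trans (iter_splitting_le _ _)).
have gB1 : bv_modulus B1 g by exact: iter_splitting_bv.
rewrite (le_trans (seminorm_triangle (Z g) _ _))// -natr1 mulrDl mul1r.
rewrite lerD//; first by rewrite (le_trans (seminorm_lip1 lZ _ _)).
have := m_eta n; move: (m n.+1 - m n)%N => i hi.
have hZ := cZ gB0 gB1; rewrite -/D in hZ.
have hX := iter_splitting_expansion i gB0 gB1; rewrite -/D in hX.
rewrite (le_trans (seminorm_triangle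
  (Sh (sp * dt) g + (mu * dt) *: (M g - g)) _ _))//.
rewrite (le_trans (lerD (lexx _) (seminorm_triangle
  (Sh (i%:R * (sp * tau)) g + (i%:R * (mu * tau)) *: (M g - g)) _ _)))//.
rewrite (seminorm_distC _ (iter i _ _)).
have hd : nm (Sh (sp * dt) g + (mu * dt) *: (M g - g) -
   (Sh (i%:R * (sp * tau)) g + (i%:R * (mu * tau)) *: (M g - g)))
   <= 2 * eta * D.
  rewrite opprD addrACA -scalerBl (le_trans (nmD _ _))// nmZ.
  have -> : sp * dt = i%:R * (sp * tau) + sp * (dt - i%:R * tau) by ring.
  rewrite ShD shift_isom_dist.
  have -> : mu * dt - i%:R * (mu * tau) = mu * (dt - i%:R * tau) by ring.
  have h1 := bv_modulusSh (sp * (dt - i%:R * tau)) gB1.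
  rewrite distrC in hi.
  have h2 := le_trans (relax_gap_le g) (ler_wpM2l (ler0n _ _) gB0).
  rewrite normrM (ger0_norm sp0) in h1.
  rewrite normrM (ger0_norm mu0).
  have h3 : B1 * (sp * `|dt - i%:R * tau|) <= B1 * (sp * eta).
    by rewrite !ler_wpM2l.
  have h4 : mu * `|dt - i%:R * tau| * nm (M g - g) <= mu * eta * (2 * B0).
    by rewrite ler_pM// ?mulr_ge0 ?seminorm_ge0 ?ler_wpM2l.
  apply: (le_trans (lerD (le_trans h1 h3) h4)).
  have h5 : 0 <= eta * (sp * B1) by rewrite !mulr_ge0.
  by rewrite /D; lra.
have itau : 0 <= i%:R * tau by rewrite mulr_ge0.
have hsq1 : (i%:R * tau) ^+ 2 <= (dt + eta) ^+ 2.
  rewrite ler_sqr ?nnegrE ?addr_ge0//.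
  by move: hi; rewrite ler_distl => /andP[_]; rewrite addrC.
have hsq2 : dt ^+ 2 <= (dt + eta) ^+ 2.
  by rewrite ler_sqr ?nnegrE ?addr_ge0// lerDl.
have muD : 0 <= mu * D by rewrite mulr_ge0.
have h1 := ler_wpM2r muD hsq1; have h2 := ler_wpM2r muD hsq2.
by lra.
Qed.

End Step.

Lemma splitting_consistent (tau B0 B1 : R) f : 0 <= tau -> 0 <= B0 ->
  bv_modulus B1 f ->
  nm (splitting tau f - (Sh (sp * tau) f + (mu * tau) *: (M f - f)))
  <= 4 * tau ^+ 2 * mu * (mu * B0 + sp * B1).
Proof.
move=> tau0 B0_ge0 fB1; have B1_ge0 := bv_modulus_ge0 fB1.
rewrite /splitting raddfD/= opprD addrACA subrr add0r linearZZ -scalerBr nmZ.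
rewrite ger0_norm ?mulr_ge0//.
have := bv_modulusSh (sp * tau) (bv_modulus_gap fB1).
rewrite (ger0_norm (mulr_ge0 sp0 tau0)).
move=> /(ler_wpM2l (mulr_ge0 mu0 tau0)) /le_trans; apply.
rewrite -subr_ge0.
have -> : 4 * tau ^+ 2 * mu * (mu * B0 + sp * B1) -
  mu * tau * (2 * B1 * (sp * tau)) =
  tau ^+ 2 * mu * (4 * (mu * B0) + 2 * (sp * B1)) by ring.
by rewrite !(mulr_ge0, addr_ge0, sqr_ge0).
Qed.

(** Transport comes before relaxation here, the reverse of [splitting]. Moving the gap from the
    shifted state back to [f] costs [mu * dt] times a translation by [sp * dt], which is again of
    second order. *)
Lemma relaxation_consistent Rl (dt B0 B1 : R) f : 0 <= dt -> nm f <= B0 ->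
  bv_modulus B1 f ->
  (forall g, nm (Rl g - (g + (mu * dt) *: (M g - g)))
             <= 4 * (mu * dt) ^+ 2 * nm g) ->
  nm (Rl (Sh (sp * dt) f) - (Sh (sp * dt) f + (mu * dt) *: (M f - f)))
  <= 4 * dt ^+ 2 * mu * (mu * B0 + sp * B1).
Proof.
move=> dt0 fB0 fB1 hRl; have B1_ge0 := bv_modulus_ge0 fB1.
set g := Sh (sp * dt) f.
rewrite (le_trans (seminorm_triangle (g + (mu * dt) *: (M g - g)) _ _))//.
rewrite [in X in _ + X]opprD [in X in _ + X]addrACA subrr add0r -scalerBr nmZ.
rewrite ger0_norm ?mulr_ge0//.
have h1 : nm (M g - g - (M f - f)) <= 2 * (B1 * (sp * dt)).
  rewrite (le_trans (relax_gap_dist _ _))// ler_wpM2l//.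
  by rewrite (le_trans (bv_modulusSh _ fB1))// ger0_norm ?mulr_ge0.
have h2 : nm (Rl g - (g + (mu * dt) *: (M g - g))) <= 4 * (mu * dt) ^+ 2 * B0.
  by rewrite (le_trans (hRl g))// ler_wpM2l ?nmSh// mulr_ge0// sqr_ge0.
have h3 := ler_wpM2l (mulr_ge0 mu0 dt0) h1.
apply: (le_trans (lerD h2 h3)).
have : 0 <= dt ^+ 2 * mu * (sp * B1) by rewrite !(mulr_ge0, sqr_ge0).
by lra.
Qed.

End Splitting.
End SplittingInSeminormedSpace.

(** * Integrable functions on the line *)

Section Translation.
Context (R : realType).
Local Notation mu := (@lebesgue_measure R).

Lemma lebesgue_measure_translation (y : R) (A : set R) : measurable A ->
  pushforward mu (fun x : measurableTypeR R => x + y : measurableTypeR R) A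
  = mu A.
Proof.
move=> mA; apply/esym.
have my : measurable_fun [set: R] (fun x : R => x + y).
  exact: measurable_funD.
pose h : {mfun measurableTypeR R >-> measurableTypeR R} :=
  HB.pack (fun x : measurableTypeR R => x + y : measurableTypeR R)
    (isMeasurableFun.Build _ _ (measurableTypeR R) (measurableTypeR R)
      (fun x : measurableTypeR R => x + y : measurableTypeR R) my).
apply: (@lebesgue_measure_unique R (pushforward mu h)) => //.
move=> _ [[a b]] _ <-; rewrite /pushforward/=.
have hE : (fun x : R => x + y) @^-1` `]a, b] = `]a - y, b - y]%classic.
  by apply/seteqP; split=> x /=; rewrite !in_itv/= ltrBlDr lerBrDr.
rewrite [X in _ = mu X]hE !lebesgue_measure_itv/= !lte_fin ltrD2r.
by case: ifP => // _; rewrite -!EFinD; congr _%:E; ring.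
Qed.

Lemma ge0_integral_translation (y : R) (f : R -> \bar R) :
  measurable_fun [set: R] f -> (forall x, 0 <= f x)%E ->
  (\int[mu]_x f (x + y)%R = \int[mu]_x f x)%E.
Proof.
move=> mf f0.
have my : measurable_fun [set: R] (fun x : R => x + y).
  exact: measurable_funD.
rewrite -[RHS](@eq_measure_integral _ _ _ _ mu (pushforward mu
  (fun x : measurableTypeR R => x + y : measurableTypeR R))); last first.
  by move=> A mA _; exact: lebesgue_measure_translation.
by rewrite ge0_integral_pushforward.
Qed.

Lemma integral_translation (y : R) (f : R -> \bar R) :
  mu.-integrable setT f -> (\int[mu]_x f (x + y)%R = \int[mu]_x f x)%E.
Proof.
move=> intf; have mf := measurable_int _ intf.
rewrite integralE [RHS]integralE; congr (_ - _)%E.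
  rewrite -[RHS](@ge0_integral_translation y)//; last exact: measurable_funepos.
  by apply: eq_integral => x _; rewrite !funeposE.
rewrite -[RHS](@ge0_integral_translation y)//; last exact: measurable_funeneg.
by apply: eq_integral => x _; rewrite !funenegE.
Qed.

Lemma integrable_translation (y : R) (f : R -> \bar R) :
  mu.-integrable setT f -> mu.-integrable setT (fun x => f (x + y)).
Proof.
move=> /integrableP[mf foo]; apply/integrableP; split.
  have my : measurable_fun [set: R] (fun x : R => x + y).
    exact: measurable_funD.
  exact: (measurableT_comp (mf : measurable_fun [set: R] f) my).
by rewrite (@ge0_integral_translation y (fun x => `|f x|)%E)//; exact: measurableT_comp.
Qed.

End Translation.

Section L1Line.
Context (R : realType).
Local Notation mu := (@lebesgue_measure R).

(** Genuine functions, not classes: [N1] is then only a seminorm, but values at points remain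
    available. *)
Record L1 := mkL1 {
  fn :> R -> R;
  L1_integrable : mu.-integrable setT (EFin \o fn) }.

Lemma L1_ext (f g : L1) : (forall x, f x = g x) -> f = g.
Proof.
case: f g => [f fi] [g gi] /= /funext fg; rewrite fg in fi *.
by congr mkL1; exact: Prop_irrelevance.
Qed.

HB.instance Definition _ := gen_eqMixin L1.
HB.instance Definition _ := gen_choiceMixin L1.

Lemma L10_subproof : mu.-integrable setT (EFin \o (fun _ : R => 0 : R)).
Proof. exact: integrable0. Qed.
Lemma L1D_subproof (f g : L1) :
  mu.-integrable setT (EFin \o (fun x => f x + g x)).
Proof. by apply: (integrableD _ (L1_integrable f) (L1_integrable g)). Qed.
Lemma L1Z_subproof (c : R) (f : L1) :
  mu.-integrable setT (EFin \o (fun x => c * f x)).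
Proof. by apply: (integrableZl _ c (L1_integrable f)). Qed.
Lemma L1N_subproof (f : L1) : mu.-integrable setT (EFin \o (fun x => - f x)).
Proof. by apply: (integrableN (L1_integrable f)). Qed.

Definition L1zero := mkL1 L10_subproof.
Definition L1add f g := mkL1 (L1D_subproof f g).
Definition L1opp f := mkL1 (L1N_subproof f).
Definition L1scale c f := mkL1 (L1Z_subproof c f).

Lemma L1addA : associative L1add.
Proof. by move=> f g h; apply: L1_ext => x /=; rewrite addrA. Qed.
Lemma L1addC : commutative L1add.
Proof. by move=> f g; apply: L1_ext => x /=; rewrite addrC. Qed.
Lemma L1add0 : left_id L1zero L1add.
Proof. by move=> f; apply: L1_ext => x /=; rewrite add0r. Qed.
Lemma L1addN : left_inverse L1zero L1opp L1add.
Proof. by move=> f; apply: L1_ext => x /=; rewrite addNr. Qed.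

HB.instance Definition _ :=
  GRing.isZmodule.Build L1 L1addA L1addC L1add0 L1addN.

Lemma L1scaleA c d f : L1scale c (L1scale d f) = L1scale (c * d) f.
Proof. by apply: L1_ext => x /=; rewrite mulrA. Qed.
Lemma L1scale1 : left_id 1 L1scale.
Proof. by move=> f; apply: L1_ext => x /=; rewrite mul1r. Qed.
Lemma L1scaleDr : right_distributive L1scale +%R.
Proof. by move=> c f g; apply: L1_ext => x /=; rewrite mulrDr. Qed.
Lemma L1scaleDl f : {morph L1scale^~ f : c d / c + d}.
Proof. by move=> c d; apply: L1_ext => x /=; rewrite mulrDl. Qed.

HB.instance Definition _ := GRing.Zmodule_isLmodule.Build R L1
  L1scaleA L1scale1 L1scaleDr L1scaleDl.

Lemma L1D (f g : L1) x : (f + g) x = f x + g x.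
Proof. by []. Qed.

Lemma L1Z (c : R) (f : L1) x : (c *: f) x = c * f x.
Proof. by []. Qed.

Lemma L1N (f : L1) x : (- f) x = - f x.
Proof. by []. Qed.

Definition N1 (f : R -> R) : R := \int[mu]_x `|f x|.

Lemma N1_ge0 f : 0 <= N1 f.
Proof. exact: Rintegral_ge0. Qed.

Lemma L1_abs (f : L1) : mu.-integrable setT (fun x => `|f x|%:E).
Proof. exact/integrable_norm/L1_integrable. Qed.

Lemma EFin_N1 (f : L1) : (N1 f)%:E = (\int[mu]_x `|f x|%:E)%E.
Proof. by rewrite /N1 /Rintegral fineK//; exact/integrable_fin_num/L1_abs. Qed.

Lemma N1_leD (f g h : L1) (c : R) : 0 <= c ->
  (forall x, `|h x| <= c * (`|f x| + `|g x|)) -> N1 h <= c * (N1 f + N1 g).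
Proof.
move=> c0 hfg; rewrite /N1 -RintegralD//; try exact: L1_abs.
have ifg : mu.-integrable setT (fun x => (`|f x| + `|g x|)%:E).
  by apply: (integrableD _ (L1_abs f) (L1_abs g)).
rewrite -RintegralZl//; apply: le_Rintegral => //; first exact: L1_abs.
by apply: (integrableZl _ c ifg).
Qed.

Lemma N1D (f g : L1) : N1 (f + g) <= N1 f + N1 g.
Proof.
rewrite -[leRHS]mul1r; apply: N1_leD => // x.
by rewrite mul1r L1D ler_normD.
Qed.

Lemma N1Z (c : R) (f : L1) : N1 (c *: f) = `|c| * N1 f.
Proof.
rewrite /N1 -RintegralZl//; last exact: L1_abs.
by apply: eq_Rintegral => x _; rewrite L1Z normrM.
Qed.

Lemma shift1_subproof (y : R) (f : L1) :
  mu.-integrable setT (EFin \o (fun x => f (x + y))).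
Proof. exact: (integrable_translation y (L1_integrable f)). Qed.

Definition shift1 (y : R) (f : L1) : L1 := mkL1 (shift1_subproof y f).

Lemma shift1E y f x : shift1 y f x = f (x + y).
Proof. by []. Qed.

Lemma N1_shift y f : N1 (shift1 y f) = N1 f.
Proof.
apply: EFin_inj; rewrite !EFin_N1.
rewrite -[RHS](@ge0_integral_translation _ y)//.
exact: (measurable_int _ (L1_abs f)).
Qed.

Lemma shift1_linear y : linear (shift1 y).
Proof. by move=> c f g; apply: L1_ext => x; rewrite !(shift1E, L1D, L1Z). Qed.

Definition LL : Type := (L1 * L1)%type.
HB.instance Definition _ := GRing.Lmodule.on LL.

Definition N2 (f : LL) : R := N1 f.1 + N1 f.2.

Lemma N2D (f g : LL) : N2 (f + g) <= N2 f + N2 g.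
Proof. by rewrite /N2 addrACA lerD// N1D. Qed.

Lemma N2Z (c : R) (f : LL) : N2 (c *: f) = `|c| * N2 f.
Proof. by rewrite /N2 !N1Z mulrDr. Qed.

Definition shift2 (y z : R) (f : LL) : LL := (shift1 y f.1, shift1 z f.2).

Lemma shift2_linear y z : linear (shift2 y z).
Proof. by move=> c f g; congr pair; exact: shift1_linear. Qed.

HB.instance Definition _ y z :=
  GRing.isLinear.Build R LL LL _ (shift2 y z) (shift2_linear y z).

(* The two Riemann components travel in opposite directions under [Sh] and in
   the same direction under [Tr]. *)
Definition Sh (y : R) : {linear LL -> LL} := shift2 (- y) y.
Definition Tr (y : R) : {linear LL -> LL} := shift2 (- y) (- y).

Lemma L1_distC (f g : L1) : N1 (f - g) = N1 (g - f).
Proof. by apply: eq_Rintegral => x _; rewrite !L1D !L1N distrC. Qed.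

Lemma Sh0 f : Sh 0 f = f.
Proof.
by case: f => f g; congr pair; apply: L1_ext => x; rewrite shift1E ?oppr0 addr0.
Qed.

Lemma ShD y z f : Sh (y + z) f = Sh y (Sh z f).
Proof.
by congr pair; apply: L1_ext => x; rewrite !shift1E; congr (fn _ _); ring.
Qed.

Lemma N2_Sh y f : N2 (Sh y f) = N2 f.
Proof. by rewrite /N2/= !N1_shift. Qed.

Lemma Tr_Sh y z f : Tr y (Sh z f) = Sh z (Tr y f).
Proof.
by congr pair; apply: L1_ext => x; rewrite !shift1E; congr (fn _ _); ring.
Qed.

(** Only the second component is displaced differently, and by translation invariance displacements
    by [y] and [- y] give the same [L^1] distance. *)
Lemma N2_Sh_Tr y f : N2 (Sh y f - f) = N2 (Tr y f - f).
Proof.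
suff h : N1 (shift1 y f.2 - f.2) = N1 (shift1 (- y) f.2 - f.2).
  by rewrite /N2; congr (_ + _).
rewrite -(N1_shift (- y)) L1_distC; congr (N1 (fn _)); apply: L1_ext => x.
by rewrite !(shift1E, L1D, L1N) subrK.
Qed.

End L1Line.

(** * Pointwise maps on pairs of integrable functions *)

Section PlaneMeasurability.
Context (R : realType).

(** Measurability here refers to the product sigma-algebra: countably many squares with rational
    centres and radii [1 / n.+1] suffice to cover [A] from inside. *)
Lemma open_measurable_plane (A : set (R * R)) : open A -> measurable A.
Proof.
move=> oA.
pose rect (q r : rat) (n : nat) : set (R * R) :=
  ball (ratr q : R) n.+1%:R^-1 `*` ball (ratr r : R) n.+1%:R^-1.
pose S (q r : rat) n := if `[< rect q r n `<=` A >] then rect q r n else set0.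
suff -> : A = \bigcup_(q : rat) \bigcup_(r : rat) \bigcup_n S q r n.
  apply: bigcupT_measurable_rat => q; apply: bigcupT_measurable_rat => r.
  apply: bigcupT_measurable => n; rewrite /S; case: ifP => // _.
  by apply: measurableX; exact: measurable_ball.
apply/seteqP; split=> [[x y] Axy|[x y] [q _ [r _ [n _]]]]; last first.
  by rewrite /S; case: ifP => // /asboolP; apply.
have /nbhs_ballP[e /= e0 eA] := open_nbhs_nbhs (conj oA Axy).
(* The rational centre lies within [1 / n.+1] of the point and the square has that same radius, so
   twice [1 / n.+1] must stay below [e]. *)
pose n := Num.truncn (2 / e).
have ne : n.+1%:R^-1 < e / 2 :> R.
  rewrite -[ltRHS]invrK invf_div ltf_pV2 ?posrE ?divr_gt0//.
  by rewrite truncnS_gt.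
have n0 : 0 < n.+1%:R^-1 :> R by [].
have near_rat (z : R) : exists q : rat, `|ratr q - z| < n.+1%:R^-1.
  have [|q] := @rat_in_itvoo R (z - n.+1%:R^-1) (z + n.+1%:R^-1).
    by rewrite ltrD2l gtrN.
  by rewrite in_itv/= => hq; exists q; rewrite ltr_distl.
have [q hq] := near_rat x; have [r hr] := near_rat y.
exists q => //; exists r => //; exists n => //; rewrite /S.
have -> : `[< rect q r n `<=` A >] = true.
  apply/asboolP => -[x' y'] []; rewrite /ball/= => hx hy.
  apply: eA; split; rewrite /ball/=.
    rewrite distrC in hx; rewrite distrC.
    by rewrite (le_lt_trans (ler_distD (ratr q) _ _))// [e]splitr ltrD// (lt_trans _ ne).
  rewrite distrC in hy; rewrite distrC.
  by rewrite (le_lt_trans (ler_distD (ratr r) _ _))// [e]splitr ltrD// (lt_trans _ ne).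
by split; rewrite /ball/=.
Qed.

Lemma closed_measurable_plane (A : set (R * R)) : closed A -> measurable A.
Proof. by move/closed_openC/open_measurable_plane/measurableC; rewrite setCK. Qed.

Lemma continuous_measurable_plane (f : R * R -> R) :
  continuous f -> measurable_fun setT f.
Proof.
move=> /continuousP cf; apply: (measurability _ (RGenOpens.measurableE R)).
move=> _ [_ [a [b ->] <-]]; rewrite setTI; apply: open_measurable_plane.
exact/cf/interval_open.
Qed.

End PlaneMeasurability.

Section Nemytskii.
Context (R : realType).
Implicit Types (z : R * R) (f g : LL R).
Local Notation mu := (@lebesgue_measure R).

Definition l1 z : R := `|z.1| + `|z.2|.

Definition l1_lip (c : R) (rho : R * R -> R * R) := forall z w, l1 (rho z - rho w) <= c * l1 (z - w).

Lemma l1_ge0 z : 0 <= l1 z. Proof. exact: addr_ge0. Qed.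

Lemma l1_lip_continuous c rho : l1_lip c rho -> continuous rho.
Proof.
move=> lrho z; apply/cvg_ballP => e e0.
have c0 : 0 < `|c| + 1 by rewrite ltr_wpDl.
near=> w.
have : l1 (z - w) < e / (`|c| + 1).
  have [h1 h2] : ball z (e / (`|c| + 1) / 2) w.
    near: w; set d := e / _ / 2.
    have d0 : 0 < d by rewrite !divr_gt0.
    by exists (ball z.1 d, ball z.2 d); first by split; exact: nbhsx_ballx.
  by rewrite [ltRHS]splitr ltrD.
rewrite ltr_pdivlMr// => hw.
have : l1 (rho z - rho w) < e.
  rewrite (le_lt_trans (lrho _ _))// (le_lt_trans _ hw)// mulrC ler_wpM2l ?l1_ge0//.
  by rewrite (le_trans (ler_norm c))// lerDl.
move=> h; split; rewrite /ball/= (le_lt_trans _ h)//.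
  by rewrite lerDl.
by rewrite lerDr.
Unshelve. all: by end_near. Qed.

Lemma l1_lip_le c rho z : l1_lip c rho -> rho 0 = 0 -> l1 (rho z) <= c * l1 z.
Proof. by move=> lrho rho0; have := lrho z 0; rewrite rho0 !subr0. Qed.

Section Lift.
Variables (c : R) (rho : R * R -> R * R).
Hypotheses (c0 : 0 <= c) (lrho : l1_lip c rho) (rho0 : rho 0 = 0).

Lemma measurable_fun_pair_LL f :
  measurable_fun [set: R] (fun x => (f.1 x, f.2 x)).
Proof.
apply: measurable_fun_pair; apply/measurable_EFinP.
  exact: (measurable_int _ (L1_integrable f.1)).
exact: (measurable_int _ (L1_integrable f.2)).
Qed.

Lemma integrable_lift (pi : R * R -> R) f :
  continuous pi -> (forall z, `|pi z| <= l1 z) ->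
  mu.-integrable setT (EFin \o (fun x => pi (rho (f.1 x, f.2 x)))).
Proof.
move=> cpi lpi.
apply: (@le_integrable _ (measurableTypeR R) R mu setT measurableT _
  (fun x => (c * (`|f.1 x| + `|f.2 x|))%:E)).
- apply/measurable_EFinP.
  apply: (measurableT_comp (f := pi \o rho)); last exact: measurable_fun_pair_LL.
  apply: continuous_measurable_plane => z; apply: continuous_comp; last exact: cpi.
  exact: l1_lip_continuous lrho z.
- move=> x _ /=; rewrite lee_fin (le_trans (lpi _))//.
  rewrite (le_trans (l1_lip_le _ lrho rho0))//.
  by rewrite ger0_norm// mulr_ge0// addr_ge0.
- have h : mu.-integrable setT (fun x => (`|f.1 x| + `|f.2 x|)%:E).
    by apply: (integrableD _ (L1_abs f.1) (L1_abs f.2)).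
  by apply: (integrableZl _ c h).
Qed.

Lemma lift1_subproof f :
  mu.-integrable setT (EFin \o (fun x => (rho (f.1 x, f.2 x)).1)).
Proof.
apply: (integrable_lift f (pi := fst)); first by move=> z; exact: cvg_fst.
by move=> z; rewrite /l1 lerDl.
Qed.

Lemma lift2_subproof f :
  mu.-integrable setT (EFin \o (fun x => (rho (f.1 x, f.2 x)).2)).
Proof.
apply: (integrable_lift f (pi := snd)); first by move=> z; exact: cvg_snd.
by move=> z; rewrite /l1 lerDr.
Qed.

(** Superposition operator; [rho 0 = 0] and the Lipschitz bound keep the composition integrable over
    the whole line. *)
Definition lift f : LL R := (mkL1 (lift1_subproof f), mkL1 (lift2_subproof f)).

Lemma liftE f x : ((lift f).1 x, (lift f).2 x) = rho (f.1 x, f.2 x).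
Proof. by rewrite /=; case: (rho _). Qed.

Lemma lift_Tr y f : lift (Tr y f) = Tr y (lift f).
Proof. by congr pair; apply: L1_ext. Qed.

End Lift.

Lemma N2_le_l1 (c : R) f g : 0 <= c ->
  (forall x, l1 (f.1 x, f.2 x) <= c * l1 (g.1 x, g.2 x)) -> N2 f <= c * N2 g.
Proof.
move=> c0 h; rewrite /N2 /N1 -!RintegralD//; try exact: L1_abs.
have ig : mu.-integrable setT (fun x => (`|g.1 x| + `|g.2 x|)%:E).
  by apply: (integrableD _ (L1_abs g.1) (L1_abs g.2)).
rewrite -RintegralZl//; apply: le_Rintegral => //.
- by apply: (integrableD _ (L1_abs f.1) (L1_abs f.2)).
- by apply: (integrableZl _ c ig).
- by move=> x _; exact: h.
Qed.

Lemma lift_lip (c : R) (rho : R * R -> R * R) c0 lrho rho0 :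
  seminorm_lip (@N2 R) c (@lift c rho c0 lrho rho0).
Proof.
move=> f g; apply: N2_le_l1 => // x.
have := lrho (f.1 x, f.2 x) (g.1 x, g.2 x).
by rewrite /l1/=.
Qed.

End Nemytskii.

(** * Limits superior, step functions and invariant bounds *)

Section BoundedLimsup.
Context (R : realType).
Implicit Types u : R^nat.

(** The bound [K] makes the real suprema and infima inside [limn_sup] genuine rather than default
    values. *)
Lemma limn_sup_le u (K B : R) k : (forall n, `|u n| <= K) ->
  (forall n, (k <= n)%N -> u n <= B) -> limn_sup u <= B.
Proof.
move=> uK uB; rewrite limn_supE; last first.
  by exists K; split; rewrite ?num_real// => M KM n _ /=; rewrite (le_trans (uK n))// ltW.
apply: (@le_trans _ _ (sups u k)).
  apply: ge_inf; last by exists k.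
  exists (- K) => _ [n _ <-]; apply: (@le_trans _ _ (u n)).
    by have := uK n; rewrite ler_norml => /andP[].
  apply: ub_le_sup; last by exists n => /=.
  by exists K => _ [m _ <-]; have := uK m; rewrite ler_norml => /andP[].
apply: ge_sup; first by exists (u k), k => /=.
by move=> _ [n /= kn <-]; exact: uB.
Qed.

Lemma limn_sup_ge u (K B : R) k : (forall n, `|u n| <= K) ->
  (forall n, (k <= n)%N -> B <= u n) -> B <= limn_sup u.
Proof.
move=> uK uB; rewrite limn_supE; last first.
  by exists K; split; rewrite ?num_real// => M KM n _ /=; rewrite (le_trans (uK n))// ltW.
apply: lb_le_inf; first by exists (sups u 0), 0%N.
move=> _ [n _ <-]; apply: (@le_trans _ _ (u (maxn n k))).
  by apply: uB; exact: leq_maxr.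
apply: ub_le_sup; last by exists (maxn n k) => //=; exact: leq_maxl.
by exists K => _ [m _ <-]; have := uK m; rewrite ler_norml => /andP[].
Qed.

Lemma limn_sup_dist u (K r : R) k : (forall n, `|u n| <= K) ->
  (forall n, (k <= n)%N -> `|u n - u k| <= r) -> `|limn_sup u - u k| <= r.
Proof.
move=> uK ur; rewrite ler_distl; apply/andP; split.
  by apply: (limn_sup_ge uK (k := k)) => n /ur; rewrite ler_distl => /andP[].
by apply: (limn_sup_le uK (k := k)) => n /ur; rewrite ler_distl => /andP[].
Qed.

End BoundedLimsup.

Section L1Limsup.
Context (R : realType).
Local Notation mu := (@lebesgue_measure R).
Variables (f : nat -> L1 R) (K c : R).
Hypothesis fK : forall k x, `|f k x| <= K.
Hypothesis fc : forall k, N1 (f k.+1 - f k) <= c * 2^-1 ^+ k.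

(** As in the Riesz-Fischer argument, the sum of all later increments dominates every later
    deviation, and its integral decays geometrically. *)
Let tail k (x : R) : \bar R :=
  (\sum_(0 <= j <oo) `|f (k + j).+1 x - f (k + j)%N x|%:E)%E.

Let tail_ge k n x : (k <= n)%N -> (`|f n x - f k x|%:E <= tail k x)%E.
Proof.
move=> kn; rewrite -(subnKC kn); move: (n - k)%N => m.
apply: (@le_trans _ _ (\sum_(0 <= j < m) `|f (k + j).+1 x - f (k + j)%N x|%:E)%E).
  elim: m => [|m IH]; first by rewrite addn0 subrr normr0 big_nil.
  rewrite big_nat_recr//= addnS.
  apply: (le_trans _ (leeD2r _ IH)).
  by rewrite -EFinD lee_fin [leRHS]addrC ler_distD.
exact: nneseries_lim_ge.
Qed.

Let mdiff k : measurable_fun [set: R] (fun x => `|f k.+1 x - f k x|%:E).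
Proof. exact: (measurable_int _ (L1_abs (f k.+1 - f k))). Qed.

Let integral_tail k : (\int[mu]_x tail k x <= (2 * c * 2^-1 ^+ k)%:E)%E.
Proof.
rewrite integral_nneseries//; last by move=> n; exact: mdiff.
apply: lime_le.
  by apply: is_cvg_nneseries => n _ _; exact: integral_ge0.
apply: nearW => n.
apply: (@le_trans _ _ (2 * c * 2^-1 ^+ k * (1 - 2^-1 ^+ n))%:E).
  elim: n => [|n IH]; first by rewrite big_nil expr0 subrr mulr0.
  rewrite big_nat_recr//=.
  have h : (\int[mu]_x `|f (k + n).+1 x - f (k + n)%N x|%:E <=
            (c * 2^-1 ^+ (k + n))%:E)%E.
    by rewrite -(EFin_N1 (f (k + n).+1 - f (k + n)%N)) lee_fin.
  apply: (le_trans (leeD IH h)); rewrite -EFinD lee_fin exprD exprS.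
  by rewrite le_eqVlt; apply/orP; left; apply/eqP; field.
rewrite lee_fin.
have c0 : 0 <= c by have := le_trans (N1_ge0 _) (fc 0); rewrite expr0 mulr1.
by rewrite ler_piMr// ?mulr_ge0 ?exprn_ge0 ?lerBlDr ?lerDl ?exprn_ge0.
Qed.

(** A limit superior is defined at every point, inherits pointwise bounds and joint measurability,
    and depends on the sequence alone, not on the rate [c]. *)
Definition L1limsup (x : R) : R := limn_sup (fun k => f k x).

Lemma measurable_L1limsup : measurable_fun [set: R] L1limsup.
Proof.
apply: measurable_fun_limn_sup => [x _|x _|k].
- by exists K => _ [n _ <-]; have := fK n x; rewrite ler_norml => /andP[].
- by exists (- K) => _ [n _ <-]; have := fK n x; rewrite ler_norml => /andP[].
- by apply/measurable_EFinP; exact: (measurable_int _ (L1_integrable (f k))).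
Qed.

Lemma L1limsup_tail k x : (`|L1limsup x - f k x|%:E <= tail k x)%E.
Proof.
have ht n : (k <= n)%N -> (`|f n x - f k x|%:E <= tail k x)%E by exact: tail_ge.
case: (tail k x) ht => [r| |] ht; last 2 first.
- by rewrite leey.
- by have := ht k (leqnn _); rewrite leeNy_eq.
rewrite lee_fin; apply: (limn_sup_dist (fun n => fK n x)) => n kn.
by rewrite -lee_fin ht.
Qed.

Lemma integral_L1limsup k :
  (\int[mu]_x `|L1limsup x - f k x|%:E <= (2 * c * 2^-1 ^+ k)%:E)%E.
Proof.
apply: le_trans (integral_tail k); apply: ge0_le_integral => //.
- apply/measurable_EFinP; apply: measurableT_comp => //.
  apply: measurable_funB; first exact: measurable_L1limsup.
  by apply/measurable_EFinP; exact: (measurable_int _ (L1_integrable (f k))).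
- by apply: ge0_emeasurable_sum => // j _; exact: mdiff.
- by move=> x _; exact: L1limsup_tail.
Qed.

Lemma integrable_L1limsup : mu.-integrable setT (EFin \o L1limsup).
Proof.
have h : mu.-integrable setT (fun x => (L1limsup x - f 0 x)%:E).
  apply/integrableP; split.
    apply/measurable_EFinP; apply: measurable_funB; first exact: measurable_L1limsup.
    by apply/measurable_EFinP; exact: (measurable_int _ (L1_integrable (f 0))).
  by apply: (le_lt_trans (integral_L1limsup 0)); rewrite ltry.
apply: eq_integrable (integrableD _ h (L1_integrable (f 0))) => // x _.
by rewrite /= -EFinD subrK.
Qed.

Lemma N1_L1limsup k : N1 (mkL1 integrable_L1limsup - f k) <= 2 * c * 2^-1 ^+ k.
Proof. by rewrite -lee_fin EFin_N1; exact: integral_L1limsup. Qed.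

End L1Limsup.

Section StepFunctions.
Context (R : realType).

Lemma measurable_step (n : R -> nat) (F : nat -> R -> R) :
  measurable_fun [set: R] n -> (forall k, measurable_fun [set: R] (F k)) ->
  measurable_fun [set: R * R] (fun p => F (n p.1) p.2).
Proof.
move=> mn mF.
have mnk k : measurable [set p : R * R | n p.1 = k].
  have -> : [set p : R * R | n p.1 = k] = (n @^-1` [set k]) `*` [set: R].
    by apply/seteqP; split=> -[x y] //= [].
  by apply: measurableX => //; rewrite -[X in measurable X]setTI; exact: mn.
have -> : [set: R * R] = \bigcup_k [set p : R * R | n p.1 = k].
  by apply/seteqP; split=> // p _; exists (n p.1).
apply/measurable_fun_bigcup => // k.
apply: (eq_measurable_fun (fun p : R * R => F k p.2)).
  by move=> p; rewrite inE/= => ->.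
apply: measurable_funTS.
exact: (measurableT_comp (mF k) measurable_snd).
Qed.

Lemma measurable_truncn_div (tau : R) : 0 < tau ->
  measurable_fun [set: R] (fun t => Num.truncn (t / tau)).
Proof.
move=> tau0; set n := fun t => _.
have mk k : measurable [set t : R | (k%:R <= t / tau)].
  have -> : [set t : R | (k%:R <= t / tau)] = `[k%:R * tau, +oo[%classic.
    by apply/seteqP; split=> t /=; rewrite in_itv/= andbT ler_pdivlMr.
  exact: measurable_itv.
have mn k : measurable (n @^-1` [set k]).
  (* [Num.truncn] is [0] on negative reals, so the level set of [0] is unbounded below. *)
  have -> : n @^-1` [set k] = (if k is k'.+1 then [set t : R | k%:R <= t / tau]
      else setT) `\` [set t : R | k.+1%:R <= t / tau].
    apply/seteqP; split=> t /=; rewrite /n.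
      by move=> <-; split; [case E : (Num.truncn _) => [//|m] /=; rewrite -truncn_gt_nat E|apply/negP; rewrite -ltNge truncnS_gt].
    move=> [h1 /negP]; rewrite -ltNge -truncn_le_nat => h2.
    apply/eqP; rewrite eqn_leq h2/=; case: k h1 {h2} => //= k h1.
    by rewrite truncn_gt_nat.
  by apply: measurableD => //; case: k.
move=> _ Y _; rewrite setTI.
have -> : n @^-1` Y = \bigcup_(k in Y) (n @^-1` [set k]).
  apply/seteqP; split=> [t Yt|t [k Yk nk]]; first by exists (n t).
  by rewrite /preimage/= (nk : n t = k).
by apply: bigcup_measurable => k _; exact: mn.
Qed.

End StepFunctions.

(** * Order preservation and invariant barriers *)

Section PointwiseBounds.
Context (R : realType).
Implicit Types (z w a b : R * R) (f : LL R).

Definition conservative (r : R * R -> R * R) :=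
  forall z, (r z).1 + (r z).2 = z.1 + z.2.

(* Crandall--Tartar: a contraction conserving the sum is order preserving. *)
Lemma conservative_lip_monotone r z w : conservative r -> l1_lip 1 r ->
  z.1 <= w.1 -> z.2 <= w.2 -> (r z).1 <= (r w).1 /\ (r z).2 <= (r w).2.
Proof.
move=> cr lr h1 h2; have := lr w z; rewrite mul1r /l1/=.
have := cr z; have := cr w.
rewrite (@ger0_norm _ (w.1 - z.1)) ?subr_ge0// (@ger0_norm _ (w.2 - z.2)) ?subr_ge0//.
have := ler_norm ((r w).1 - (r z).1); have := ler_norm ((r w).2 - (r z).2).
have := ler_norm (- ((r w).1 - (r z).1)); have := ler_norm (- ((r w).2 - (r z).2)).
by rewrite !normrN => *; split; lra.
Qed.

(* [a] and [b] are x-independent states evolving by the same relaxation;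
   conservation freezes their density at [U] and [-U]. *)
Definition trapped (U : R) f := exists a b,
  [/\ a.1 + a.2 = 2 * U, b.1 + b.2 = - (2 * U), l1 a <= 2 * U, l1 b <= 2 * U
    & forall x, [/\ f.1 x <= a.1, f.2 x <= a.2, b.1 <= f.1 x & b.2 <= f.2 x]].

Lemma trapped_density U f x : trapped U f -> `|f.1 x + f.2 x| <= 2 * U.
Proof.
move=> [a [b [ea eb la lb /(_ x)[h1 h2 h3 h4]]]]; rewrite ler_norml.
by apply/andP; split; lra.
Qed.

Lemma trapped_bound U f x : trapped U f ->
  `|f.1 x| <= 2 * U /\ `|f.2 x| <= 2 * U.
Proof.
move=> [a [b [ea eb la lb /(_ x)[h1 h2 h3 h4]]]]; rewrite /l1 in la lb.
have := ler_norm a.1; have := ler_norm a.2.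
have := ler_norm (- b.1); have := ler_norm (- b.2); rewrite !normrN => *.
have := normr_ge0 a.1; have := normr_ge0 a.2.
have := normr_ge0 b.1; have := normr_ge0 b.2 => *.
by rewrite !ler_norml; split; apply/andP; split; lra.
Qed.

(** Barriers that do not depend on [x] are unaffected by transport, even with different shifts in
    the two components. *)
Lemma trapped_Sh U f y : trapped U f -> trapped U (Sh y f).
Proof.
move=> [a [b [ea eb la lb h]]]; exists a, b; split => // x.
have [h1 _ h3 _] := h (x - y); have [_ h2 _ h4] := h (x + y).
by split; rewrite ?shift1E.
Qed.

Lemma trapped_upwind U (lam dx : R) f : 0 <= lam <= 1 -> trapped U f ->
  trapped U (upwind (@Sh R) lam dx f).
Proof.
case/andP=> c0 c1 [a [b [ea eb la lb h]]]; exists a, b; split => // x.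
have [h1 h2 h3 h4] := h x.
have [k1 _ k3 _] := h (x - dx); have [_ k2 _ k4] := h (x + dx).
have d0 : 0 <= 1 - lam by rewrite subr_ge0.
have := ler_wpM2l d0 h1; have := ler_wpM2l d0 h2; have := ler_wpM2l d0 h3.
have := ler_wpM2l d0 h4; have := ler_wpM2l c0 k1; have := ler_wpM2l c0 k2.
have := ler_wpM2l c0 k3; have := ler_wpM2l c0 k4 => *.
by split; rewrite /= ?shift1E; lra.
Qed.

Section Lift.
Variables (r : R * R -> R * R) (lr : l1_lip 1 r) (r0 : r 0 = 0).
Hypothesis cr : conservative r.
Local Notation Lr := (lift ler01 lr r0).

(** The barriers relax along with the state: [r] preserves order, keeps their sums, and does not
    increase [l1], so the separate bounds on both components survive too. *)
Lemma trapped_lift U f : trapped U f -> trapped U (Lr f).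
Proof.
move=> [a [b [ea eb la lb h]]]; exists (r a), (r b); split.
- by rewrite cr.
- by rewrite cr.
- by rewrite (le_trans (l1_lip_le _ lr r0))// mul1r.
- by rewrite (le_trans (l1_lip_le _ lr r0))// mul1r.
move=> x; have [h1 h2 h3 h4] := h x.
have [k1 k2] := conservative_lip_monotone (z := (f.1 x, f.2 x)) cr lr h1 h2.
have [k3 k4] := conservative_lip_monotone (w := (f.1 x, f.2 x)) cr lr h3 h4.
by split.
Qed.

Lemma trapped_splitting U (mu sp tau : R) f : 0 <= mu * tau <= 1 -> trapped U f ->
  trapped U (splitting (@Sh R) Lr mu sp tau f).
Proof.
move=> b01 fU; apply: trapped_Sh.
move: fU => [a [b [ea eb la lb h]]].
move: (mu * tau) b01 => c /andP[c0 c1].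
have d0 : 0 <= 1 - c by rewrite subr_ge0.
have lr' z : l1 (r z) <= l1 z by rewrite (le_trans (l1_lip_le _ lr r0))// mul1r.
have hl z : l1 z <= 2 * U ->
    l1 ((1 - c) * z.1 + c * (r z).1, (1 - c) * z.2 + c * (r z).2) <= 2 * U.
  move=> lz; rewrite /l1/=.
  have := ler_normD ((1 - c) * z.1) (c * (r z).1).
  have := ler_normD ((1 - c) * z.2) (c * (r z).2).
  rewrite !normrM (ger0_norm c0) (ger0_norm d0) => k1 k2.
  have := ler_wpM2l c0 (le_trans (lr' z) lz); have := ler_wpM2l d0 lz.
  by rewrite /l1 => *; lra.
exists ((1 - c) * a.1 + c * (r a).1, (1 - c) * a.2 + c * (r a).2),
  ((1 - c) * b.1 + c * (r b).1, (1 - c) * b.2 + c * (r b).2); split => /=.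
- by have := congr1 ( *%R c) (cr a) => ?; lra.
- by have := congr1 ( *%R c) (cr b) => ?; lra.
- exact: hl.
- exact: hl.
move=> x; have [h1 h2 h3 h4] := h x.
have [k1 k2] := conservative_lip_monotone (z := (f.1 x, f.2 x)) cr lr h1 h2.
have [k3 k4] := conservative_lip_monotone (w := (f.1 x, f.2 x)) cr lr h3 h4.
have := ler_wpM2l d0 h1; have := ler_wpM2l d0 h2; have := ler_wpM2l d0 h3.
have := ler_wpM2l d0 h4; have := ler_wpM2l c0 k1; have := ler_wpM2l c0 k2.
have := ler_wpM2l c0 k3; have := ler_wpM2l c0 k4 => *.
by split; lra.
Qed.

End Lift.
End PointwiseBounds.

(** * The exact solution *)

Lemma le_of_geometric_slack (R : realType) (x a c : R) :
  (forall k : nat, x <= a + c * 2^-1 ^+ k) -> x <= a.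
Proof.
move=> h; have hc : (fun k => a + c * 2^-1 ^+ k) @ \oo --> a + 0.
  apply: cvgD; first exact: cvg_cst.
  by apply: (@cvg_geometric R c 2^-1); rewrite ger0_norm// invf_lt1 ?ltr1n.
rewrite addr0 in hc; rewrite -(cvg_lim _ hc)//.
apply: limr_ge; first by apply/cvg_ex; exists a.
by apply: nearW => k; exact: h.
Qed.

Section ExactSolution.
Context (R : realType).
Local Notation mu_leb := (@lebesgue_measure R).
Local Notation bv := (bv_modulus (@N2 R) (@Tr R)).
Variables (rM : R * R -> R * R) (lM : l1_lip 1 rM) (rM0 : rM 0 = 0).
Hypothesis cM : conservative rM.
Variables (mu sp U B0 B1 : R) (w0 : LL R).
Hypotheses (mu0 : 0 < mu) (sp0 : 0 <= sp).
Hypotheses (w0B0 : N2 w0 <= B0) (w0B1 : bv B1 w0) (w0U : trapped U w0).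

Let M := lift ler01 lM rM0.
Let D := mu * B0 + sp * B1.
Let N2D' := @N2D R.
Let N2Z' := @N2Z R.
Let Sh0' := @Sh0 R.
Let ShD' := @ShD R.
Let N2Sh' := @N2_Sh R.
Let TrSh' := @Tr_Sh R.
Let N2ShTr' := @N2_Sh_Tr R.
Let lM' : seminorm_lip (@N2 R) 1 M := lift_lip ler01 lM rM0.
Let MT' : forall y g, M (Tr y g) = Tr y (M g) := lift_Tr ler01 lM rM0.

Let M0' : M 0 = 0.
Proof. by congr pair; apply: L1_ext => x /=; rewrite -[(0, 0)]/(0 : R * R) rM0. Qed.

Let B1_ge0 : 0 <= B1.
Proof. exact: (bv_modulus_ge0 N2D' N2Z' w0B1). Qed.

Let B0_ge0 : 0 <= B0.
Proof. by rewrite (le_trans _ w0B0)//; exact: (seminorm_ge0 N2D' N2Z'). Qed.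

Let D_ge0 : 0 <= D.
Proof. by rewrite addr_ge0// mulr_ge0// ltW. Qed.

(** [mu^-1] is the largest step for which the Euler relaxation is a convex combination. *)
Definition tau (k : nat) : R := mu^-1 * 2^-1 ^+ k.

Lemma tau_gt0 k : 0 < tau k.
Proof. by rewrite mulr_gt0 ?invr_gt0 ?exprn_gt0. Qed.

Let tau_ge0 k : 0 <= tau k. Proof. exact/ltW/tau_gt0. Qed.

Lemma mu_tau k : mu * tau k = 2^-1 ^+ k.
Proof. by rewrite mulrA mulfV ?gt_eqF// mul1r. Qed.

Lemma mu_tau_le1 k : mu * tau k <= 1.
Proof. by rewrite mu_tau exprn_ile1 ?invr_ge0// invf_le1 ?ler1n. Qed.

Lemma tauS k : tau k = 2 * tau k.+1.
Proof. by rewrite /tau exprS; field; rewrite gt_eqF. Qed.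

Definition approx_step (k : nat) : LL R -> LL R :=
  splitting (@Sh R) M mu sp (tau k).

Definition approx (k : nat) (t : R) : LL R :=
  iter (Num.truncn (t / tau k)) (approx_step k) w0.

Lemma approx_step_lip k : seminorm_lip (@N2 R) 1 (approx_step k).
Proof.
by apply: splitting_lip => //; [exact: ltW|exact: mu_tau_le1].
Qed.

Lemma iter_approx_bounds k n : N2 (iter n (approx_step k) w0) <= B0 /\
  bv B1 (iter n (approx_step k) w0).
Proof.
split.
  apply: le_trans w0B0; apply: iter_splitting_le => //; first exact: ltW.
  exact: mu_tau_le1.
by apply: iter_splitting_bv => //; [exact: ltW|exact: mu_tau_le1].
Qed.

Lemma approx_step_displacement k n j : N2 (iter (j + n) (approx_step k) w0
  - iter n (approx_step k) w0) <= j%:R * (2 * tau k * D).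
Proof.
rewrite iterD; have [h0 h1] := iter_approx_bounds k n.
apply: (le_trans (iter_displacement N2D' N2Z' _ _ (approx_step_lip k))).
by rewrite ler_wpM2l//; apply: splitting_displacement => //; exact: ltW.
Qed.

Lemma truncn_le_div (t T c : R) : 0 < c -> t <= T -> 0 <= T ->
  (Num.truncn (t / c))%:R * c <= T.
Proof.
move=> c0 tT T0; have [t0|t0] := leP 0 t.
  by rewrite -ler_pdivlMr// (le_trans (_ : _ <= t / c))// ?truncn_le ?divr_ge0 ?ler_pM2r ?invr_gt0// ltW.
have -> : Num.truncn (t / c) = 0%N.
  apply/eqP; rewrite -leqn0 truncn_le_nat.
  by rewrite (lt_trans _ ltr01)// ltr_pdivrMr// mul0r.
by rewrite mul0r.
Qed.

Lemma truncn_halve (t : R) k :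
  let n := Num.truncn (t / tau k) in
  let m := Num.truncn (t / tau k.+1) in (m = 2 * n)%N \/ m = (1 + 2 * n)%N.
Proof.
move=> n m.
have e : t / tau k.+1 = 2 * (t / tau k).
  rewrite (tauS k); have := tau_gt0 k.+1; move: (tau _) => c c0.
  by field; rewrite gt_eqF.
have h1 := truncnS_gt (t / tau k.+1); have h2 := truncnS_gt (t / tau k).
have [t0|t0] := leP 0 (t / tau k).
  have h3 : n%:R <= t / tau k by rewrite truncn_le.
  have h4 : m%:R <= t / tau k.+1 by rewrite truncn_le e mulr_ge0.
  rewrite -/n -/m e in h1 h2 h4.
  have : (m < 2 * n.+1)%N.
    by rewrite -(ltr_nat R) natrM (le_lt_trans h4)// ltr_pM2l.
  have : (2 * n < m.+1)%N.
    by rewrite -(ltr_nat R) natrM (le_lt_trans _ h1)// ler_pM2l.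
  rewrite mulnS ltnS => k1 k2.
  have [->|nm] := eqVneq m (2 * n)%N; first by left.
  right; apply/eqP; rewrite eqn_leq add1n ltn_neqAle eq_sym nm k1 andbT.
  by rewrite andbT -ltnS; exact: k2.
have n0 : n = 0%N.
  by apply/eqP; rewrite -leqn0 truncn_le_nat (lt_trans t0).
left; rewrite n0 muln0; apply/eqP; rewrite -leqn0 truncn_le_nat e.
by rewrite (lt_trans _ ltr01)// pmulr_rlt0.
Qed.

(** The coarse step plays the part of [Z] and pairs of fine steps match it without rounding. When
    the number of fine steps up to [t] is odd, the last one adds one displacement, which gives the
    summand [1]. *)
Lemma approx_cauchy k (t T : R) : t <= T -> 0 <= T ->
  N2 (approx k.+1 t - approx k t) <= (8 * T * mu + 1) * D * tau k.
Proof.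
move=> tT T0; set n := Num.truncn (t / tau k).
have nT : n%:R * tau k <= T by apply: truncn_le_div => //; exact: tau_gt0.
have main : N2 (approx k t - iter (2 * n) (approx_step k.+1) w0) <=
    8 * T * mu * D * tau k.
  rewrite /approx -/n.
  apply: (le_trans (@consistent_splitting_error R (LL R) (@N2 R) N2D' N2Z' (@Sh R) (@Tr R)
    Sh0' ShD' N2Sh' TrSh' N2ShTr' M lM' MT' M0' mu sp (ltW mu0) sp0
    (tau k.+1) (tau_ge0 _) (mu_tau_le1 _) (approx_step k) (tau k) 0 B0 B1 w0
    (muln 2) (approx_step_lip k) (tau_ge0 _) (lexx _) w0B0 w0B1 _ _ _ _ n)).
  - by move=> f fB0 fB1; apply: splitting_consistent => //; exact: ltW.
  - by rewrite muln0.
  - by move=> i; rewrite leq_mul2l leqnSn orbT.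
  - by move=> i; rewrite mulnS addnK -tauS subrr normr0.
  rewrite addr0 mulr0 mul0r addr0.
  have h0 := mulr_ge0 (mulr_ge0 (ltW mu0) D_ge0) (tau_ge0 k).
  by have := ler_wpM2r h0 nT; rewrite -/D; lra.
have extra : N2 (approx k.+1 t - iter (2 * n) (approx_step k.+1) w0) <= D * tau k.
  rewrite /approx; have [->|->] := truncn_halve t k; rewrite -/n.
    by rewrite subrr (seminorm0 N2Z') mulr_ge0.
  apply: (le_trans (approx_step_displacement _ _ _)).
  by rewrite (tauS k); lra.
rewrite (le_trans (seminorm_triangle N2D' (iter (2 * n) (approx_step k.+1) w0) _ _))//.
rewrite (seminorm_distC N2Z' _ (approx k t)).
by rewrite (le_trans (lerD extra main)){extra main}//; lra.
Qed.

Lemma approx_trapped k t : trapped U (approx k t).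
Proof.
rewrite /approx; elim: (Num.truncn _) => // n IH; rewrite iterS.
by apply: trapped_splitting => //; rewrite mu_tau_le1 andbT mulr_ge0// ltW.
Qed.

(** Density, and flux divided by the speed. A limit superior is not additive, so it is taken of
    these rather than of the Riemann components: the bound [U] on the density must hold at every
    point of the limit. *)
Definition approx_u k t : L1 R := 2^-1 *: ((approx k t).1 + (approx k t).2).
Definition approx_y k t : L1 R := 2^-1 *: ((approx k t).1 - (approx k t).2).

Lemma approx_u_bound k t x : `|approx_u k t x| <= U.
Proof.
rewrite L1Z L1D normrM ger0_norm//.
have := trapped_density x (approx_trapped k t).
by move=> h; rewrite ler_pdivrMl.
Qed.

Lemma approx_y_bound k t x : `|approx_y k t x| <= 2 * U.
Proof.
have [h1 h2] := trapped_bound x (approx_trapped k t).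
rewrite L1Z L1D L1N normrM ger0_norm// ler_pdivrMl//.
by have := ler_normB ((approx k t).1 x) ((approx k t).2 x); lra.
Qed.

Definition rate (T : R) : R := (8 * T * mu + 1) * D * mu^-1.

Lemma rate_ge0 (T : R) : 0 <= T -> 0 <= rate T.
Proof.
by move=> T0; rewrite /rate !mulr_ge0 ?invr_ge0 ?addr_ge0 ?mulr_ge0// ltW.
Qed.

Lemma approx_u_cauchy k (t T : R) : t <= T -> 0 <= T ->
  N1 (approx_u k.+1 t - approx_u k t) <= rate T * 2^-1 ^+ k.
Proof.
move=> tT T0; have := approx_cauchy k tT T0; rewrite /tau mulrA -/(rate T).
apply: le_trans; rewrite -[leRHS]mul1r; apply: N1_leD => // x.
rewrite mul1r !(L1D, L1N, L1Z) -mulrBr normrM ger0_norm//.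
rewrite ler_pdivrMl// opprD addrACA (le_trans (ler_normD _ _))//.
by rewrite ler_peMl// ?ler1n// addr_ge0.
Qed.

Lemma approx_y_cauchy k (t T : R) : t <= T -> 0 <= T ->
  N1 (approx_y k.+1 t - approx_y k t) <= rate T * 2^-1 ^+ k.
Proof.
move=> tT T0; have := approx_cauchy k tT T0; rewrite /tau mulrA -/(rate T).
apply: le_trans; rewrite -[leRHS]mul1r; apply: N1_leD => // x.
rewrite mul1r !(L1D, L1N, L1Z) -mulrBr normrM ger0_norm//.
rewrite ler_pdivrMl// opprD addrACA -opprD (le_trans (ler_normB _ _))//.
by rewrite ler_peMl// ?ler1n// addr_ge0.
Qed.

Definition exact_u (t : R) : R -> R := L1limsup (approx_u ^~ t).
Definition exact_y (t : R) : R -> R := L1limsup (approx_y ^~ t).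

(** The Cauchy rate depends on a time horizon; the absolute value of [t] is one available for every
    [t]. *)
Definition exact_uL (t : R) : L1 R :=
  mkL1 (integrable_L1limsup (fun k x => approx_u_bound k t x)
    (fun k => approx_u_cauchy k (ler_norm t) (normr_ge0 t))).
Definition exact_yL (t : R) : L1 R :=
  mkL1 (integrable_L1limsup (fun k x => approx_y_bound k t x)
    (fun k => approx_y_cauchy k (ler_norm t) (normr_ge0 t))).

Definition exact (t : R) : LL R :=
  (exact_uL t + exact_yL t, exact_uL t - exact_yL t).

Lemma exact_u_bound t x : `|exact_u t x| <= U.
Proof.
rewrite ler_norml; apply/andP; split.
  apply: (limn_sup_ge (approx_u_bound ^~ t ^~ x) (k := 0)) => n _.
  by have := approx_u_bound n t x; rewrite ler_norml => /andP[].
apply: (limn_sup_le (approx_u_bound ^~ t ^~ x) (k := 0)) => n _.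
by have := approx_u_bound n t x; rewrite ler_norml => /andP[].
Qed.

Lemma exact_y_bound t x : `|exact_y t x| <= 2 * U.
Proof.
rewrite ler_norml; apply/andP; split.
  apply: (limn_sup_ge (approx_y_bound ^~ t ^~ x) (k := 0)) => n _.
  by have := approx_y_bound n t x; rewrite ler_norml => /andP[].
apply: (limn_sup_le (approx_y_bound ^~ t ^~ x) (k := 0)) => n _.
by have := approx_y_bound n t x; rewrite ler_norml => /andP[].
Qed.

Lemma approx_limit k (t T : R) : t <= T -> 0 <= T ->
  N2 (exact t - approx k t) <= 8 * rate T * 2^-1 ^+ k.
Proof.
move=> tT T0.
have hu : N1 (exact_uL t - approx_u k t) <= 2 * rate T * 2^-1 ^+ k.
  have := N1_L1limsup (fun k x => approx_u_bound k t x)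
    (fun k => approx_u_cauchy k tT T0) k.
  (* The limits built with horizons [T] and [normr t] are the same function and differ only in their
     integrability proofs. *)
  by congr (_ <= _); congr (N1 (fn _)); apply: L1_ext.
have hy : N1 (exact_yL t - approx_y k t) <= 2 * rate T * 2^-1 ^+ k.
  have := N1_L1limsup (fun k x => approx_y_bound k t x)
    (fun k => approx_y_cauchy k tT T0) k.
  by congr (_ <= _); congr (N1 (fn _)); apply: L1_ext.
have h1 : N1 (exact t - approx k t).1 <=
    1 * (N1 (exact_uL t - approx_u k t) + N1 (exact_yL t - approx_y k t)).
  apply: N1_leD => // x; rewrite mul1r.
  apply: le_trans (ler_normD _ _); rewrite le_eqVlt; apply/orP; left.
  apply/eqP; congr (`| _ |).
  rewrite -[LHS]/((exact_uL t + exact_yL t) x - (approx k t).1 x).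
  by rewrite !(L1D, L1N, L1Z); field.
have h2 : N1 (exact t - approx k t).2 <=
    1 * (N1 (exact_uL t - approx_u k t) + N1 (exact_yL t - approx_y k t)).
  apply: N1_leD => // x; rewrite mul1r.
  apply: le_trans (ler_normB _ _); rewrite le_eqVlt; apply/orP; left.
  apply/eqP; congr (`| _ |).
  rewrite -[LHS]/((exact_uL t - exact_yL t) x - (approx k t).2 x).
  by rewrite !(L1D, L1N, L1Z); field.
by rewrite /N2; apply: (le_trans (lerD h1 h2)); lra.
Qed.

Lemma exact_le (t T : R) : t <= T -> 0 <= T -> N2 (exact t) <= B0.
Proof.
move=> tT T0; apply: (@le_of_geometric_slack _ _ _ (8 * rate T)) => k.
have h1 := approx_limit k tT T0.
have [h2 _] := iter_approx_bounds k (Num.truncn (t / tau k)).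
have h3 := N2D (exact t - approx k t) (approx k t).
rewrite subrK in h3; apply: (le_trans h3).
by rewrite addrC lerD.
Qed.

(** [dt] is compared with [tau k] up to a rounding of at most [tau k], which disappears as [k]
    grows. The part [2 * D * dt] pays for the time between the last mesh time and [t]. *)
Lemma exact_consistent (Z : LL R -> LL R) (dt t T : R) :
  0 < dt -> 0 <= t -> t <= T -> seminorm_lip (@N2 R) 1 Z ->
  (forall f, N2 f <= B0 -> bv B1 f ->
    N2 (Z f - (Sh (sp * dt) f + (mu * dt) *: (M f - f)))
    <= 4 * dt ^+ 2 * mu * D) ->
  N2 (iter (Num.truncn (t / dt)) Z w0 - exact t) <= (8 * T * mu + 2) * D * dt.
Proof.
move=> dt0 t0 tT lZ cZ; have T0 : 0 <= T := le_trans t0 tT.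
set n := Num.truncn (t / dt).
have nT : n%:R * dt <= T by exact: truncn_le_div.
have nt : n%:R * dt <= t by exact: truncn_le_div.
have nt1 : t < n%:R * dt + dt.
  have := truncnS_gt (t / dt); rewrite -/n ltr_pdivrMr// -natr1.
  by rewrite mulrDl mul1r.
(* All terms carrying [tau k] go into the slack, using [(dt + tau k)^2 - dt^2 <= tau k * (2 dt + tau
   0)]; the last summand is the distance from [approx k t] to the limit. *)
apply: (@le_of_geometric_slack _ _ _ (mu^-1 *
  (n%:R * (8 * (2 * dt + tau 0) * mu * D + 2 * D) + 2 * D)
  + 8 * rate T)) => k.
pose m i := Num.truncn (i%:R * dt / tau k).
have tk0 := tau_gt0 k.
have mtau i : (m i)%:R * tau k <= i%:R * dt.
  by apply: truncn_le_div => //; rewrite mulr_ge0// ltW.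
have mtau1 i : i%:R * dt < (m i)%:R * tau k + tau k.
  have := truncnS_gt (i%:R * dt / tau k); rewrite -/(m i) ltr_pdivrMr// -natr1.
  by rewrite mulrDl mul1r.
have mS i : (m i <= m i.+1)%N.
  apply: le_truncn; rewrite ler_pM2r ?invr_gt0// ler_pM2r// ler_nat.
  exact: leqnSn.
have m_eta i : `|(m i.+1 - m i)%:R * tau k - dt| <= tau k.
  rewrite natrB// ler_distl.
  have := mtau i; have := mtau i.+1; have := mtau1 i; have := mtau1 i.+1.
  rewrite -[i.+1%:R]natr1 => *.
  by apply/andP; split; lra.
have main : N2 (iter n Z w0 - iter (m n) (approx_step k) w0) <=
   n%:R * (8 * (dt + tau k) ^+ 2 * mu * D + 2 * tau k * D).
  apply: (@consistent_splitting_error R (LL R) (@N2 R) N2D' N2Z' (@Sh R) (@Tr R)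
    Sh0' ShD' N2Sh' TrSh' N2ShTr' M lM' MT' M0' mu sp (ltW mu0) sp0
    (tau k) (tau_ge0 _) (mu_tau_le1 _) Z dt (tau k) B0 B1 w0
    m lZ (ltW dt0) (tau_ge0 _) w0B0 w0B1 cZ _ mS m_eta n).
  by rewrite /m mul0r mul0r truncn0.
have extra : N2 (approx k t - iter (m n) (approx_step k) w0) <= 2 * D * (dt + tau k).
  have mle : (m n <= Num.truncn (t / tau k))%N.
    by apply: le_truncn; rewrite ler_pM2r ?invr_gt0.
  rewrite /approx -(subnK mle).
  apply: (le_trans (approx_step_displacement _ _ _)).
  rewrite natrB//.
  have h1 : (Num.truncn (t / tau k))%:R * tau k <= t by exact: truncn_le_div.
  have h2 : ((Num.truncn (t / tau k))%:R - (m n)%:R) * tau k <= dt + tau k.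
    by have := mtau1 n; lra.
  by have := ler_wpM2r D_ge0 h2; lra.
have lim := approx_limit k tT T0.
rewrite (le_trans (seminorm_triangle N2D' (iter (m n) (approx_step k) w0) _ _))//.
rewrite (le_trans (lerD (lexx _) (seminorm_triangle N2D' (approx k t) _ _)))//.
rewrite (seminorm_distC N2Z' _ (approx k t)) (seminorm_distC N2Z' _ (exact t)).
rewrite (le_trans (lerD main (lerD extra lim))){main extra lim}//.
have hA A B : (mu^-1 * A + B) * 2^-1 ^+ k = A * tau k + B * 2^-1 ^+ k.
  by rewrite mulrDl mulrAC mulrC.
rewrite hA.
have tk_le : tau k <= tau 0.
  rewrite /tau ler_pM2l ?invr_gt0// expr0 exprn_ile1 ?invr_ge0//.
  by rewrite invf_le1 ?ler1n.
have muD : 0 <= mu * D by rewrite mulr_ge0// ltW.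
have h1 : n%:R * (dt ^+ 2 * (mu * D)) <= T * (dt * (mu * D)).
  rewrite expr2 -mulrA !(mulrA n%:R) ler_wpM2r// !mulr_ge0// ltW//.
have h2 : n%:R * (tau k * tau k * (mu * D)) <= n%:R * (tau k * tau 0 * (mu * D)).
  by rewrite ler_wpM2l// ler_wpM2r// ler_wpM2l.
by lra.
Qed.

Lemma measurable_exact_u : measurable_fun [set: R * R] (fun p => exact_u p.1 p.2).
Proof.
apply: (@measurable_fun_limn_sup _ _ _ setT (fun k p => approx_u k p.1 p.2)).
- move=> p _; exists U => _ [n _ <-].
  by have := approx_u_bound n p.1 p.2; rewrite ler_norml => /andP[].
- move=> p _; exists (- U) => _ [n _ <-].
  by have := approx_u_bound n p.1 p.2; rewrite ler_norml => /andP[].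
move=> k; apply: (@measurable_step _ (fun t => Num.truncn (t / tau k))
  (fun n => 2^-1 *: ((iter n (approx_step k) w0).1 + (iter n (approx_step k) w0).2))).
  exact: measurable_truncn_div (tau_gt0 k).
by move=> n; apply/measurable_EFinP; exact: (measurable_int _ (L1_integrable _)).
Qed.

Lemma measurable_exact_y : measurable_fun [set: R * R] (fun p => exact_y p.1 p.2).
Proof.
apply: (@measurable_fun_limn_sup _ _ _ setT (fun k p => approx_y k p.1 p.2)).
- move=> p _; exists (2 * U) => _ [n _ <-].
  by have := approx_y_bound n p.1 p.2; rewrite ler_norml => /andP[].
- move=> p _; exists (- (2 * U)) => _ [n _ <-].
  by have := approx_y_bound n p.1 p.2; rewrite ler_norml => /andP[].
move=> k; apply: (@measurable_step _ (fun t => Num.truncn (t / tau k))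
  (fun n => 2^-1 *: ((iter n (approx_step k) w0).1 - (iter n (approx_step k) w0).2))).
  exact: measurable_truncn_div (tau_gt0 k).
by move=> n; apply/measurable_EFinP; exact: (measurable_int _ (L1_integrable _)).
Qed.

End ExactSolution.

(** * Relaxation maps *)

Section RelaxationMaps.
Context (R : realType).
Implicit Types (z w : R * R).

Definition dens z : R := (z.1 + z.2) / 2.
Definition flux (s : R) z : R := s * ((z.1 - z.2) / 2).

(** The map sending [(u, v)] to [(c * u, psi u v)], written in Riemann coordinates. *)
Definition relax_map (s c : R) (psi : R -> R -> R) z : R * R :=
  (c * dens z + psi (dens z) (flux s z) / s,
   c * dens z - psi (dens z) (flux s z) / s).

Lemma normr_divp (x y : R) : 0 < y -> `|x / y| = `|x| / y.
Proof. by move=> y0; rewrite normrM (@gtr0_norm _ y^-1)// invr_gt0. Qed.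

Lemma ler_l1_pm (x y m : R) : `|x| <= m -> `|y| <= m ->
  `|x + y| + `|x - y| <= 2 * m.
Proof.
rewrite !ler_norml => /andP[x1 x2] /andP[y1 y2].
by case: (ger0P (x + y)); case: (ger0P (x - y)) => *; lra.
Qed.

(** Since [|x + y| + |x - y| = 2 max (|x|, |y|)], the norm [l1] in Riemann coordinates is
    [2 max (|u|, |v| / s)]. It is enough to estimate [psi] for this maximum. *)
Lemma relax_map_lip (s c : R) psi : 0 < s -> 0 <= c ->
  (forall u v u' v' m, s * `|u - u'| <= m -> `|v - v'| <= m ->
     `|psi u v - psi u' v'| <= c * m) ->
  l1_lip c (relax_map s c psi).
Proof.
move=> s0 c0 hpsi z w; pose m := s * (l1 (z - w) / 2).
have hu : s * `|dens z - dens w| <= m.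
  rewrite /m ler_pM2l// /l1 /dens -mulrBl normrM (@ger0_norm _ 2^-1)//.
  rewrite ler_pM2r// opprD addrACA; exact: ler_normD.
have hv : `|flux s z - flux s w| <= m.
  rewrite /m /flux -mulrBr -mulrBl !normrM (gtr0_norm s0) (@ger0_norm _ 2^-1)//.
  rewrite ler_pM2l// ler_pM2r// opprD opprK addrACA.
  rewrite (_ : - z.2 + w.2 = - (z.2 - w.2)); last by rewrite opprB addrC.
  exact: ler_normB.
have h := hpsi _ _ _ _ _ hu hv.
rewrite /relax_map /l1/=.
set P := psi _ _ in h *; set Q := psi _ _ in h *.
have -> : c * dens z + P / s - (c * dens w + Q / s) =
  c * (dens z - dens w) + (P - Q) / s by ring.
have -> : c * dens z - P / s - (c * dens w - Q / s) =
  c * (dens z - dens w) - (P - Q) / s by ring.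
have e : c * (`|z.1 - w.1| + `|z.2 - w.2|) = 2 * (c * m / s).
  by rewrite /m /l1/=; field; rewrite gt_eqF.
rewrite e; apply: ler_l1_pm.
  rewrite normrM (ger0_norm c0) -mulrA ler_wpM2l//.
  by rewrite ler_pdivlMr// mulrC.
by rewrite normr_divp// ler_pM2r ?invr_gt0.
Qed.

Lemma dens_relax_map s c psi z : (relax_map s c psi z).1 + (relax_map s c psi z).2
  = c * (z.1 + z.2).
Proof. by rewrite /relax_map/= addrACA subrr addr0 -mulrDr -splitr. Qed.

(** * Contractivity under the subcharacteristic condition [gu <= s * b0] *)

Section Structure.
Variables (G : R -> R -> R) (eqA : R -> R) (gu b0 beta s : R).
Hypotheses (s0 : 0 < s) (b00 : 0 < b0) (gs : gu <= s * b0) (beta0 : 0 < beta).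
Hypothesis Gu : forall u u' v, `|G u v - G u' v| <= gu * `|u - u'|.
Hypothesis Gv : forall u v v' : R, v' <= v ->
  b0 * (v - v') <= G u v - G u v' <= beta * (v - v').
Hypothesis GA : forall u, G u (eqA u) = 0.
Hypothesis A0 : eqA 0 = 0.

Lemma source_slope (u v v' : R) : exists ga,
  [/\ b0 <= ga, ga <= beta & G u v - G u v' = ga * (v - v')].
Proof.
have bb : b0 <= beta.
  have := Gv 0 ler01; rewrite subr0 !mulr1 => /andP[h1 h2].
  exact: le_trans h1 h2.
have key x y : y < x -> exists ga,
    [/\ b0 <= ga, ga <= beta & G u x - G u y = ga * (x - y)].
  move=> yx; have /andP[h1 h2] := Gv u (ltW yx).
  have xy : 0 < x - y by rewrite subr_gt0.
  exists ((G u x - G u y) / (x - y)); split.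
  - by rewrite ler_pdivlMr.
  - by rewrite ler_pdivrMr.
  - by rewrite divfK// gt_eqF.
have [vv|vv|->] := ltgtP v v'.
- have [ga [h1 h2 h3]] := key _ _ vv; exists ga; split => //.
  by rewrite -[LHS]opprB h3 -mulrN opprB.
- exact: key.
- by exists b0; rewrite !subrr mulr0.
Qed.

(** The subcharacteristic condition turns the dependence on [u] into a perturbation of size
    [b0 * m], which the slope [ga >= b0] in [v] can compensate. *)
Lemma source_increment (u v u' v' m : R) : s * `|u - u'| <= m ->
  exists ga d : R, [/\ b0 <= ga, ga <= beta, `|d| <= b0 * m
    & G u v - G u' v' = ga * (v - v') + d].
Proof.
move=> hu; have [ga [h1 h2 h3]] := source_slope u v v'.
exists ga, (G u v' - G u' v'); split => //.
  rewrite (le_trans (Gu _ _ _))//.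
  have h4 : gu * `|u - u'| <= s * b0 * `|u - u'| by rewrite ler_wpM2r.
  have := ler_wpM2l (ltW b00) hu; lra.
by rewrite -h3 subrKA.
Qed.

(** Implicit differentiation of [G u (eqA u) = 0], in finite differences: the slope of the
    equilibrium is at most [gu / b0 <= s]. *)
Lemma equilibrium_lip u u' : `|eqA u - eqA u'| <= s * `|u - u'|.
Proof.
have [ga [d [h1 h2 h3 h4]]] :=
  source_increment (eqA u) (eqA u') (lexx (s * `|u - u'|)).
have : `|ga * (eqA u - eqA u')| <= b0 * (s * `|u - u'|).
  move: h4; rewrite !GA subrr => /esym/eqP; rewrite addr_eq0 => /eqP ->.
  by rewrite normrN.
rewrite normrM ger0_norm ?(le_trans (ltW b00))// => h5.
have h6 : b0 * `|eqA u - eqA u'| <= ga * `|eqA u - eqA u'| by rewrite ler_wpM2r.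
by have := le_trans h6 h5; rewrite ler_pM2l.
Qed.

(** Not the projection onto equilibrium, but the map for which the source [- G / eps] is exactly
    [(beta / eps)] times the deviation of the relaxed flux from [v]. *)
Definition maxwellian : R * R -> R * R :=
  relax_map s 1 (fun u v => v - G u v / beta).

(** The weight [beta - ga] from [v], nonnegative as [ga <= beta], and the weight [b0 <= ga] from [u]
    add up to at most [beta]. *)
Lemma maxwellian_lip : l1_lip 1 maxwellian.
Proof.
apply: relax_map_lip => // u v u' v' m hu hv.
have [ga [d [h1 h2 h3 h4]]] := source_increment v v' hu.
rewrite mul1r.
have -> : v - G u v / beta - (v' - G u' v' / beta) =
    ((beta - ga) * (v - v') - d) / beta.
  have -> : G u v = G u' v' + (ga * (v - v') + d) by rewrite -h4; ring.
  by field; rewrite gt_eqF.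
rewrite normr_divp// ler_pdivrMr//.
rewrite (le_trans (ler_normB _ _))// normrM (@ger0_norm _ (beta - ga)) ?subr_ge0//.
have m0 : 0 <= m := le_trans (normr_ge0 _) hv.
have k1 : (beta - ga) * `|v - v'| <= (beta - ga) * m.
  by rewrite ler_wpM2l// subr_ge0.
have k2 : b0 * m <= ga * m by rewrite ler_wpM2r.
by lra.
Qed.

Lemma maxwellian_conservative : conservative maxwellian.
Proof. by move=> z; rewrite dens_relax_map mul1r. Qed.

Lemma G00 : G 0 0 = 0.
Proof. by have := GA 0; rewrite A0. Qed.

Lemma relax_map0 c psi : psi 0 0 = 0 -> relax_map s c psi 0 = 0.
Proof.
move=> p0; rewrite /relax_map /dens /flux /= subrr addr0 !mul0r !mulr0 p0 mul0r.
by rewrite subrr addr0.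
Qed.

Lemma maxwellian0 : maxwellian 0 = 0.
Proof. by apply: relax_map0; rewrite G00 mul0r subr0. Qed.

Section TimeStep.
Variable b : R.
Hypothesis b_ge0 : 0 <= b.
Let e := expR (- b).

Let e_gt0 : 0 < e. Proof. exact: expR_gt0. Qed.
Let e_le1 : e <= 1. Proof. by rewrite -expR0 ler_expR oppr_le0. Qed.
Let e_ge : 1 - b <= e. Proof. exact: expR_ge1Dx. Qed.
Let be_le1 : (1 + b) * e <= 1.
Proof. by rewrite /e expRN ler_pdivrMr ?expR_gt0// mul1r expR_ge1Dx. Qed.

(** The relaxation step of the scheme with [b = beta * dt / eps], so that [dt / eps] reads
    [b / beta]. *)
Definition relaxed_flux (u v : R) : R :=
  v - (v - eqA u) * (1 - (1 + b) * e) - b / beta * e * G u v.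

Definition relaxation : R * R -> R * R := relax_map s 1 relaxed_flux.

Definition relaxation_gain : R * R -> R * R :=
  relax_map s (1 - e) (fun u v => relaxed_flux u v - e * v).

Lemma relaxation_split z :
  relaxation z = (e * z.1 + (relaxation_gain z).1, e * z.2 + (relaxation_gain z).2).
Proof.
rewrite /relaxation /relaxation_gain /relax_map/=.
move: (relaxed_flux _ _) => f; rewrite /flux /dens.
by congr pair; field; rewrite gt_eqF.
Qed.

(** [relaxed_flux u v] is the convex combination of [v], [v - G u v / beta] and [eqA u] with weights
    [e], [b * e] and [1 - (1 + b) * e]. Without the first term the weights add up to [1 - e], and
    each remaining map contracts the maximum norm. *)
Lemma relaxation_gain_lip : l1_lip (1 - e) relaxation_gain.
Proof.
apply: relax_map_lip => //; first by rewrite subr_ge0.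
move=> u v u' v' m hu hv.
have [ga [d [h1 h2 h3 h4]]] := source_increment v v' hu.
have hA := le_trans (equilibrium_lip u u') hu.
have m0 : 0 <= m := le_trans (normr_ge0 _) hv.
have -> : relaxed_flux u v - e * v - (relaxed_flux u' v' - e * v') =
   b * e / beta * ((beta - ga) * (v - v') - d)
   + (1 - (1 + b) * e) * (eqA u - eqA u').
  rewrite /relaxed_flux.
  have -> : G u v = G u' v' + (ga * (v - v') + d) by rewrite -h4; ring.
  by field; rewrite gt_eqF.
have c1 : 0 <= 1 - (1 + b) * e by rewrite subr_ge0.
have c2 : 0 <= b * e / beta by rewrite !mulr_ge0 ?invr_ge0// ltW.
rewrite (le_trans (ler_normD _ _))// !normrM (ger0_norm c1).
rewrite (@ger0_norm _ b)// (@gtr0_norm _ e)// (@gtr0_norm _ beta^-1) ?invr_gt0//.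
have k0 : `|(beta - ga) * (v - v') - d| <= beta * m.
  rewrite (le_trans (ler_normB _ _))// normrM (@ger0_norm _ (beta - ga)) ?subr_ge0//.
  have k1 : (beta - ga) * `|v - v'| <= (beta - ga) * m.
    by rewrite ler_wpM2l// subr_ge0.
  have k2 : b0 * m <= ga * m by rewrite ler_wpM2r.
  by lra.
have k1 := ler_wpM2l c2 k0; have k2 := ler_wpM2l c1 hA.
have k3 : b * e / beta * (beta * m) = b * e * m by field; rewrite gt_eqF.
by lra.
Qed.

Lemma relaxation_lip : l1_lip 1 relaxation.
Proof.
move=> z w; rewrite !relaxation_split.
have h := relaxation_gain_lip z w; rewrite /l1/= in h *.
set k := relaxation_gain z in h *; set k' := relaxation_gain w in h *.
have hh (x y p q : R) : `|e * x + p - (e * y + q)| <= e * `|x - y| + `|p - q|.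
  rewrite opprD addrACA -mulrBr (le_trans (ler_normD _ _))// normrM.
  by rewrite (ger0_norm (ltW e_gt0)).
have h1 := hh z.1 w.1 k.1 k'.1; have h2 := hh z.2 w.2 k.2 k'.2.
by lra.
Qed.

Lemma relaxation_conservative : conservative relaxation.
Proof. by move=> z; rewrite dens_relax_map mul1r. Qed.

Lemma relaxed_flux0 : relaxed_flux 0 0 = 0.
Proof. by rewrite /relaxed_flux A0 G00 subrr mul0r mulr0 !subr0. Qed.

Lemma relaxation0 : relaxation 0 = 0.
Proof. exact/relax_map0/relaxed_flux0. Qed.

Lemma relaxation_gain0 : relaxation_gain 0 = 0.
Proof. by apply: relax_map0; rewrite relaxed_flux0 mulr0 subr0. Qed.

(** The two discrepancies with an Euler step, [1 - (1 + b) * e] and [b * (1 - e)], are both at most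
    [b^2]. They multiply [v - eqA u] and [G u v / beta], the second being dominated by the first,
    and [|v - eqA u| <= s * l1 z]. *)
Lemma relaxation_consistent_l1 z :
  l1 (relaxation z - (z.1 + b * ((maxwellian z).1 - z.1),
                      z.2 + b * ((maxwellian z).2 - z.2)))
  <= 4 * b ^+ 2 * l1 z.
Proof.
set u := dens z; set v := flux s z.
have hz1 : z.1 = u + v / s by rewrite /u /v /dens /flux; field; rewrite gt_eqF.
have hz2 : z.2 = u - v / s by rewrite /u /v /dens /flux; field; rewrite gt_eqF.
pose d := relaxed_flux u v - v + b * G u v / beta.
have dle : `|d| <= 2 * b ^+ 2 * `|v - eqA u|.
  have -> : d = - ((v - eqA u) * (1 - (1 + b) * e))
      + b * (1 - e) * (G u v / beta).
    by rewrite /d /relaxed_flux; field; rewrite gt_eqF.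
  have c1 : 0 <= 1 - (1 + b) * e by rewrite subr_ge0.
  have c2 : 0 <= b * (1 - e) by rewrite mulr_ge0// subr_ge0.
  have hG : `|G u v / beta| <= `|v - eqA u|.
    have [ga [h1 h2]] := source_slope u v (eqA u); rewrite GA subr0 => ->.
    rewrite normr_divp// normrM (@ger0_norm _ ga) ?(le_trans (ltW b00))//.
    rewrite ler_pdivrMr// mulrC.
    by rewrite ler_wpM2l.
  rewrite (le_trans (ler_normD _ _))// normrN !normrM (ger0_norm c1).
  rewrite -(normrM b) (ger0_norm c2) -normrM.
  have k1 := ler_wpM2l c2 hG.
  have k2 : b * (1 - e) <= b * b by rewrite ler_wpM2l//; have := e_ge; lra.
  have k3 : 1 - (1 + b) * e <= b * b.
    have : (1 + b) * (1 - b) <= (1 + b) * e by rewrite ler_wpM2l// addr_ge0.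
    by lra.
  have k4 := ler_wpM2r (normr_ge0 (v - eqA u)) k2.
  have k5 := ler_wpM2r (normr_ge0 (v - eqA u)) k3.
  by rewrite expr2; lra.
have hd : `|v - eqA u| <= s * l1 z.
  have hA : `|eqA u| <= s * `|u|.
    by have := equilibrium_lip u 0; rewrite A0 !subr0.
  have hu : `|u| <= l1 z / 2.
    by rewrite /u /dens normrM (@ger0_norm _ 2^-1)// ler_pM2r// ler_normD.
  have hv : `|v| <= s * (l1 z / 2).
    rewrite /v /flux !normrM (gtr0_norm s0) (@ger0_norm _ 2^-1)// ler_pM2l//.
    by rewrite ler_pM2r// ler_normB.
  have := ler_normB v (eqA u); have := ler_wpM2l (ltW s0) hu; lra.
have -> : l1 (relaxation z - (z.1 + b * ((maxwellian z).1 - z.1),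
                      z.2 + b * ((maxwellian z).2 - z.2))) = 2 * (`|d| / s).
  have e1 : (relaxation z).1 - (z.1 + b * ((maxwellian z).1 - z.1)) = d / s.
    rewrite /relaxation /maxwellian /relax_map /= -/u -/v hz1 /d.
    by field; rewrite !gt_eqF.
  have e2 : (relaxation z).2 - (z.2 + b * ((maxwellian z).2 - z.2)) = - (d / s).
    rewrite /relaxation /maxwellian /relax_map /= -/u -/v hz2 /d.
    by field; rewrite !gt_eqF.
  rewrite /l1 -[X in `|X| + _]/((relaxation z).1 - (z.1 + b * ((maxwellian z).1 - z.1))).
  rewrite -[X in _ + `|X|]/((relaxation z).2 - (z.2 + b * ((maxwellian z).2 - z.2))).
  rewrite e1 e2 normrN normr_divp//.
  by ring.
have : `|d| / s <= 2 * b ^+ 2 * l1 z.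
  rewrite ler_pdivrMr// (le_trans dle)//.
  have := ler_wpM2l (_ : 0 <= 2 * b ^+ 2) hd.
  by rewrite mulr_ge0 ?sqr_ge0// => /(_ isT); lra.
by lra.
Qed.

End TimeStep.
End Structure.
End RelaxationMaps.

(** * Cell averages *)

Section CellAverages.
Context (R : realType).
Local Notation mu := (@lebesgue_measure R).
Variable dx : R.
Hypothesis dx0 : 0 < dx.

(* Unlike [cell], closed on the left, so that every point has a cell. *)
Definition cell_index (x : R) : int := Num.floor (x / dx + 2^-1).

Lemma cell_index_eq x j :
  (cell_index x == j) = (interface dx (j - 1) <= x < interface dx j).
Proof.
have e1 : (j - 1)%:~R + 2^-1 = j%:~R - 2^-1 :> R by rewrite rmorphB/=; lra.
have e2 : (j + 1)%:~R - 2^-1 = j%:~R + 2^-1 :> R by rewrite intrD; lra.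
rewrite floor_eq /interface e1 -e2.
by rewrite -lerBlDr -ltrBrDr ler_pdivlMr// ltr_pdivrMr.
Qed.

Lemma cell_index_cell x j : cell dx j x -> cell_index x = j.
Proof.
rewrite /cell/= in_itv/= => /andP[h1 h2]; apply/eqP.
by rewrite cell_index_eq (ltW h1).
Qed.

Lemma cell_indexD x : cell_index (x + dx) = cell_index x + 1.
Proof.
apply/eqP; rewrite /cell_index floor_eq mulrDl divff ?gt_eqF// addrAC.
have /andP[h1 h2] := floor_itv (x / dx + 2^-1).
by rewrite !intrD !mulr1z in h1 h2 *; rewrite lerD2r h1/= ltrD2r h2.
Qed.

Lemma cell_indexB x : cell_index (x - dx) = cell_index x - 1.
Proof. by have := cell_indexD (x - dx); rewrite subrK => ->; rewrite addrK. Qed.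

Lemma measurable_cell_index_eq j : measurable [set x | cell_index x = j].
Proof.
have -> : [set x | cell_index x = j] = `[interface dx (j - 1), interface dx j[%classic.
  apply/seteqP; split=> x /=; rewrite in_itv/= -cell_index_eq.
    by move=> ->.
  by move=> /eqP.
exact: measurable_itv.
Qed.

Lemma measurable_cell_comp (F : int -> R) :
  measurable_fun [set: R] (fun x => F (cell_index x)).
Proof.
move=> _ Y _; rewrite setTI.
pose C j := if `[< Y (F j) >] then [set x | cell_index x = j] else set0.
have -> : (fun x => F (cell_index x)) @^-1` Y =
    \bigcup_n (C (Posz n) `|` C (Negz n)).
  apply/seteqP; split=> x.
    move=> Yx; have Cx : C (cell_index x) x by rewrite /C asboolT.
    by case E : (cell_index x) Cx => [n|n] Cx; exists n => //; [left|right].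
  by case=> n _ [] /=; rewrite /C; case: ifPn => // /asboolP Yn /= ->.
by apply: bigcupT_measurable => n; apply: measurableU; rewrite /C;
  case: ifP => // _; exact: measurable_cell_index_eq.
Qed.

(** Kernel of the averaging operator: symmetric, jointly measurable and of mass [dx], so that
    Tonelli's theorem gives its [L^1] bounds. *)
Definition same_cell (x y : R) : bool := cell_index x == cell_index y.

Lemma measurable_same_cell :
  measurable_fun [set: R * R] (fun p => (same_cell p.1 p.2)%:R : R).
Proof.
have mi : measurable_fun [set: R] (fun x => (cell_index x)%:~R : R).
  exact: measurable_cell_comp.
have -> : (fun p : R * R => (same_cell p.1 p.2)%:R : R) =
    (fun p => if ((cell_index p.1)%:~R : R) == (cell_index p.2)%:~R then 1 else 0).
  by apply/funext => p; rewrite eqr_int /same_cell; case: ifP.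
apply: measurable_fun_ifT => //; apply: measurable_fun_eqr.
  exact: (measurableT_comp mi measurable_fst).
exact: (measurableT_comp mi measurable_snd).
Qed.

Lemma measurable_same_cell1 x :
  measurable_fun [set: R] (fun y => (same_cell x y)%:R : R).
Proof. exact: (measurable_cell_comp (fun j => (cell_index x == j)%:R)). Qed.

Lemma same_cellE x y : (same_cell x y)%:R =
  \1_(`[interface dx (cell_index x - 1), interface dx (cell_index x)[%classic) y :> R.
Proof. by rewrite indicE mem_setE in_itv/= -cell_index_eq eq_sym. Qed.

Lemma interfaceB j : interface dx j - interface dx (j - 1) = dx.
Proof. by rewrite /interface rmorphB/=; ring. Qed.

Lemma integral_same_cell x : (\int[mu]_y (same_cell x y)%:R%:E = dx%:E)%E.
Proof.
under eq_integral do rewrite same_cellE.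
rewrite integral_indic//.
rewrite setIT (_ : _ _ = mu `[interface dx (cell_index x - 1),
  interface dx (cell_index x)[%classic)// lebesgue_measure_itv/= lte_fin.
rewrite -EFinD interfaceB.
by rewrite -subr_gt0 interfaceB dx0.
Qed.

Lemma same_cellC x y : same_cell x y = same_cell y x.
Proof. exact: eq_sym. Qed.

Lemma same_cell_dist x y : same_cell x y -> `|y - x| <= dx.
Proof.
move=> /eqP xy.
have := cell_index_eq y (cell_index x); rewrite -xy eqxx => /esym/andP[h1 h2].
have := cell_index_eq x (cell_index x); rewrite eqxx => /esym/andP[h3 h4].
have := interfaceB (cell_index x) => e.
by rewrite ler_distl; apply/andP; split; lra.
Qed.

Section Average.
Variable f : L1 R.

Let mf : measurable_fun [set: R] f.
Proof. by apply/measurable_EFinP; exact: (measurable_int _ (L1_integrable f)). Qed.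

Lemma integrable_same_cell x :
  mu.-integrable setT (fun y => ((same_cell x y)%:R * f y)%:E).
Proof.
apply: (@le_integrable _ (measurableTypeR R) R mu setT measurableT _
    (EFin \o f)); last exact: L1_integrable.
  apply/measurable_EFinP; apply: measurable_funM => //.
  exact: measurable_same_cell1.
move=> y _ /=; rewrite lee_fin normrM; case: (same_cell x y).
  by rewrite normr1 mul1r.
by rewrite normr0 mul0r.
Qed.

Lemma cell_average_same x : cell_average dx f (cell_index x) =
  dx^-1 * \int[mu]_y ((same_cell x y)%:R * f y).
Proof.
rewrite /cell_average /cell; congr (_ * _).
(* The open cell and the half-open set of equal index differ by one endpoint. *)
rewrite Rintegral_itv_obnd_cbnd; last first.
  by apply: (integrableS measurableT _ _ (L1_integrable f)).
rewrite Rintegral_mkcond; apply: eq_Rintegral => y _.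
rewrite /patch same_cellE indicE.
by case: ifP; rewrite ?mul1r ?mul0r.
Qed.

Lemma cell_average_le x : (`|cell_average dx f (cell_index x)|%:E <=
  dx^-1%:E * \int[mu]_y ((same_cell x y)%:R * `|f y|)%:E)%E.
Proof.
rewrite cell_average_same normrM gtr0_norm ?invr_gt0// EFinM.
apply: lee_wpmul2l; first by rewrite lee_fin invr_ge0 ltW.
have h := le_normr_Rintegral measurableT (integrable_same_cell x).
rewrite -lee_fin in h; apply: (le_trans h).
rewrite /Rintegral fineK; last first.
  by apply: integrable_fin_num => //; exact: (integrable_norm (integrable_same_cell x)).
rewrite le_eqVlt; apply/orP; left; apply/eqP; apply: eq_integral => y _.
by rewrite normrM ger0_norm.
Qed.

Let mh : measurable_fun [set: R * R]
  (fun p : R * R => ((same_cell p.1 p.2)%:R * `|f p.2|)%:E).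
Proof.
apply/measurable_EFinP; apply: measurable_funM; first exact: measurable_same_cell.
apply: (measurableT_comp (f := fun y => `|f y|)); last exact: measurable_snd.
exact: measurableT_comp.
Qed.

Lemma integral_cell_average :
  (\int[mu]_x `|cell_average dx f (cell_index x)|%:E <= (N1 f)%:E)%E.
Proof.
have mc : measurable_fun [set: R] (fun x => cell_average dx f (cell_index x)).
  exact: measurable_cell_comp.
pose h (p : R * R) := ((same_cell p.1 p.2)%:R * `|f p.2|)%:E.
have h0 p : (0 <= h p)%E by rewrite lee_fin mulr_ge0.
apply: (@le_trans _ _ (\int[mu]_x (dx^-1%:E * \int[mu]_y h (x, y)))%E).
  apply: ge0_le_integral => //.
  - by apply/measurable_EFinP; exact: measurableT_comp.
  - apply: measurable_funeM.
    exact: (measurable_fun_fubini_tonelli_F (m2 := mu) h mh h0).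
  - by move=> x _; exact: cell_average_le.
rewrite ge0_integralZl//; last first.
- by rewrite lee_fin invr_ge0 ltW.
- by move=> x _; exact: integral_ge0.
- exact: (measurable_fun_fubini_tonelli_F (m2 := mu) h mh h0).
rewrite (fubini_tonelli (m1 := mu) (m2 := mu) h mh h0).
under eq_integral => y _.
  under eq_integral => x _ do rewrite /h/= same_cellC mulrC EFinM.
  rewrite ge0_integralZl//; last first.
    by apply/measurable_EFinP; exact: measurable_same_cell1.
  rewrite integral_same_cell.
  over.
rewrite ge0_integralZr//; last 2 first.
- by apply/measurable_EFinP; exact: measurableT_comp.
- by rewrite lee_fin ltW.
rewrite EFin_N1 muleC -muleA -EFinM mulfV ?gt_eqF// mule1//.
Qed.

Lemma integrable_cell_average :
  mu.-integrable setT (EFin \o (fun x => cell_average dx f (cell_index x))).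
Proof.
apply/integrableP; split.
  by apply/measurable_EFinP; exact: measurable_cell_comp.
by apply: (le_lt_trans integral_cell_average); rewrite ltry.
Qed.

Definition projection : L1 R := mkL1 integrable_cell_average.

Lemma N1_projection : N1 projection <= N1 f.
Proof. by rewrite -lee_fin EFin_N1; exact: integral_cell_average. Qed.

(** Points of one cell are at distance at most [dx]. Replacing the cell by a window centred at [x]
    makes the bound an average of translations, to which a modulus applies after exchanging
    integrals. *)
Lemma projection_dist_le x : (`|projection x - f x|%:E <=
  dx^-1%:E * \int[mu]_z ((`|z| <= dx)%R%:R * `|f (z + x) - f x|)%:E)%E.
Proof.
have ic : mu.-integrable setT (fun y => ((same_cell x y)%:R * f x)%:E).
  apply: (@le_integrable _ (measurableTypeR R) R mu setT measurableT _
    (fun y => (f x)%:E * (same_cell x y)%:R%:E)%E).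
  - apply/measurable_EFinP; apply: measurable_funM => //.
    exact: measurable_same_cell1.
  - by move=> y _ /=; rewrite mulrC.
  apply: integrableZl => //; apply/integrableP; split.
    by apply/measurable_EFinP; exact: measurable_same_cell1.
  under eq_integral => y _ do rewrite gee0_abs ?lee_fin//.
  by rewrite integral_same_cell ltry.
have e : projection x - f x =
    dx^-1 * \int[mu]_y ((same_cell x y)%:R * f y - (same_cell x y)%:R * f x).
  rewrite /projection/= cell_average_same RintegralB//; last exact: integrable_same_cell.
  rewrite mulrBr; congr (_ - _).
  under eq_Rintegral do rewrite mulrC.
  have isame : mu.-integrable setT (fun y => (same_cell x y)%:R%:E).
    apply/integrableP; split.
      by apply/measurable_EFinP; exact: measurable_same_cell1.
    under eq_integral => y _ do rewrite gee0_abs ?lee_fin//.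
    by rewrite integral_same_cell ltry.
  rewrite RintegralZl//.
  rewrite [X in _ * (_ * X)](_ : _ = dx); last by rewrite /Rintegral integral_same_cell.
  by rewrite mulrC mulfK// gt_eqF.
have id : mu.-integrable setT
    (fun y => ((same_cell x y)%:R * f y - (same_cell x y)%:R * f x)%:E).
  by apply: (integrableB _ (integrable_same_cell x) ic).
rewrite e normrM gtr0_norm ?invr_gt0// EFinM.
apply: lee_wpmul2l; first by rewrite lee_fin invr_ge0 ltW.
have h := le_normr_Rintegral measurableT id.
rewrite -lee_fin in h; apply: (le_trans h).
rewrite /Rintegral fineK; last first.
  by apply: integrable_fin_num => //; exact: (integrable_norm id).
pose k y := ((`|y - x| <= dx)%R%:R * `|f y - f x|)%:E.
have mxy : measurable_fun [set: R] (fun y => y - x) by exact: measurable_funB.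
have mk : measurable_fun [set: R] k.
  apply/measurable_EFinP; apply: measurable_funM.
    have -> : (fun y => (`|y - x| <= dx)%R%:R : R) =
       (fun y => if `|y - x| <= dx then 1 else 0) by apply/funext => y; case: ifP.
    apply: measurable_fun_ifT => //; apply: measurable_fun_ler => //.
    exact: measurableT_comp.
  by apply: measurableT_comp => //; exact: measurable_funB.
have k0 y : (0 <= k y)%E by rewrite lee_fin mulr_ge0.
have -> : (\int[mu]_z ((`|z| <= dx)%R%:R * `|f (z + x) - f x|)%:E)%E = (\int[mu]_y k y)%E.
  rewrite -(ge0_integral_translation x mk k0); apply: eq_integral => z _.
  by rewrite /k addrK.
apply: ge0_le_integral => //.
  by have /integrable_norm/measurable_int := id.
move=> y _; rewrite lee_fin -mulrBr normrM ger0_norm// ler_wpM2r//.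
rewrite ler_nat; case E : (same_cell x y) => //.
by rewrite same_cell_dist.
Qed.

Lemma N1_projection_dist (B : R) :
  (forall y, N1 (shift1 (- y) f - f) <= B * `|y|) ->
  N1 (projection - f) <= 2 * B * dx.
Proof.
move=> hB; rewrite -lee_fin EFin_N1.
pose k (p : R * R) := ((`|p.2| <= dx)%R%:R * `|f (p.2 + p.1) - f p.1|)%:E.
have B0 : 0 <= B by have := le_trans (N1_ge0 _) (hB 1); rewrite normr1 mulr1.
have mz : measurable_fun [set: R] (fun z : R => (`|z| <= dx)%R%:R : R).
  have -> : (fun z : R => (`|z| <= dx)%R%:R : R) =
     (fun z => if `|z| <= dx then 1 else 0) by apply/funext => z; case: ifP.
  by apply: measurable_fun_ifT => //; exact: measurable_fun_ler.
have mk : measurable_fun [set: R * R] k.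
  apply/measurable_EFinP; apply: measurable_funM.
    exact: (measurableT_comp mz measurable_snd).
  apply: measurableT_comp => //; apply: measurable_funB.
    apply: (measurableT_comp mf); apply: measurable_funD.
      exact: measurable_snd.
    exact: measurable_fst.
  exact: (measurableT_comp mf measurable_fst).
have k0 p : (0 <= k p)%E by rewrite lee_fin mulr_ge0.
apply: (@le_trans _ _ (\int[mu]_x (dx^-1%:E * \int[mu]_z k (x, z)))%E).
  apply: ge0_le_integral => //.
  - exact: (measurable_int _ (L1_abs (projection - f))).
  - apply: measurable_funeM.
    exact: (measurable_fun_fubini_tonelli_F (m2 := mu) k mk k0).
  - by move=> x _; exact: projection_dist_le.
rewrite ge0_integralZl//; last first.
- by rewrite lee_fin invr_ge0 ltW.
- by move=> x _; exact: integral_ge0.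
- exact: (measurable_fun_fubini_tonelli_F (m2 := mu) k mk k0).
rewrite (fubini_tonelli (m1 := mu) (m2 := mu) k mk k0).
have inner z : (\int[mu]_x k (x, z) <= (B * dx)%:E * (\1_(`[- dx, dx]%classic) z)%:E)%E.
  rewrite indicE mem_setE in_itv/= -ler_norml /k/=.
  have [zdx|zdx] := boolP (`|z| <= dx); last first.
    by under eq_integral do rewrite mul0r; rewrite integral0 mule0.
  under eq_integral do rewrite mul1r (addrC z).
  rewrite mule1; have := hB (- z); rewrite opprK normrN -lee_fin EFin_N1 => h.
  by apply: (le_trans h); rewrite lee_fin ler_wpM2l.
(* The window has length [2 * dx] and each translation costs at most [B * dx]; this is the origin of
   the factor [2]. *)
apply: (@le_trans _ _ (dx^-1%:E * ((B * dx)%:E * (2 * dx)%:E))%E).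
  apply: lee_wpmul2l; first by rewrite lee_fin invr_ge0 ltW.
  have -> : (2 * dx)%:E = (\int[mu]_z (\1_(`[- dx, dx]%classic) z)%:E)%E.
    rewrite integral_indic//.
    rewrite setIT (_ : _ _ = mu `[- dx, dx]%classic)//.
    rewrite lebesgue_measure_itv/= lte_fin -EFinD.
    by rewrite ltrNl gtrN ?oppr_lt0 // ?(lt_trans _ dx0) ?oppr_lt0//; congr _%:E; ring.
  rewrite -ge0_integralZl//; last 2 first.
  - by apply/measurable_EFinP; exact: measurable_indic.
  - by rewrite lee_fin mulr_ge0// ltW.
  apply: ge0_le_integral => //.
  - by move=> z _; exact: integral_ge0.
  - exact: (measurable_fun_fubini_tonelli_G (m1 := mu) k mk k0).
  - apply: measurable_funeM.
    by apply/measurable_EFinP; exact: measurable_indic.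
rewrite -!EFinM lee_fin le_eqVlt; apply/orP; left; apply/eqP.
by field; rewrite gt_eqF.
Qed.

Lemma projection_ubound K : (forall x, f x <= K) -> forall x, projection x <= K.
Proof.
move=> fK x; rewrite /projection/= cell_average_same mulrC ler_pdivrMr//.
have isame : mu.-integrable setT (fun y => (same_cell x y)%:R%:E).
  apply/integrableP; split.
    by apply/measurable_EFinP; exact: measurable_same_cell1.
  under eq_integral => y _ do rewrite gee0_abs ?lee_fin//.
  by rewrite integral_same_cell ltry.
have -> : K * dx = \int[mu]_y (K * (same_cell x y)%:R).
  by rewrite RintegralZl// /Rintegral integral_same_cell.
apply: le_Rintegral => //; first exact: integrable_same_cell.
  by apply: (integrableZl _ K isame).
by move=> y _; rewrite mulrC ler_wpM2r.
Qed.

End Average.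

Lemma projection_lbound (f : L1 R) K : (forall x, K <= f x) ->
  forall x, K <= projection f x.
Proof.
move=> fK x; have := @projection_ubound (- f) (- K) _ x.
have -> : projection (- f) x = - projection f x.
  have E g : projection g x = dx^-1 * \int[mu]_y ((same_cell x y)%:R * g y).
    exact: cell_average_same.
  rewrite !E -mulrN; congr (_ * _).
  rewrite -[RHS]mulN1r -RintegralZl//; last exact: integrable_same_cell.
  by apply: eq_Rintegral => y _; rewrite L1N; ring.
rewrite lerN2; apply=> y; by rewrite L1N lerN2.
Qed.

End CellAverages.

(** * Distributional variation and translations *)

Lemma dominated_integrable_fun d (T : measurableType d) (R : realType)
    (mu : {measure set T -> \bar R}) (h g : T -> R) :
  measurable_fun setT h -> (forall x, `|h x| <= `|g x|) ->
  mu.-integrable setT (EFin \o g) -> mu.-integrable setT (EFin \o h).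
Proof.
move=> mh hg ig; apply: (@le_integrable _ T R mu setT measurableT _ (EFin \o g)) => //.
  exact/measurable_EFinP.
by move=> x _ /=; rewrite lee_fin.
Qed.

Section VariationModulus.
Context (R : realType).
Local Notation mu := (@lebesgue_measure R).

Lemma measurable_L1 (f : L1 R) : measurable_fun [set: R] f.
Proof. by apply/measurable_EFinP; exact: (measurable_int _ (L1_integrable f)). Qed.

Lemma integrable_mul_bounded (f : L1 R) (h : R -> R) (K : R) :
  measurable_fun [set: R] h -> (forall x, `|h x| <= K) ->
  mu.-integrable setT (EFin \o (fun x => f x * h x)).
Proof.
move=> mh hK.
apply: (@dominated_integrable_fun _ (measurableTypeR R) R mu _ (K *: f)).
- by apply: measurable_funM => //; exact: measurable_L1.
- move=> x; rewrite L1Z mulrC !normrM ler_wpM2r//.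
  by rewrite (le_trans (hK x))// ler_norm.
- exact: L1_integrable.
Qed.

Section TestFunctions.
Variables (psi : R -> R) (L : R).
Hypotheses (cpsi : continuous psi) (psi1 : forall x, `|psi x| <= 1).
Hypothesis psiL : forall x, L < `|x| -> psi x = 0.

Let mpsi : measurable_fun [set: R] psi.
Proof. exact: continuous_measurable_fun. Qed.

Lemma integrable_test : mu.-integrable setT (EFin \o psi).
Proof.
apply: (@dominated_integrable_fun _ (measurableTypeR R) R mu _
  (\1_(`[- L, L]%classic) : R -> R)) => //.
  move=> x; rewrite indicE mem_setE in_itv/= -ler_norml.
  have [xL|xL] := leP `|x| L; first by rewrite normr1.
  by rewrite psiL// normr0.
exact: integrable_indic_itv.
Qed.

(** Its increments [primitive (x + y) - primitive x] have compact support even when [psi] has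
    nonzero integral. *)
Definition primitive (x : R) : R := \int[mu]_(t in `]-oo, x]) psi t.

Lemma is_derive_primitive (x : R) : is_derive x (1 : R) primitive (psi x).
Proof.
have x1 : x < x + 1 by rewrite ltrDl.
have i1 : mu.-integrable `]-oo, x + 1] (EFin \o psi).
  by apply: (integrableS measurableT _ _ integrable_test).
have [|d1 d2] := continuous_FTC1 x1 i1 _ (@cpsi x); first by rewrite ltNyr.
apply: DeriveDef; first exact: d1.
by rewrite -derive1E; exact: d2.
Qed.

Lemma primitive_increment x y : exists2 c, `|c - x| <= `|y| &
  primitive (x + y) - primitive x = psi c * y.
Proof.
have key a b : a <= b -> exists2 c, a <= c <= b &
    primitive b - primitive a = psi c * (b - a).
  move=> ab; have [|c] := MVT_segment ab (fun z _ => is_derive_primitive z).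
    apply: derivable_within_continuous => z _.
    by case: (is_derive_primitive z).
  by rewrite in_itv/= => hc e; exists c.
have [y0|y0] := leP 0 y.
  have [|c /andP[c1 c2] e] := key x (x + y); first by rewrite lerDl.
  exists c; last by rewrite e addrAC subrr add0r.
  by rewrite (ger0_norm y0) ger0_norm ?subr_ge0// lerBlDl.
have [|c /andP[c1 c2] e] := key (x + y) x; first by rewrite gerDl ltW.
exists c.
  by rewrite (ltr0_norm y0) ler_distl; apply/andP; split; lra.
by rewrite -[LHS]opprB e opprD addrA subrr sub0r mulrN opprK.
Qed.

(** The mean of [psi] over a segment of length [|y|] starting at [x], up to sign, is an admissible
    test function whose derivative is a difference quotient of [psi]. A change of variable moves the
    translation onto [f]. *)
Lemma translation_test (f : L1 R) (V y : R) : (Defs.variation f <= V%:E)%E ->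
  \int[mu]_x ((f (x - y) - f x) * psi x) <= V * `|y|.
Proof.
move=> fV; have [->|y0] := eqVneq y 0.
  under eq_Rintegral do rewrite subr0 subrr mul0r.
  by rewrite normr0 mulr0 /Rintegral integral0.
have ny0 : 0 < `|y| by rewrite normr_gt0.
pose phi x := `|y|^-1 * (primitive (x + y) - primitive x).
have dphi (x : R) : is_derive x (1 : R) phi (`|y|^-1 * (psi (x + y) - psi x)).
  have d1 : is_derive x (1:R) (primitive \o (fun x => x + y)) (psi (x + y) * 1).
    apply: is_derive1_comp; first exact: is_derive_primitive.
    by rewrite -[X in is_derive _ _ _ X]addr0; exact: is_deriveD.
  have d2 := is_deriveB d1 (is_derive_primitive x).
  rewrite mulr1 in d2.
  exact: (is_deriveZ `|y|^-1 d2).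
have dphiE : derive1 phi = (fun x => `|y|^-1 * (psi (x + y) - psi x)).
  apply/funext => x; rewrite derive1E.
  by case: (dphi x).
have mshift : measurable_fun [set: R] (fun x => psi (x + y)).
  by apply: (measurableT_comp mpsi); exact: measurable_funD.
have cshift : continuous (fun x => psi (x + y)).
  move=> x; apply: (@continuous_comp _ _ _ (fun x => x + y) psi); last exact: cpsi.
  by apply: cvgD; [exact: cvg_id|exact: cvg_cst].
have test : C1_line phi /\ compact_support phi /\ forall x, `|phi x| <= 1.
  split; [split|split].
  - by move=> x; by case: (dphi x).
  - rewrite dphiE => x; apply: cvgM; first exact: cvg_cst.
    by apply: cvgB; [exact: cshift|exact: @cpsi].
  - have sub : [set x | phi x != 0] `<=` `[- (L + `|y|), L + `|y|].
      move=> x /=; rewrite in_itv/= -ler_norml; apply: contraR; rewrite -ltNge.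
      move=> xL; rewrite /phi; have [c cx ->] := primitive_increment x y.
      rewrite psiL ?mul0r ?mulr0//.
      rewrite -(ltrD2r `|y|) (lt_le_trans xL)//.
      rewrite (le_trans _ (lerD (lexx `|c|) cx))//.
      by rewrite distrC (le_trans _ (ler_normD _ _))// addrC subrK.
    rewrite /compact_support.
    apply: (subclosed_compact _ (@segment_compact R (- (L + `|y|)) (L + `|y|))).
      exact: closed_closure.
    have hcl : closed (`[- (L + `|y|), L + `|y|]%classic : set R).
      exact: interval_closed.
    by rewrite (proj1 (closure_id _) hcl); exact: closureS sub.
  - move=> x; rewrite /phi; have [c cx ->] := primitive_increment x y.
    rewrite mulrCA !normrM normfV normr_id mulVf ?gt_eqF// mulr1.
    exact: psi1.
have ub : \int[mu]_x (f x * derive1 phi x) <= V.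
  rewrite -lee_fin; apply: (le_trans _ fV); apply: ereal_sup_ubound.
  by exists phi => //; case: test => ? [? ?]; split.
have i1 : mu.-integrable setT (EFin \o (fun x => f x * psi (x + y))).
  exact: (@integrable_mul_bounded f _ 1).
have i2 : mu.-integrable setT (EFin \o (fun x => f x * psi x)).
  exact: (@integrable_mul_bounded f _ 1).
have i3 : mu.-integrable setT (EFin \o (fun x => f (x - y) * psi x)).
  exact: (@integrable_mul_bounded (shift1 (- y) f) _ 1).
have e1 : \int[mu]_x (f x * derive1 phi x) =
    `|y|^-1 * (\int[mu]_x (f x * psi (x + y)) - \int[mu]_x (f x * psi x)).
  rewrite -RintegralB// -RintegralZl//.
    by apply: eq_Rintegral => x _; rewrite dphiE; ring.
  by apply: (integrableB _ i1 i2).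
have e2 : \int[mu]_x (f x * psi (x + y)) = \int[mu]_x (f (x - y) * psi x).
  rewrite /Rintegral; congr fine.
  rewrite -(@integral_translation _ y _ i3); apply: eq_integral => x _ /=.
  by rewrite addrK.
move: ub; rewrite e1 e2 -RintegralB// ler_pdivrMl//.
rewrite mulrC; apply: le_trans; rewrite le_eqVlt; apply/orP; left; apply/eqP.
by apply: eq_Rintegral => x _; rewrite mulrBl.
Qed.

End TestFunctions.

(** * The [L^1] norm as a supremum over continuous test functions *)

Section Duality.
Variables (g : L1 R) (c : R).
Hypothesis gc : forall (psi : R -> R) (L : R), continuous psi ->
  (forall x, `|psi x| <= 1) -> (forall x, L < `|x| -> psi x = 0) ->
  \int[mu]_x (g x * psi x) <= c.

Let chi (n : nat) (x : R) : R := Num.max 0 (Num.min 1 (n.+1%:R - `|x|)).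

Let chi_cont n : continuous (chi n).
Proof.
move=> x; apply: (@continuous_max _ _ (fun _ => 0) (fun x => Num.min 1 (n.+1%:R - `|x|))).
  exact: cst_continuous.
apply: (@continuous_min _ _ (fun _ => 1) (fun x => n.+1%:R - `|x|)).
  exact: cst_continuous.
apply: cvgB; first exact: cvg_cst.
exact: norm_continuous.
Qed.

Let chi_ge0 n x : 0 <= chi n x. Proof. by rewrite le_max lexx. Qed.
Let chi_le1 n x : chi n x <= 1.
Proof. by rewrite ge_max ler01 ge_min lexx. Qed.
Let chi_out n x : n.+1%:R < `|x| -> chi n x = 0.
Proof.
move=> h; apply/max_l; rewrite ge_min; apply/orP; right.
by rewrite subr_le0 ltW.
Qed.
Let chi_in n x : `|x| <= n%:R -> chi n x = 1.
Proof.
move=> h; rewrite /chi min_l; first by rewrite max_r.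
by rewrite lerBrDr -natr1 addrC lerD2r.
Qed.
Let chi_nd x m n : (m <= n)%N -> chi m x <= chi n x.
Proof.
move=> mn; rewrite /chi ge_max le_max lexx/= le_max; apply/orP; right.
rewrite le_min !ge_min lexx/=; apply/orP; right.
by rewrite lerD2r ler_nat.
Qed.

Let mchi n : measurable_fun [set: R] (chi n).
Proof. exact: continuous_measurable_fun. Qed.

Let cut_bound n : \int[mu]_x (`|g x| * chi n x) <= c.
Proof.
apply/ler_addgt0Pr => /= e; move: (e : R) => {}e e0.
pose E : set R := `[- n.+1%:R, n.+1%:R]%classic.
have mE : measurable E by exact: measurable_itv.
have muE : (mu E < +oo)%E.
  by rewrite /E lebesgue_measure_itv/=; case: ifP => _; rewrite ltry.
have gE : mu.-integrable E (EFin \o g).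
  by apply: (integrableS measurableT _ _ (L1_integrable g)).
have [g_ [cg ig /fine_cvgP[hfin hcvg]]] := approximation_continuous_integrable mE muE gE.
have [k [kfin hk]] : exists k,
    ((\int[mu]_(z in E) `|(g z - g_ k z)%:E|)%E \is a fin_num) /\
    fine (\int[mu]_(z in E) `|(g z - g_ k z)%:E|)%E < e / 4.
  have : \forall k \near \oo,
      (fine (\int[mu]_(z in E) `|(g z - g_ k z)%:E|)%E < e / 4).
    by apply: (cvgr_lt _ hcvg); rewrite divr_gt0.
  move=> /(filterI hfin)[N _ hN].
  by exists N; have [h1 h2] := hN N (leqnn _).
(* [E] has length [2 * n.+1], so [eta] times this length is [e / 2]; twice the approximation error
   [e / 4] gives the other half. *)
set eta := e / (4 * n.+1%:R).
have eta0 : 0 < eta by rewrite divr_gt0// mulr_gt0.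
have den0 x : 0 < `|g_ k x| + eta by rewrite ltr_wpDl.
(* A continuous substitute for the cut-off sign of [g]. On [E], [|g| * chi n] exceeds [g * psi] by
   at most [2 * |g - g_ k| + eta], and both vanish outside. *)
pose psi x := chi n x * (g_ k x / (`|g_ k x| + eta)).
have q1 x : `|g_ k x / (`|g_ k x| + eta)| <= 1.
  by rewrite normr_divp// ler_pdivrMr// mul1r lerDl ltW.
have cpsi : continuous psi.
  move=> x; apply: cvgM; first exact: chi_cont.
  apply: cvgM; first exact: cg.
  apply: cvgV; first by rewrite gt_eqF.
  apply: cvgD; last exact: cvg_cst.
  by apply: (@cvg_norm _ _ _ _ _ (g_ k)); exact: cg.
have psi1 x : `|psi x| <= 1.
  by rewrite normrM (ger0_norm (chi_ge0 _ _)) -[leRHS]mulr1 ler_pM.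
have psiL x : n.+1%:R < `|x| -> psi x = 0.
  by move=> /chi_out; rewrite /psi => ->; rewrite mul0r.
have hpsi := gc cpsi psi1 psiL.
pose d x := `|g x - g_ k x| * \1_E x + eta / 2 * \1_E x : R.
have mgk : measurable_fun [set: R] (g_ k) by exact: continuous_measurable_fun.
have iE : mu.-integrable setT (EFin \o (fun x => `|g x - g_ k x| * \1_E x)).
  have h : mu.-integrable E (EFin \o (fun x => `|g x - g_ k x|)).
    by apply: integrable_norm; apply: (integrableB _ gE (ig k)).
  have h2 := proj1 (@integrable_mkcond _ (measurableTypeR R) R mu E _ mE) h.
  apply: eq_integrable h2 => // x _; rewrite /patch /= indicE.
  by case: ifP => _; rewrite ?mulr1 ?mulr0.
have i1E : mu.-integrable setT (EFin \o (\1_E : R -> R)) by exact: integrable_indic_itv.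
have i1 : mu.-integrable setT (EFin \o (fun x => `|g x| * chi n x)).
  apply: (@dominated_integrable_fun _ (measurableTypeR R) R mu _ g).
  - apply: measurable_funM; last exact: mchi.
    by apply: measurableT_comp => //; exact: measurable_L1.
  - move=> x; rewrite normrM normr_id (ger0_norm (chi_ge0 _ _)).
    by rewrite ler_piMr.
  - exact: L1_integrable.
have i2 : mu.-integrable setT (EFin \o (fun x => g x * psi x)).
  by apply: (@integrable_mul_bounded g _ 1) => //; exact: continuous_measurable_fun.
have pt x : `|g x| * chi n x <= g x * psi x + (2 * (`|g x - g_ k x| * \1_E x) + eta * \1_E x).
  rewrite /psi indicE mem_setE in_itv/= -ler_norml.
  have [xn|xn] := leP `|x| n.+1%:R; last by rewrite chi_out// !mulr0 !mul0r !mulr0 !addr0.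
  rewrite !mulr1.
  have c0 := chi_ge0 n x; have c1 := chi_le1 n x.
  set r := g_ k x / _.
  have h1 : `|g_ k x| - eta <= g_ k x * r.
    rewrite /r mulrA -expr2 ler_pdivlMr// -(real_normK (num_real (g_ k x))).
    by rewrite -subr_sqr lerBlDr lerDl sqr_ge0.
  have h2 : - `|g x - g_ k x| <= (g x - g_ k x) * r.
    rewrite lerNl; apply: (le_trans (ler_norm _)); rewrite normrN normrM.
    by rewrite ler_piMr//; exact: q1.
  have h3 : `|g x| <= `|g x - g_ k x| + `|g_ k x|.
    by rewrite -{1}(subrK (g_ k x) (g x)) ler_normD.
  have h4 : `|g x| <= g x * r + (2 * `|g x - g_ k x| + eta) by lra.
  have h5 : 0 <= 2 * `|g x - g_ k x| + eta.
    by rewrite addr_ge0 ?mulr_ge0// ltW.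
  have h6 := ler_wpM2r c0 h4.
  have h7 : (2 * `|g x - g_ k x| + eta) * chi n x <= 2 * `|g x - g_ k x| + eta.
    by rewrite ler_piMr.
  lra.
have i3 : mu.-integrable setT (EFin \o (fun x => 2 * (`|g x - g_ k x| * \1_E x))).
  by apply: (integrableZl _ 2 iE).
have i4 : mu.-integrable setT (EFin \o (fun x => eta * \1_E x)).
  by apply: (integrableZl _ eta i1E).
have i34 : mu.-integrable setT
    (EFin \o (fun x => 2 * (`|g x - g_ k x| * \1_E x) + eta * \1_E x)).
  by apply: (integrableD _ i3 i4).
have i5 : mu.-integrable setT (EFin \o (fun x => g x * psi x +
    (2 * (`|g x - g_ k x| * \1_E x) + eta * \1_E x))).
  by apply: (integrableD _ i2 i34).
apply: (le_trans (le_Rintegral measurableT i1 i5 (fun x _ => pt x))).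
rewrite RintegralD// RintegralD// RintegralZl// RintegralZl//.
have -> : \int[mu]_x (\1_E x) = 2 * n.+1%:R.
  rewrite /Rintegral integral_indic// setIT (_ : _ _ = mu E)// /E.
  rewrite lebesgue_measure_itv/= lte_fin -EFinD.
  by rewrite gtrN//= opprK; ring.
have -> : \int[mu]_x (`|g x - g_ k x| * \1_E x) =
    fine (\int[mu]_(z in E) `|(g z - g_ k z)%:E|)%E.
  rewrite /Rintegral [in RHS]integral_mkcond; congr fine.
  apply: eq_integral => x _; rewrite /patch indicE.
  by case: ifP => _; rewrite ?mulr1 ?mulr0.
have : eta * (2 * n.+1%:R) = e / 2.
  have : (n.+1%:R : R) != 0 by rewrite pnatr_eq0.
  by rewrite /eta; move: (n.+1%:R : R) => N N0; field.
by move: hk hpsi => *; lra.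
Qed.

Lemma N1_duality : N1 g <= c.
Proof.
rewrite -lee_fin EFin_N1.
have e x : (`|g x|%:E = limn (fun n => (`|g x| * chi n x)%:E))%E.
  apply/esym/cvg_lim => //; apply: cvg_near_cst.
  exists (Num.truncn `|x|).+1 => // n /= xn; rewrite chi_in ?mulr1//.
  by rewrite (le_trans (ltW (truncnS_gt _)))// ler_nat.
under eq_integral do rewrite e.
rewrite monotone_convergence//; last 3 first.
- move=> n; apply/measurable_EFinP; apply: measurable_funM; last exact: mchi.
  by apply: measurableT_comp => //; exact: measurable_L1.
- by move=> n x _; rewrite lee_fin mulr_ge0.
- by move=> x _ m n mn; rewrite lee_fin ler_wpM2l// chi_nd.
have i1 n : mu.-integrable setT (EFin \o (fun x => `|g x| * chi n x)).
  apply: (@dominated_integrable_fun _ (measurableTypeR R) R mu _ g).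
  - apply: measurable_funM; last exact: mchi.
    by apply: measurableT_comp => //; exact: measurable_L1.
  - move=> x; rewrite normrM normr_id (ger0_norm (chi_ge0 _ _)).
    by rewrite ler_piMr.
  - exact: L1_integrable.
apply: lime_le.
  apply: ereal_nondecreasing_is_cvgn => m n mn; apply: ge0_le_integral => //.
  - by move=> x _; rewrite lee_fin mulr_ge0.
  - exact: (measurable_int _ (i1 m)).
  - exact: (measurable_int _ (i1 n)).
  - by move=> x _; rewrite lee_fin ler_wpM2l// chi_nd.
apply: nearW => n; have := cut_bound n; rewrite -lee_fin /Rintegral fineK//.
by apply: integrable_fin_num => //; exact: i1.
Qed.

End Duality.

Lemma variation_modulus (f : L1 R) (V : R) : (Defs.variation f <= V%:E)%E ->
  forall y, N1 (shift1 (- y) f - f) <= V * `|y|.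
Proof.
move=> fV y; apply: N1_duality => psi L cpsi psi1 psiL.
have := translation_test cpsi psi1 psiL y fV.
apply: le_trans; rewrite le_eqVlt; apply/orP; left; apply/eqP.
by apply: eq_Rintegral => x _; rewrite L1D L1N shift1E.
Qed.

End VariationModulus.

(** * Weak form *)

Section PlaneTranslation.
Context (R : realType).
Local Notation mu := (@lebesgue_measure R).
Local Notation leb2 := (@lebesgue_plane R).

Lemma measurable_plane_shift (s y : R) :
  measurable_fun [set: R * R] (fun p : R * R => (p.1 + s, p.2 + y)).
Proof.
by apply: measurable_fun_pair; apply: measurable_funD.
Qed.

Definition plane_shift (s y : R) : {mfun (measurableTypeR R * measurableTypeR R)%type >->
    (measurableTypeR R * measurableTypeR R)%type} :=
  HB.pack (fun p : measurableTypeR R * measurableTypeR R =>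
    (p.1 + s, p.2 + y) : measurableTypeR R * measurableTypeR R)
    (isMeasurableFun.Build _ _ (measurableTypeR R * measurableTypeR R)%type
      (measurableTypeR R * measurableTypeR R)%type
      (fun p => (p.1 + s, p.2 + y)) (measurable_plane_shift s y)).

Lemma plane_measure_translation (s y : R) (A : set (R * R)) : measurable A ->
  pushforward leb2 (plane_shift s y) A = leb2 A.
Proof.
move=> mA; apply/esym.
apply: (@product_measure_unique _ _ _ _ R mu mu (pushforward leb2 (plane_shift s y))) => //.
move=> B C mB mC.
have my (z : R) : measurable_fun [set: R] (fun x : R => x + z).
  exact: measurable_funD.
have hB := lebesgue_measure_translation s mB.
have hC := lebesgue_measure_translation y mC.
transitivity (mu ((fun x : R => (x + s)%R) @^-1` B) * mu ((fun x : R => (x + y)%R) @^-1` C))%E; last first.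
  by congr (_ * _)%E.
rewrite -[RHS](@product_measure1E _ _ _ _ R mu mu)//.
- by rewrite -[X in measurable X]setTI; exact: my.
- by rewrite -[X in measurable X]setTI; exact: my.
Qed.

Lemma integral_plane_translation (s y : R) (F : R * R -> R) :
  measurable_fun [set: R * R] F -> leb2.-integrable setT (EFin \o F) ->
  leb2.-integrable setT (EFin \o (fun p => F (p.1 + s, p.2 + y))) /\
  \int[leb2]_p F (p.1 + s, p.2 + y) = \int[leb2]_p F p.
Proof.
move=> mF iF.
have mEF : measurable_fun [set: R * R] (EFin \o F) by exact/measurable_EFinP.
have mFs : measurable_fun [set: R * R] (fun p => F (p.1 + s, p.2 + y)).
  exact: (measurableT_comp mF (measurable_plane_shift s y)).
have iFs : leb2.-integrable setT (EFin \o (fun p => F (p.1 + s, p.2 + y))).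
  apply/integrableP; split; first exact/measurable_EFinP.
  move: iF => /integrableP[_]; apply: le_lt_trans.
  rewrite -[leRHS](@eq_measure_integral _ _ _ _ leb2 (pushforward leb2
    (plane_shift s y))); last first.
    by move=> A mA _; exact: plane_measure_translation.
  by rewrite ge0_integral_pushforward//; apply: measurableT_comp.
split => //; rewrite /Rintegral; congr fine.
rewrite -[RHS](@eq_measure_integral _ _ _ _ leb2 (pushforward leb2
    (plane_shift s y))); last first.
  by move=> A mA _; exact: plane_measure_translation.
by rewrite integral_pushforward.
Qed.

End PlaneTranslation.

Section TestFunctions.
Context (R : realType).
Variables (phi : R * R -> R) (c : R).
Hypotheses (C1phi : C1_plane phi) (cphi : compact_support phi).

Definition transport_derivative (p : R * R) : R := d1 phi p + c * d2 phi p.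

Lemma test_continuous : continuous phi.
Proof. by move=> p; apply: differentiable_continuous; have [h _ _] := C1phi. Qed.

Lemma transport_derivative_continuous : continuous transport_derivative.
Proof.
have [_ h1 h2] := C1phi => p; apply: cvgD; first exact: h1.
by apply: cvgM; [exact: cvg_cst|exact: h2].
Qed.

Lemma test_support : exists2 L : R, 0 < L &
  forall p, phi p != 0 -> `|p.1| <= L /\ `|p.2| <= L.
Proof.
have [M [Mr hM]] := compact_bounded cphi.
exists (`|M| + 1); first by rewrite ltr_wpDl.
move=> p hp; have : `|p| <= `|M| + 1.
  apply: hM; first by rewrite (le_lt_trans (ler_norm M))// ltrDl.
  exact: subset_closure.
by rewrite prod_normE ge_max => /andP[].
Qed.

Lemma is_derive_along (p : R * R) (s : R) :
  is_derive s (1 : R) (fun s => phi (p.1 + s, p.2 + c * s))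
    (transport_derivative (p.1 + s, p.2 + c * s)).
Proof.
have [dphi _ _] := C1phi.
set q := (p.1 + s, p.2 + c * s).
have hv : ((1, c) : R * R) = (1, 0) + c *: ((0, 1) : R * R).
  by congr pair; rewrite /= -[c *: _]/(c * _) ?mulr0 ?mulr1 ?addr0 ?add0r.
have e : transport_derivative q = 'D_((1, c) : R * R) phi q.
  rewrite /transport_derivative /d1 /d2 !deriveE//.
  by rewrite hv linearD linearZ.
rewrite e.
have hd : derivable phi q (1, c) by exact: diff_derivable.
have eqf : (fun h : R => h^-1 *: ((phi \o shift q) (h *: ((1, c) : R * R)) - phi q)) =
    (fun h : R => h^-1 *: (((fun s => phi (p.1 + s, p.2 + c * s)) \o shift s)
        (h *: (1 : R)) - phi (p.1 + s, p.2 + c * s))).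
  apply/funext => h /=; congr (_ *: (phi _ - _)).
  rewrite /q; congr pair; rewrite /= -[_ *: _]/(_ * _) ?mulr1.
    by ring.
  by rewrite -[h%:A]/(h * 1); ring.
apply: DeriveDef.
  by rewrite /derivable -eqf.
by rewrite /derive -eqf.
Qed.

Lemma test_increment p (tau : R) : 0 < tau -> exists2 th, 0 <= th <= tau &
  phi (p.1 + tau, p.2 + c * tau) - phi p =
  tau * transport_derivative (p.1 + th, p.2 + c * th).
Proof.
move=> tau0.
have [|th] := MVT_segment (ltW tau0) (fun s _ => is_derive_along p s).
  apply: derivable_within_continuous => s _.
  by case: (is_derive_along p s).
rewrite in_itv/= => hth e; exists th => //.
move: e; rewrite subr0 mulr0 !addr0 => e; rewrite [RHS]mulrC -e.
by case: (p).
Qed.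

Lemma transport_derivative_support (L : R) : 0 < L ->
  (forall p, phi p != 0 -> `|p.1| <= L /\ `|p.2| <= L) ->
  forall p, transport_derivative p != 0 -> `|p.1| <= L /\ `|p.2| <= L.
Proof.
move=> L0 hL p hn; apply: contrapT => hp; move/eqP: hn; apply.
(* Leaving the box is an open condition, so [phi] vanishes near [p] along the whole characteristic,
   and so does its derivative at [p]. *)
suff nz : \forall s \near (0 : R), phi (p.1 + s, p.2 + c * s) = 0.
  have := is_derive_along p 0; rewrite mulr0 !addr0 (_ : (p.1, p.2) = p); last by case: (p).
  move=> hd; rewrite -(@derive_val _ _ _ _ _ _ _ hd).
  rewrite (near_eq_derive (g := fun _ => 0)) ?oner_neq0//.
  exact: derive_cst.
have h1 : L < `|p.1| \/ L < `|p.2|.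
  case: (leP `|p.1| L) => h1; last by left.
  by case: (leP `|p.2| L) => h2; [exfalso; exact: hp|right].
have phi0 q : L < `|q.1| \/ L < `|q.2| -> phi q = 0.
  move=> hq; apply/eqP; apply: contraPT hq => /hL[k1 k2].
  by case; rewrite ltNge ?k1 ?k2.
have cont (a b : R) : L < `|a| -> \forall s \near (0 : R), L < `|a + b * s|.
  move=> La; have : (fun s => `|a + b * s|) @ (0 : R) --> `|a + b * 0|.
    apply: cvg_norm; apply: cvgD; first exact: cvg_cst.
    by apply: cvgM; [exact: cvg_cst|exact: cvg_id].
  by rewrite mulr0 addr0 => h; exact: (cvgr_gt _ h).
case: h1 => /(cont _ _) h1.
  have := h1 1; apply: filterS => s; rewrite mul1r => hs.
  by apply: phi0; left.
by have := h1 c; apply: filterS => s hs; apply: phi0; right.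
Qed.

Lemma continuous_box_bounded (f : R * R -> R) (L : R) : continuous f ->
  (forall p, f p != 0 -> `|p.1| <= L /\ `|p.2| <= L) ->
  exists2 B, 0 <= B & forall p, `|f p| <= B.
Proof.
move=> cf hf.
have cbox : compact (`[- L, L] `*` `[- L, L] : set (R * R)).
  by apply: compact_setX; exact: segment_compact.
have [M [Mr hM]] := compact_bounded (continuous_compact (continuous_subspaceT cf) cbox).
exists (`|M| + 1); first by rewrite addr_ge0.
move=> p; have [->|/hf[h1 h2]] := eqVneq (f p) 0.
  by rewrite normr0 addr_ge0.
apply: hM; first by rewrite (le_lt_trans (ler_norm M))// ltrDl.
by exists p => //; split; rewrite /= in_itv/= -ler_norml.
Qed.

End TestFunctions.

Section PlaneIntegrals.
Context (R : realType).
Local Notation mu := (@lebesgue_measure R).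
Local Notation leb2 := (@lebesgue_plane R).

Lemma measurable_strip (a b : R) : measurable [set p : R * R | a <= p.1 <= b].
Proof.
rewrite (_ : [set p | _] = `[a, b]%classic `*` [set: R]); last first.
  by apply/seteqP; split=> p /=; rewrite in_itv/= => // -[].
exact: measurableX.
Qed.

Lemma measurable_after (s : R) :
  measurable_fun [set: R * R] (fun p : R * R => (s <= p.1)%R%:R : R).
Proof.
rewrite (_ : (fun p : R * R => _) = \1_(`[s, +oo[%classic `*` [set: R])).
  by apply: measurable_indic; exact: measurableX.
apply/funext => p; rewrite indicE; case: (leP s p.1) => h.
  by rewrite mem_set//; split => //; rewrite /= in_itv/= h.
by rewrite memNset// => -[]; rewrite /= in_itv/= andbT leNgt h.
Qed.

Lemma integral_box (f : R * R -> R) (K a b c d : R) : a <= b -> c <= d ->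
  measurable_fun [set: R * R] f -> (forall p, `|f p| <= K) ->
  (forall p, f p != 0 -> a <= p.1 <= b /\ c <= p.2 <= d) ->
  leb2.-integrable setT (EFin \o f) /\
  \int[leb2]_p `|f p| <= K * ((b - a) * (d - c)).
Proof.
move=> ab cd mf fK fbox.
have mA : measurable (`[a, b]%classic `*` `[c, d]%classic : set (R * R)).
  exact: measurableX.
pose g := fun p : R * R => K * (\1_(`[a, b]%classic `*` `[c, d]%classic) p : R).
have leb2A : leb2 (`[a, b]%classic `*` `[c, d]%classic) = ((b - a) * (d - c))%:E.
  rewrite (_ : leb2 _ = mu `[a, b]%classic * mu `[c, d]%classic)%E; last first.
    exact: (@product_measure1E _ _ _ _ R mu mu).
  rewrite !lebesgue_measure_itv/= !lte_fin.
  have e (x y : R) : x <= y -> (if x < y then (y%:E - x%:E)%E else 0%E) = (y - x)%:E.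
    by rewrite le_eqVlt => /predU1P[->|->]; rewrite ?ltxx ?subrr// EFinB.
  by rewrite !e.
have i1 : leb2.-integrable setT (EFin \o (\1_(`[a, b]%classic `*` `[c, d]%classic) : R * R -> R)).
  apply/integrableP; split; first exact/measurable_EFinP/measurable_indic.
  under eq_integral do rewrite /= ger0_norm//.
  rewrite integral_indic// setIT.
  by rewrite [X in (X < _)%E](_ : _ = leb2 (`[a, b]%classic `*` `[c, d]%classic))// leb2A ltry.
have ig : leb2.-integrable setT (EFin \o g) by apply: (integrableZl _ K i1).
have fg p : `|f p| <= g p.
  rewrite /g indicE; have [|] := boolP (p \in _); first by rewrite mulr1.
  move=> pA; rewrite mulr0 normr_le0; apply: contraNT pA => /fbox[h1 h2].
  by rewrite inE/= !in_itv/=.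
have fi : leb2.-integrable setT (EFin \o f).
  apply: (@dominated_integrable_fun _ (measurableTypeR R * measurableTypeR R)%type R leb2 f g mf _ ig) => p.
  by rewrite (le_trans (fg p))// ler_norm.
split => //; apply: (@le_trans _ _ (\int[leb2]_p g p)).
  apply: le_Rintegral => //; exact: integrable_norm fi.
rewrite RintegralZl// /Rintegral integral_indic// setIT.
by rewrite [X in fine X](_ : _ = leb2 (`[a, b]%classic `*` `[c, d]%classic))// leb2A.
Qed.

Lemma integral_strip_le (T c : R) (f : R * R -> R) : 0 <= T -> 0 <= c ->
  measurable_fun [set: R * R] f ->
  (forall t, 0 <= t <= T -> (\int[mu]_x `|f (t, x)|%:E <= c%:E)%E) ->
  (\int[leb2]_(p in [set p | (0 <= p.1 <= T)%R]) `|f p|%:E <= (T * c)%:E)%E.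
Proof.
move=> T0 c0 mf fc.
rewrite integral_mkcond.
set F := (X in integral _ _ X).
have FE p : F p = if 0 <= p.1 <= T then `|f p|%:E else 0%E.
  by rewrite /F patchE mem_setE; case: ifP.
have F0 p : (0 <= F p)%E by rewrite FE; case: ifP.
have mF : measurable_fun [set: R * R] F.
  apply/measurable_restrict => //; first exact: measurable_strip.
  apply: measurable_funS (_ : measurable_fun setT _) => //.
  by apply/measurable_EFinP; exact: measurableT_comp.
rewrite (@fubini_tonelli1 _ _ _ _ _ mu mu F mF F0).
have -> : (T * c)%:E = (\int[mu]_(t in `[0%R, T]%classic) (cst c%:E) t)%E.
  rewrite integral_cst// [X in (_ * X)%E](_ : _ = mu `[0, T]%classic)// lebesgue_measure_itv/= lte_fin.
  move: T0; rewrite le_eqVlt => /predU1P[<-|->].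
    by rewrite ltxx mul0r mule0.
  by rewrite oppr0 adde0 -EFinM mulrC.
rewrite [leRHS]integral_mkcond; apply: ge0_le_integral => //.
- by move=> t _; apply: integral_ge0.
- exact: measurable_fun_fubini_tonelli_F.
- by apply/measurable_restrict => //; exact: measurable_cst.
move=> /= t _; rewrite patchE mem_setE in_itv/= /fubini_F.
case: ifPn => tT.
  apply: le_trans (fc t tT); rewrite le_eqVlt; apply/orP; left; apply/eqP.
  by apply: eq_integral => x _; rewrite FE/= tT.
by rewrite integral0_eq// => x _; rewrite FE/= (negbTE tT).
Qed.

End PlaneIntegrals.

(** * Weak form of a transport equation as a limit of discrete identities *)

Section WeakForm.
Context (R : realType).
Local Notation mu := (@lebesgue_measure R).
Local Notation leb2 := (@lebesgue_plane R).
Variables (c K : R) (r_ h_ : nat -> R * R -> R) (r h : R * R -> R) (r0 : R -> R)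
  (tk : nat -> R).
Hypotheses (tk_gt0 : forall k, 0 < tk k) (tk_le : forall k, tk k <= tk 0)
  (tk_cvg : tk @ \oo --> 0).
Hypotheses (mr_ : forall k, measurable_fun [set: R * R] (r_ k))
  (mh_ : forall k, measurable_fun [set: R * R] (h_ k))
  (mr : measurable_fun [set: R * R] r) (mh : measurable_fun [set: R * R] h)
  (mr0 : measurable_fun [set: R] r0).
Hypotheses (r_K : forall k p, `|r_ k p| <= K) (h_K : forall k p, `|h_ k p| <= K)
  (rK : forall p, `|r p| <= K) (hK : forall p, `|h p| <= K)
  (r0K : forall x, `|r0 x| <= K).
Hypothesis r_step : forall k (p : R * R), 0 <= p.1 ->
  r_ k (p.1 + tk k, p.2 + c * tk k) = r_ k p + tk k * h_ k p.
Hypothesis r_init : forall k (t x : R), 0 <= t -> t < tk k -> r_ k (t, x) = r0 x.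
Hypothesis r_limit : forall T : R, 0 <= T -> exists2 C : R, 0 <= C &
  forall k (t : R), 0 <= t <= T ->
    (\int[mu]_x `|r (t, x) - r_ k (t, x)|%:E <= (C * tk k)%:E)%E /\
    (\int[mu]_x `|h (t, x) - h_ k (t, x)|%:E <= (C * tk k)%:E)%E.
Variable phi : R * R -> R.
Hypotheses (C1phi : C1_plane phi) (cphi : compact_support phi).

Let phic : continuous phi := test_continuous C1phi.
Let der := transport_derivative phi c.
Let derc : continuous der := transport_derivative_continuous C1phi.

Let K0 : 0 <= K. Proof. exact: le_trans (rK 0). Qed.

Let phis k p := phi (p.1 + tk k, p.2 + c * tk k).
Let quot k p := (tk k)^-1 * (phis k p - phi p).
Let on (s : R) (p : R * R) : R := (s <= p.1)%R%:R.

Let limit_integrand p := on 0 p * (r p * der p + h p * phi p).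
Let approx_integrand k p := on 0 p * (r_ k p * quot k p + h_ k p * phis k p).
Let initial_layer k p := (tk k)^-1 * ((on 0 p - on (tk k) p) * (r0 p.2 * phi p)).
(** [initial_layer] with the test function frozen at [t = 0]. Its integral is exactly the initial
    term, and the difference of the two is bounded on a slab of thickness [tk k]. *)
Let initial_slab k p := (tk k)^-1 * ((on 0 p - on (tk k) p) * (r0 p.2 * phi (0, p.2))).

Let m_on s : measurable_fun [set: R * R] (on s).
Proof. exact: measurable_after. Qed.

Let m_phi : measurable_fun [set: R * R] phi.
Proof. exact: continuous_measurable_plane. Qed.

Let m_der : measurable_fun [set: R * R] der.
Proof. exact: continuous_measurable_plane. Qed.

Let m_phis k : measurable_fun [set: R * R] (phis k).
Proof. exact: (measurableT_comp m_phi (measurable_plane_shift _ _)). Qed.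

Let m_quot k : measurable_fun [set: R * R] (quot k).
Proof. by apply: measurable_funM => //; exact: measurable_funB. Qed.

Let m_r0 : measurable_fun [set: R * R] (fun p : R * R => r0 p.2).
Proof. exact: (measurableT_comp mr0 measurable_snd). Qed.

Let m_phi0 : measurable_fun [set: R] (fun x => phi (0, x)).
Proof. exact: (measurableT_comp m_phi (pair1_measurable _)). Qed.

Let m_phi0' : measurable_fun [set: R * R] (fun p : R * R => phi (0, p.2)).
Proof. exact: (measurableT_comp m_phi0 measurable_snd). Qed.

Let on01 s p : 0 <= on s p <= 1.
Proof. by rewrite /on; case: (s <= p.1)%R; rewrite ?lexx ?ler01. Qed.

(** Discrete integration by parts, pointwise: the right side is the difference between a function
    and its translate along the characteristic, so its integral over the plane is zero. The values
    on [0 <= t < tk k] are not the translate of anything and produce the initial layer. *)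
Let telescoping k p : approx_integrand k p + initial_layer k p =
  (tk k)^-1 * (on (tk k) (p.1 + tk k, p.2 + c * tk k) * r_ k (p.1 + tk k, p.2 + c * tk k)
    * phis k p - on (tk k) p * r_ k p * phi p).
Proof.
rewrite /approx_integrand /initial_layer /on /= lerDr.
have tk0 := tk_gt0 k; have tkN0 : tk k != 0 by rewrite gt_eqF.
have [p0|p0] := leP 0 p.1; last first.
  have -> : (tk k <= p.1) = false by apply/negbTE; rewrite -ltNge (lt_trans p0).
  by rewrite !(mul0r, subrr, mulr0, addr0).
rewrite (r_step k p0) /quot; have [pt|pt] := leP (tk k) p.1.
  by rewrite /=; field.
have <- : r_ k p = r0 p.2 by case: p p0 pt => t x /= *; exact: r_init.
by rewrite /=; field.
Qed.

Variables (L B : R).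
Hypotheses (L_gt0 : 0 < L)
  (phiL : forall p, phi p != 0 -> `|p.1| <= L /\ `|p.2| <= L)
  (phiB : forall p, `|phi p| <= B) (derB : forall p, `|der p| <= B)
  (der0B : forall p, `|transport_derivative phi 0 p| <= B).

Let B0 : 0 <= B. Proof. exact: le_trans (phiB 0). Qed.

(** Enlarged so that one box contains the supports of all shifted test functions, since
    [tk k <= tk 0]. *)
Let Lp := L + tk 0 * (1 + `|c|).
Let box : set (R * R) := `[- Lp, Lp]%classic `*` `[- Lp, Lp]%classic.
Let on_box (p : R * R) : R := \1_box p.
Let bounded_box (p : R * R) := `|p.1| <= Lp /\ `|p.2| <= Lp.

Let L_Lp : L <= Lp.
Proof. by rewrite lerDl mulr_ge0// ?addr_ge0// ltW. Qed.

Let Lp_ge0 : 0 <= Lp. Proof. exact: le_trans (ltW L_gt0) L_Lp. Qed.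

Let phi_box p : phi p != 0 -> bounded_box p.
Proof. by move=> /phiL[h1 h2]; split; exact: le_trans L_Lp. Qed.

Let phis_box k p : phis k p != 0 -> bounded_box p.
Proof.
move=> /phiL/= [h1 h2]; have := tk_le k; have := tk_gt0 k => tk0 tkk.
have hc := mulr_ge0 (ltW (tk_gt0 0)) (normr_ge0 c).
split; rewrite /Lp mulrDr mulr1.
  rewrite -(addrK (tk k) p.1) (le_trans (ler_normB _ _))// (gtr0_norm tk0).
  by lra.
rewrite -(addrK (c * tk k) p.2) (le_trans (ler_normB _ _))// normrM (gtr0_norm tk0).
have : `|c| * tk k <= `|c| * tk 0 by rewrite ler_wpM2l.
by have := tk_gt0 0; lra.
Qed.

Let quot_box k p : quot k p != 0 -> bounded_box p.
Proof.
have [e|/phi_box//] := eqVneq (phi p) 0.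
have [e'|/phis_box//] := eqVneq (phis k p) 0.
by rewrite /quot e e' subrr mulr0 eqxx.
Qed.

Let der_box p : der p != 0 -> bounded_box p.
Proof.
move=> /(transport_derivative_support C1phi L_gt0 phiL)[h1 h2].
by split; exact: le_trans L_Lp.
Qed.

Let on_box1 p : bounded_box p -> on_box p = 1.
Proof.
move=> [h1 h2]; rewrite /on_box indicE (_ : p \in box) ?mulr1//.
by rewrite inE; split; rewrite /= in_itv/= -ler_norml.
Qed.

Let on_box_neq0 p : on_box p != 0 -> bounded_box p.
Proof.
rewrite /on_box indicE; have [|] := boolP (p \in box); last by rewrite eqxx.
by rewrite inE => -[/=]; rewrite !in_itv/= -!ler_norml.
Qed.

Let on_box01 p : 0 <= on_box p <= 1.
Proof. by rewrite /on_box indicE; case: (_ \in _); rewrite ?lexx ?ler01. Qed.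

Let m_on_box : measurable_fun [set: R * R] on_box.
Proof. by apply: measurable_indic; exact: measurableX. Qed.

Let phisB k p : `|phis k p| <= B. Proof. exact: phiB. Qed.

Let quotE k p : exists2 th, 0 <= th <= tk k & quot k p = der (p.1 + th, p.2 + c * th).
Proof.
have [th hth e] := test_increment c C1phi p (tk_gt0 k).
by exists th => //; rewrite /quot /phis e mulKf// gt_eqF.
Qed.

Let quotB k p : `|quot k p| <= B.
Proof. by have [th _ ->] := quotE k p; exact: derB. Qed.

Let box_integrable (f : R * R -> R) (b : R) : measurable_fun [set: R * R] f ->
  (forall p, `|f p| <= b) -> (forall p, f p != 0 -> bounded_box p) ->
  leb2.-integrable setT (EFin \o f).
Proof.
move=> mf fb fbox.
have LL : - Lp <= Lp by rewrite ge0_cp.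
by apply: (integral_box LL LL mf fb _).1 => p /fbox[]; rewrite !ler_norml.
Qed.

Let i_limit : leb2.-integrable setT (EFin \o limit_integrand).
Proof.
apply: (@box_integrable _ (K * B + K * B)).
- apply: measurable_funM => //; apply: measurable_funD; exact: measurable_funM.
- move=> p; have /andP[h0 h1] := on01 0 p.
  rewrite normrM ger0_norm// -[leRHS]mul1r ler_pM//.
  by rewrite (le_trans (ler_normD _ _))// !normrM lerD// ler_pM.
move=> p; have [e|/der_box//] := eqVneq (der p) 0.
have [e'|/phi_box//] := eqVneq (phi p) 0.
by rewrite /limit_integrand e e' !mulr0 addr0 mulr0 eqxx.
Qed.

Let i_approx k : leb2.-integrable setT (EFin \o approx_integrand k).
Proof.
apply: (@box_integrable _ (K * B + K * B)).
- apply: measurable_funM => //; apply: measurable_funD; exact: measurable_funM.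
- move=> p; have /andP[h0 h1] := on01 0 p.
  rewrite normrM ger0_norm// -[leRHS]mul1r ler_pM//.
  rewrite (le_trans (ler_normD _ _))// normrM (normrM (h_ k p)).
  by apply: lerD; apply: ler_pM => //; exact: quotB.
move=> p; have [e|/quot_box//] := eqVneq (quot k p) 0.
have [e'|/phis_box//] := eqVneq (phis k p) 0.
by rewrite /approx_integrand e e' !mulr0 addr0 mulr0 eqxx.
Qed.

Let on_slab k p : on 0 p - on (tk k) p = (0 <= p.1 < tk k)%R%:R.
Proof.
rewrite /on; have [p0|p0] := leP 0 p.1; have [pt|pt] := leP (tk k) p.1 => /=.
- by rewrite subrr.
- by rewrite subr0.
- by move: p0; rewrite ltNge (le_trans (ltW (tk_gt0 k)) pt).
- by rewrite subrr.
Qed.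

Let slab01 k p : `|on 0 p - on (tk k) p| <= 1.
Proof. by rewrite on_slab; case: (_ && _); rewrite ?normr1 ?normr0 ?ler01. Qed.

Let i_layer k : leb2.-integrable setT (EFin \o initial_layer k).
Proof.
apply: (@box_integrable _ (`|(tk k)^-1| * (1 * (K * B)))).
- apply: measurable_funM => //; apply: measurable_funM; first exact: measurable_funB.
  exact: measurable_funM.
- by move=> p; rewrite /initial_layer normrM ler_wpM2l// normrM ler_pM// normrM ler_pM.
move=> p; have [e|/phi_box//] := eqVneq (phi p) 0.
by rewrite /initial_layer e !mulr0 eqxx.
Qed.

Let slab_box k p : initial_slab k p != 0 ->
  0 <= p.1 <= tk k /\ - L <= p.2 <= L.
Proof.
rewrite /initial_slab on_slab; have [e|/phiL[/= _ h2 nz]] := eqVneq (phi (0, p.2)) 0.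
  by rewrite e !mulr0 eqxx.
split; last by rewrite -ler_norml.
move: nz; case: (boolP (0 <= p.1 < tk k)) => [/andP[h0 h1] _|_]; first by rewrite h0 ltW.
by rewrite mul0r mulr0 eqxx.
Qed.

Let m_slab k : measurable_fun [set: R * R] (initial_slab k).
Proof.
apply: measurable_funM => //; apply: measurable_funM; first exact: measurable_funB.
exact: measurable_funM.
Qed.

Let i_slab k : leb2.-integrable setT (EFin \o initial_slab k).
Proof.
have LL : - L <= L by rewrite ge0_cp// ltW.
apply: (integral_box (K := `|(tk k)^-1| * (1 * (K * B))) (ltW (tk_gt0 k)) LL (m_slab k) _ _).1.
  by move=> p; rewrite /initial_slab normrM ler_wpM2l// normrM ler_pM// normrM ler_pM.
exact: slab_box.
Qed.

Let integral_telescoping k :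
  \int[leb2]_p approx_integrand k p + \int[leb2]_p initial_layer k p = 0.
Proof.
pose F p := on (tk k) p * r_ k p * phi p.
have mF : measurable_fun [set: R * R] F.
  by apply: measurable_funM => //; exact: measurable_funM.
have iF : leb2.-integrable setT (EFin \o F).
  apply: (@box_integrable _ (1 * K * B)) => //.
    move=> p; have /andP[h0 h1] := on01 (tk k) p.
    by rewrite !normrM !ler_pM// ger0_norm.
  move=> p; have [e|/phi_box//] := eqVneq (phi p) 0.
  by rewrite /F e !mulr0 eqxx.
have [iFs e] := integral_plane_translation (tk k) (c * tk k) mF iF.
rewrite -RintegralD//; try by [exact: i_approx|exact: i_layer].
under eq_Rintegral do rewrite telescoping.
rewrite RintegralZl//; last by apply: (integrableB _ iFs iF).
by rewrite RintegralB// e subrr mulr0.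
Qed.

Let i_initial : mu.-integrable setT (EFin \o (fun x => r0 x * phi (0, x))).
Proof.
have i1 : mu.-integrable setT (EFin \o (fun x => K * B * \1_(`[- L, L]%classic) x)).
  have i0 : mu.-integrable setT (EFin \o (\1_(`[- L, L]%classic) : R -> R)).
    apply/integrableP; split; first exact/measurable_EFinP/measurable_indic.
    under eq_integral do rewrite /= ger0_norm//.
    rewrite integral_indic// setIT [X in (X < _)%E](_ : _ = mu `[- L, L]%classic)//.
    by rewrite lebesgue_measure_itv/=; case: ifP => _; rewrite -?EFinD ltry.
  by apply: (integrableZl _ (K * B) i0).
apply: (@dominated_integrable_fun _ (measurableTypeR R) R mu _ _ _ _ i1).
  exact: measurable_funM.
move=> x; rewrite indicE; have [->|/phiL[/= _ h2]] := eqVneq (phi (0, x)) 0.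
  by rewrite mulr0 normr0.
rewrite mem_set; last by rewrite /= in_itv/= -ler_norml.
by rewrite mulr1 (ger0_norm (mulr_ge0 K0 B0)) normrM ler_pM.
Qed.

Let integral_slab k :
  \int[leb2]_p initial_slab k p = \int[mu]_x (r0 x * phi (0, x)).
Proof.
have := integral12_prod_meas1 (i_slab k) => e.
have ig := i_initial.
set I := \int[mu]_x (r0 x * phi (0, x)).
have inner t : (\int[mu]_x (initial_slab k (t, x))%:E =
    ((tk k)^-1 * I)%:E * (\1_(`[0%R, tk k[%classic) t)%:E)%E.
  have e1 : (0 <= t < tk k)%R%:R = \1_(`[0%R, tk k[%classic) t :> R.
    by rewrite indicE mem_setE in_itv.
  transitivity (\int[mu]_x (((tk k)^-1 * \1_(`[0%R, tk k[%classic) t)%:E *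
      (r0 x * phi (0, x))%:E))%E.
    apply: eq_integral => x _.
    rewrite /initial_slab on_slab/= e1 -EFinM.
    by congr (_%:E); exact: mulrA.
  rewrite integralZl//.
  rewrite -[X in (_ * X)%E]fineK; last exact: integrable_fin_num.
  by rewrite -!EFinM mulrAC.
rewrite {1}/Rintegral -[X in fine X]e /fubini_F.
under eq_integral do rewrite inner.
rewrite integralZl//; last first.
  apply/integrableP; split; first exact/measurable_EFinP/measurable_indic.
  under eq_integral do rewrite /= ger0_norm//.
  rewrite integral_indic// setIT [X in (X < _)%E](_ : _ = mu `[0, tk k[%classic)//.
  by rewrite lebesgue_measure_itv/=; case: ifP => _; rewrite -?EFinD ltry.
rewrite integral_indic// setIT [X in (_ * X)%E](_ : _ = mu `[0, tk k[%classic)//.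
rewrite lebesgue_measure_itv/= lte_fin tk_gt0 oppr0 adde0 -EFinM/= mulrAC.
by rewrite mulVf ?mul1r// gt_eqF.
Qed.

(** [phi] is only [C^1], so the difference quotients converge pointwise without a rate; this part
    goes to zero by dominated convergence, unlike [gap], which has a rate. *)
Let defect k p := `|der p - quot k p| + `|phi p - phis k p|.

Let m_defect k : measurable_fun [set: R * R] (defect k).
Proof.
by apply: measurable_funD; apply: measurableT_comp => //; exact: measurable_funB.
Qed.

Let defectB k p : `|defect k p| <= 4 * B * on_box p.
Proof.
rewrite ger0_norm ?addr_ge0//.
have [e|nz] := eqVneq (defect k p) 0.
  by rewrite e mulr_ge0 ?mulr_ge0//; have /andP[] := on_box01 p.
rewrite on_box1; last first.
  have [e|/der_box//] := eqVneq (der p) 0.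
  have [e'|/phi_box//] := eqVneq (phi p) 0.
  have [e''|/phis_box//] := eqVneq (phis k p) 0.
  by move: nz; rewrite /defect /quot e e' e'' !subrr mulr0 subrr normr0 addr0 eqxx.
rewrite /defect; have := ler_normB (der p) (quot k p).
have := ler_normB (phi p) (phis k p).
have := derB p; have := quotB k p; have := phiB p; have := phisB k p.
by lra.
Qed.

Let i_on_box : leb2.-integrable setT (EFin \o (fun p => 4 * B * on_box p)).
Proof.
apply: (@box_integrable _ (4 * B * 1)).
- exact: measurable_funM.
- move=> p; have /andP[h0 h1] := on_box01 p.
  by rewrite ger0_norm ?mulr_ge0// ler_wpM2l// mulr_ge0.
by move=> p nz; apply: on_box_neq0; apply: contra nz => /eqP->; rewrite mulr0.
Qed.

Let defect_cvg p : defect ^~ p @ \oo --> 0.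
Proof.
pose along s := der (p.1 + s, p.2 + c * s).
have along_c : along @ (0 : R) --> der p.
  have -> : der p = along 0 by rewrite /along mulr0 !addr0; case: (p).
  apply: (@continuous_comp _ _ _ (fun s : R => (p.1 + s, p.2 + c * s)) der); last exact: derc.
  have a1 : (fun s : R => p.1 + s) @ (0 : R) --> p.1 + 0.
    by apply: cvgD; [exact: cvg_cst|exact: cvg_id].
  have a2 : (fun s : R => p.2 + c * s) @ (0 : R) --> p.2 + c * 0.
    by apply: cvgD; [exact: cvg_cst|apply: cvgM; [exact: cvg_cst|exact: cvg_id]].
  exact: (cvg_pair a1 a2).
apply/cvgrPdist_lt => e e0.
have e2 : 0 < e / 2 by rewrite divr_gt0.
move/cvgrPdist_lt: along_c => /(_ _ e2) [d /= d0 hd].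
have small : \forall k \near \oo, tk k < d /\ tk k * B < e / 2.
  have h1 : \forall k \near \oo, tk k < d by exact: (cvgr_lt _ tk_cvg).
  have h2 : \forall k \near \oo, tk k * B < e / 2.
    have : (fun k => tk k * B) @ \oo --> 0 * B by apply: cvgM => //; exact: cvg_cst.
    by rewrite mul0r => htk; exact: (cvgr_lt _ htk).
  by near=> k; split; near: k.
apply: filterS small => k [h1 h2].
rewrite sub0r normrN ger0_norm ?addr_ge0// /defect.
have [th /andP[th0 thk] eq] := quotE k p.
have a1 : `|der p - quot k p| < e / 2.
  by rewrite eq; apply: hd; rewrite /= sub0r normrN ger0_norm// (le_lt_trans thk).
have a2 : `|phi p - phis k p| <= tk k * B.
  have -> : phi p - phis k p = - (tk k * quot k p).
    by rewrite /quot mulVKf ?opprB// gt_eqF.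
  by rewrite normrN normrM (gtr0_norm (tk_gt0 k)) ler_pM2l.
by lra.
Unshelve. all: by end_near. Qed.

Let defect_integral_cvg : (fun k => \int[leb2]_p defect k p) @ \oo --> 0.
Proof.
have hd := @dominated_cvg _ _ _ leb2 setT measurableT (fun k p => (defect k p)%:E)
  (fun _ => 0%E) (fun p => (4 * B * on_box p)%:E).
have {hd} : (\int[leb2]_p (defect k p)%:E @[k --> \oo] --> \int[leb2]_p (0 : \bar R))%E.
  apply: hd => //.
  - by move=> k; apply/measurable_EFinP; exact: m_defect.
  - by move=> p _; apply: cvg_EFin; [exact: nearW|exact: defect_cvg].
  - by move=> k p _; rewrite abse_EFin lee_fin; exact: defectB.
rewrite integral0 => /fine_cvg; exact.
Qed.

Let i_defect k : leb2.-integrable setT (EFin \o defect k).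
Proof.
apply: (@dominated_integrable_fun _ (measurableTypeR R * measurableTypeR R)%type R leb2 _ _ (m_defect k) _ i_on_box) => p.
by rewrite (le_trans (defectB k p))// ler_norm.
Qed.

Let gap k p := on 0 p * on_box p * (`|r p - r_ k p| + `|h p - h_ k p|).

Let m_gap k : measurable_fun [set: R * R] (gap k).
Proof.
apply: measurable_funM; first exact: measurable_funM.
by apply: measurable_funD; apply: measurableT_comp => //; exact: measurable_funB.
Qed.

Let i_gap k : leb2.-integrable setT (EFin \o gap k).
Proof.
apply: (@box_integrable _ (1 * 1 * (4 * K))) => //.
  move=> p; have /andP[a0 a1] := on01 0 p; have /andP[b0 b1] := on_box01 p.
  rewrite ger0_norm; last by rewrite mulr_ge0 ?mulr_ge0 ?addr_ge0.
  apply: ler_pM; rewrite ?mulr_ge0 ?addr_ge0//; first exact: ler_pM.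
  have := ler_normB (r p) (r_ k p); have := ler_normB (h p) (h_ k p).
  by have := rK p; have := r_K k p; have := hK p; have := h_K k p; lra.
move=> p nz; apply: on_box_neq0; apply: contra nz => /eqP e.
by rewrite /gap e mulr0 mul0r.
Qed.

Let gap_integral (C : R) k : 0 <= C ->
  (forall k (t : R), 0 <= t <= Lp ->
    (\int[mu]_x `|r (t, x) - r_ k (t, x)|%:E <= (C * tk k)%:E)%E /\
    (\int[mu]_x `|h (t, x) - h_ k (t, x)|%:E <= (C * tk k)%:E)%E) ->
  \int[leb2]_p gap k p <= Lp * (2 * C * tk k).
Proof.
move=> C0 hC; rewrite -lee_fin /Rintegral fineK; last exact: (integrable_fin_num measurableT (i_gap k)).
pose f p := `|r p - r_ k p| + `|h p - h_ k p|.
have mf : measurable_fun [set: R * R] f.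
  by apply: measurable_funD; apply: measurableT_comp => //; exact: measurable_funB.
have Ctk : 0 <= C * tk k by rewrite mulr_ge0// ltW.
apply: (@le_trans _ _ (\int[leb2]_(p in [set p | (0 <= p.1 <= Lp)%R]) `|f p|%:E)%E).
  rewrite [leRHS]integral_mkcond; apply: ge0_le_integral => //.
  - by move=> p _; rewrite lee_fin mulr_ge0// ?addr_ge0//; have /andP[] := on01 0 p; have /andP[] := on_box01 p => *; rewrite mulr_ge0.
  - by apply/measurable_EFinP; exact: m_gap.
  - apply/measurable_restrict => //; first exact: measurable_strip.
    apply: measurable_funS (_ : measurable_fun setT _) => //.
    by apply/measurable_EFinP; exact: measurableT_comp.
  move=> p _; rewrite patchE mem_setE.
  have f0 : 0 <= f p by rewrite addr_ge0.
  have /andP[a0 a1] := on01 0 p; have /andP[b0 b1] := on_box01 p.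
  case: ifPn => hp.
    rewrite lee_fin (ger0_norm f0) /gap -/(f p) ler_piMl//.
    by rewrite -[leRHS]mul1r ler_pM.
  rewrite lee_fin (_ : gap k p = 0)// /gap.
  have [p0|p0] := boolP (0 <= p.1); last by rewrite /on (negbTE p0) !mul0r.
  have [e|/on_box_neq0[h1 _]] := eqVneq (on_box p) 0; first by rewrite e mulr0 mul0r.
  by move/negP: hp; case; rewrite -topredE/= p0 (le_trans (ler_norm _) h1).
apply: integral_strip_le => //; first by rewrite -mulrA mulr_ge0.
move=> t tL; have [h1 h2] := hC k t tL.
have mt (g g' : R * R -> R) : measurable_fun setT g -> measurable_fun setT g' ->
    measurable_fun [set: R] (fun x : R => `|g (t, x) - g' (t, x)|%:E).
  move=> mg mg'; apply/measurable_EFinP; apply: measurableT_comp => //.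
  by apply: measurable_funB; [exact: (measurableT_comp mg (pair1_measurable t))|
    exact: (measurableT_comp mg' (pair1_measurable t))].
under eq_integral do rewrite ger0_norm ?addr_ge0// EFinD.
rewrite ge0_integralD//; [|exact: mt|exact: mt].
rewrite (le_trans (leeD h1 h2))// -EFinD lee_fin.
by lra.
Qed.

Let limit_approx k p : `|limit_integrand p - approx_integrand k p| <=
  B * gap k p + K * defect k p.
Proof.
have /andP[a0 a1] := on01 0 p.
rewrite /limit_integrand /approx_integrand -mulrBr normrM (ger0_norm a0).
have [nb|nb] := eqVneq (on_box p) 0.
  have z q : (q != 0 -> bounded_box p) -> q = 0 :> R.
    by move=> hq; apply/eqP; apply: contraT => /hq/on_box1; rewrite nb => /eqP; rewrite eq_sym oner_eq0.
  rewrite (z _ (@der_box p)) (z _ (@phi_box p)) (z _ (@quot_box k p)) (z _ (@phis_box k p)).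
  rewrite !mulr0 addr0 subrr normr0 mulr0 addr_ge0// mulr_ge0//.
    by rewrite /gap nb mulr0 mul0r.
  by rewrite addr_ge0.
rewrite /gap (on_box1 (on_box_neq0 nb)) mulr1.
have e : r p * der p + h p * phi p - (r_ k p * quot k p + h_ k p * phis k p) =
  (r p - r_ k p) * quot k p + (h p - h_ k p) * phis k p +
  (r p * (der p - quot k p) + h p * (phi p - phis k p)) by ring.
have b1 : `|(r p - r_ k p) * quot k p + (h p - h_ k p) * phis k p| <=
    B * (`|r p - r_ k p| + `|h p - h_ k p|).
  rewrite (le_trans (ler_normD _ _))// !(normrM (_ - _)) mulrDr.
  by apply: lerD; rewrite mulrC ler_wpM2r.
have b2 : `|r p * (der p - quot k p) + h p * (phi p - phis k p)| <= K * defect k p.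
  rewrite (le_trans (ler_normD _ _))// (normrM (r p)) (normrM (h p)) mulrDr.
  by apply: lerD; rewrite ler_wpM2r.
rewrite e [B * (_ * _)]mulrCA (le_trans (ler_wpM2l a0 (ler_normD _ _)))// mulrDr lerD//.
  by rewrite ler_wpM2l.
by rewrite (le_trans _ b2)// ler_piMl.
Qed.

Let slab_layer k p : `|initial_slab k p - initial_layer k p| <= K * B.
Proof.
rewrite /initial_slab /initial_layer -mulrBr on_slab -mulrBr -mulrBr.
case: (boolP (0 <= p.1 < tk k)) => [/andP[p0 p1]|_]; last first.
  by rewrite mul0r mulr0 normr0 mulr_ge0.
rewrite mul1r !normrM (ger0_norm (ltW _)) ?invr_gt0//.
have le : `|phi (0, p.2) - phi p| <= tk k * B.
  move: p0; rewrite le_eqVlt => /predU1P[p0|p0].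
    have -> : p = (0, p.2) by rewrite p0; case: (p).
    by rewrite subrr normr0 mulr_ge0// ltW.
  have [th _] := test_increment 0 C1phi (0, p.2) p0.
  rewrite /= !mul0r addr0 add0r distrC => e.
  rewrite (_ : phi p - _ = p.1 * transport_derivative phi 0 (0 + th, p.2)); last first.
    by rewrite -e; case: (p).
  by rewrite normrM (gtr0_norm p0) ler_pM// ltW.
rewrite mulrCA ler_pM//.
  by rewrite mulr_ge0// invr_ge0 ltW.
by rewrite ler_pdivrMl.
Qed.

Let slab_layer_integral k :
  `|\int[leb2]_p initial_slab k p - \int[leb2]_p initial_layer k p| <=
  K * B * (tk k * (2 * L)).
Proof.
rewrite -RintegralB//; try by [exact: i_slab|exact: i_layer].
have LL : - L <= L by rewrite ge0_cp// ltW.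
have m : measurable_fun [set: R * R] (fun p => initial_slab k p - initial_layer k p).
  apply: measurable_funB; first exact: m_slab.
  by apply: measurable_funM => //; apply: measurable_funM;
    [exact: measurable_funB|exact: measurable_funM].
have [|i e] := integral_box (ltW (tk_gt0 k)) LL m (slab_layer k).
  move=> p; have [e|/phiL[_ h2]] := eqVneq (phi p) 0.
    rewrite /initial_layer e !mulr0 subr0; exact: slab_box.
  rewrite /initial_slab /initial_layer on_slab -mulrBr -mulrBr.
  case: (boolP (0 <= p.1 < tk k)) => [/andP[h0 h1] _|_].
    by rewrite h0 (ltW h1) -ler_norml.
  by rewrite mul0r mulr0 eqxx.
rewrite (le_trans (le_normr_Rintegral _ i))// (le_trans e)//.
by rewrite subr0 opprK -mulr2n mulr_natl.
Qed.

Lemma transport_weak_form_bounded :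
  [/\ leb2.-integrable setT (EFin \o (fun p =>
         (0 <= p.1)%R%:R * (r p * transport_derivative phi c p + h p * phi p))),
      mu.-integrable setT (EFin \o (fun x => r0 x * phi (0, x))) &
      \int[leb2]_p ((0 <= p.1)%R%:R * (r p * transport_derivative phi c p + h p * phi p))
      + \int[mu]_x (r0 x * phi (0, x)) = 0].
Proof.
split; [exact: i_limit|exact: i_initial|].
rewrite -[X in X + _]/(\int[leb2]_p limit_integrand p).
set X := _ + _.
have [C C0 hC] := r_limit Lp_ge0.
(* [X] does not depend on [k]. Subtracting the telescoping identity, whose value is zero, leaves the
   distance from limit to approximation, the defect of the test function, and the slab against the
   layer. *)
have est k : `|X| <= B * (Lp * (2 * C * tk k)) + K * \int[leb2]_p defect k p
    + K * B * (tk k * (2 * L)).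
  have -> : X = (\int[leb2]_p limit_integrand p - \int[leb2]_p approx_integrand k p)
    + (\int[leb2]_p initial_slab k p - \int[leb2]_p initial_layer k p).
    rewrite integral_slab addrACA -[LHS]subr0 -opprD; congr (_ - _).
    by rewrite integral_telescoping.
  apply: (le_trans (ler_normD _ _)); apply: lerD; last exact: slab_layer_integral.
  have i1 : leb2.-integrable setT (EFin \o (fun p => B * gap k p)).
    by apply: (integrableZl _ B (i_gap k)).
  have i2 : leb2.-integrable setT (EFin \o (fun p => K * defect k p)).
    by apply: (integrableZl _ K (i_defect k)).
  have i3 : leb2.-integrable setT (EFin \o (fun p => limit_integrand p - approx_integrand k p)).
    by apply: (integrableB _ i_limit (i_approx k)).
  rewrite -RintegralB//; try by [exact: i_limit|exact: i_approx].
  apply: (le_trans (le_normr_Rintegral measurableT i3)).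
  apply: (@le_trans _ _ (\int[leb2]_p (B * gap k p + K * defect k p))).
    apply: le_Rintegral; [by []|exact: (integrable_norm i3)| |].
    by apply: (integrableD _ i1 i2).
    by move=> p _; exact: limit_approx.
  rewrite RintegralD// !RintegralZl//; try by [exact: i_gap|exact: i_defect].
  by rewrite lerD2r ler_wpM2l// gap_integral.
have lim : (fun k => B * (Lp * (2 * C * tk k)) + K * \int[leb2]_p defect k p
    + K * B * (tk k * (2 * L))) @ \oo --> B * (Lp * (2 * C * 0)) + K * 0 + K * B * (0 * (2 * L)).
  apply: cvgD; first apply: cvgD.
  - by do 3 (apply: cvgMr).
  - by apply: cvgMr.
  - by apply: cvgMr; apply: cvgMl.
rewrite !(mulr0, mul0r, addr0) in lim.
apply/eqP; rewrite -normr_le0 -(cvg_lim _ lim)//.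
apply: limr_ge; first by apply/cvg_ex; exists 0.
by apply: nearW.
Qed.

End WeakForm.

Lemma transport_weak_form (R : realType) (c K : R) (r_ h_ : nat -> R * R -> R)
    (r h : R * R -> R) (r0 : R -> R) (tk : nat -> R) :
  (forall k, 0 < tk k) -> (forall k, tk k <= tk 0) -> tk @ \oo --> 0 ->
  (forall k, measurable_fun [set: R * R] (r_ k)) ->
  (forall k, measurable_fun [set: R * R] (h_ k)) ->
  measurable_fun [set: R * R] r -> measurable_fun [set: R * R] h ->
  measurable_fun [set: R] r0 ->
  (forall k p, `|r_ k p| <= K) -> (forall k p, `|h_ k p| <= K) ->
  (forall p, `|r p| <= K) -> (forall p, `|h p| <= K) -> (forall x, `|r0 x| <= K) ->
  (forall k (p : R * R), 0 <= p.1 ->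
    r_ k (p.1 + tk k, p.2 + c * tk k) = r_ k p + tk k * h_ k p) ->
  (forall k (t x : R), 0 <= t -> t < tk k -> r_ k (t, x) = r0 x) ->
  (forall T : R, 0 <= T -> exists2 C : R, 0 <= C & forall k (t : R), 0 <= t <= T ->
    (\int[@lebesgue_measure R]_x `|r (t, x) - r_ k (t, x)|%:E <= (C * tk k)%:E)%E /\
    (\int[@lebesgue_measure R]_x `|h (t, x) - h_ k (t, x)|%:E <= (C * tk k)%:E)%E) ->
  forall phi : R * R -> R, C1_plane phi -> compact_support phi ->
  [/\ (@lebesgue_plane R).-integrable setT (EFin \o (fun p =>
         (0 <= p.1)%R%:R * (r p * transport_derivative phi c p + h p * phi p))),
      (@lebesgue_measure R).-integrable setT (EFin \o (fun x => r0 x * phi (0, x))) &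
      \int[@lebesgue_plane R]_p
        ((0 <= p.1)%R%:R * (r p * transport_derivative phi c p + h p * phi p))
      + \int[@lebesgue_measure R]_x (r0 x * phi (0, x)) = 0].
Proof.
move=> tk0 tkle tkc mr_ mh_ mr mh mr0 r_K h_K rK hK r0K rs ri rl phi C1phi cphi.
have [L L0 phiL] := test_support cphi.
have [B1 B10 phiB] := continuous_box_bounded (test_continuous C1phi) phiL.
have dL c' := transport_derivative_support (c := c') C1phi L0 phiL.
have dC c' := transport_derivative_continuous (c := c') C1phi.
have [B2 B20 derB] := continuous_box_bounded (dC c) (dL c).
have [B3 B30 der0B] := continuous_box_bounded (dC 0) (dL 0).
apply: (@transport_weak_form_bounded _ c K r_ h_ r h r0 tk tk0 tkle tkc mr_ mh_ mr mh
  mr0 r_K h_K rK hK r0K rs ri rl phi C1phi L (B1 + B2 + B3)) => // p.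
- by rewrite (le_trans (phiB p))// -addrA lerDl addr_ge0.
- by rewrite (le_trans (derB p))// addrAC lerDr addr_ge0.
- by rewrite (le_trans (der0B p))// lerDr addr_ge0.
Qed.

Section ExactWeakForm.
Context (R : realType).
Local Notation leb := (@lebesgue_measure R).
Local Notation leb2 := (@lebesgue_plane R).
Local Notation bv := (bv_modulus (@N2 R) (@Tr R)).
Variables (rM : R * R -> R * R) (lM : l1_lip 1 rM) (rM0 : rM 0 = 0).
Hypothesis cM : conservative rM.
Variables (mu sp U B0 B1 : R) (w0 : LL R).
Hypotheses (mu0 : 0 < mu) (sp0 : 0 <= sp).
Hypotheses (w0B0 : N2 w0 <= B0) (w0B1 : bv B1 w0) (w0U : trapped U w0).

Let M := lift ler01 lM rM0.
Let ex := exact lM rM0 cM mu0 sp0 w0B0 w0B1 w0U.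
Let app := approx lM rM0 mu sp w0.
Let eu := exact_u lM rM0 mu sp w0.
Let ey := exact_y lM rM0 mu sp w0.
Let eu_bound := @exact_u_bound R rM lM rM0 cM mu sp U w0 mu0 w0U.
Let ey_bound := @exact_y_bound R rM lM rM0 cM mu sp U w0 mu0 w0U.
Let N2D' := @N2D R.
Let N2Z' := @N2Z R.

Let U0 : 0 <= U. Proof. by rewrite (le_trans _ (eu_bound 0 0)). Qed.

Let drift (f : LL R) : LL R := mu *: (M f - f).
Let e1 p := eu p.1 p.2 + ey p.1 p.2.
Let e2 p := eu p.1 p.2 - ey p.1 p.2.
(** One bound for states and sources: each exact Riemann component is at most [U + 2 * U], hence
    [l1 <= 6 * U], and a drift component is at most [mu * (2 * l1)]. *)
Let bound := 3 * U + mu * (12 * U).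

Let bound_ge : 3 * U <= bound.
Proof. by rewrite /bound lerDl; apply: mulr_ge0; [exact: ltW|rewrite mulr_ge0]. Qed.

Let drift_le_bound : mu * (12 * U) <= bound.
Proof. by rewrite /bound lerDr mulr_ge0. Qed.

Let l1_drift z : `|mu * ((rM z).1 - z.1)| <= mu * (2 * l1 z) /\
  `|mu * ((rM z).2 - z.2)| <= mu * (2 * l1 z).
Proof.
have h := l1_lip_le z lM rM0; rewrite mul1r in h.
rewrite !normrM (gtr0_norm mu0) !ler_pM2l//.
have := ler_normB (rM z).1 z.1; have := ler_normB (rM z).2 z.2.
have := normr_ge0 (rM z).1; have := normr_ge0 (rM z).2.
have := normr_ge0 z.1; have := normr_ge0 z.2.
by move: h; rewrite /l1 => *; split; lra.
Qed.

Let app_bound k t x : `|(app k t).1 x| <= 2 * U /\ `|(app k t).2 x| <= 2 * U.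
Proof. exact: trapped_bound (@approx_trapped R rM lM rM0 cM mu sp U w0 mu0 w0U k t). Qed.

Let drift_bound k t x : `|(drift (app k t)).1 x| <= bound /\
  `|(drift (app k t)).2 x| <= bound.
Proof.
have [a1 a2] := app_bound k t x.
have [h1 h2] := l1_drift ((app k t).1 x, (app k t).2 x).
have hl : mu * (2 * l1 ((app k t).1 x, (app k t).2 x)) <= bound.
  apply: le_trans drift_le_bound.
  by rewrite ler_pM2l// /l1/=; have := U0; lra.
by split; [apply: le_trans h1 hl|apply: le_trans h2 hl].
Qed.

Let exact_bound p : `|e1 p| <= 3 * U /\ `|e2 p| <= 3 * U.
Proof.
have := eu_bound p.1 p.2; have := ey_bound p.1 p.2.
have := ler_normD (eu p.1 p.2) (ey p.1 p.2).
have := ler_normB (eu p.1 p.2) (ey p.1 p.2).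
by rewrite /e1 /e2 /eu /ey => *; split; lra.
Qed.

Let exact_drift_bound p :
  `|mu * ((rM (e1 p, e2 p)).1 - e1 p)| <= bound /\
  `|mu * ((rM (e1 p, e2 p)).2 - e2 p)| <= bound.
Proof.
have [a1 a2] := exact_bound p; have [h1 h2] := l1_drift (e1 p, e2 p).
have hl : mu * (2 * l1 (e1 p, e2 p)) <= bound.
  apply: le_trans drift_le_bound.
  by rewrite ler_pM2l// /l1/=; lra.
by split; [apply: le_trans h1 hl|apply: le_trans h2 hl].
Qed.

Let tk k := tau mu k.
Let tk_gt0 k : 0 < tk k := tau_gt0 mu0 k.

Let tk_le k : tk k <= tk 0.
Proof.
rewrite /tk /tau ler_pM2l ?invr_gt0// expr0 exprn_ile1 ?invr_ge0//.
by rewrite invf_le1 ?ler1n.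
Qed.

Let tk_cvg : tk @ \oo --> 0.
Proof.
by apply: (@cvg_geometric R mu^-1 2^-1); rewrite ger0_norm// invf_lt1 ?ltr1n.
Qed.

Let app_next k t : 0 <= t -> app k (t + tk k) =
  Sh (sp * tk k) (app k t + tk k *: drift (app k t)).
Proof.
move=> t0; have tk0 := tk_gt0 k.
rewrite /app /approx -/(tk k) mulrDl mulfV ?gt_eqF//.
rewrite (_ : Num.truncn _ = (Num.truncn (t / tk k)).+1); last first.
  apply/eqP; rewrite truncn_eq ?addr_ge0 ?divr_ge0 ?(ltW tk0)//.
  rewrite -!natr1 lerD2r ltrD2r.
  rewrite truncn_le ?divr_ge0 ?(ltW tk0)//.
  by have := truncnS_gt (t / tk k); rewrite -natr1.
by rewrite iterS /approx_step /splitting scalerA (mulrC (tk k)).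
Qed.

Let app_init k t : 0 <= t -> t < tk k -> app k t = w0.
Proof.
move=> t0 tt; rewrite /app /approx (_ : Num.truncn _ = 0%N)//.
by apply/eqP; rewrite -leqn0 truncn_le_nat ltr_pdivrMr ?mul1r//; exact: tk_gt0.
Qed.

Let app_cvg T : 0 <= T -> exists2 C : R, 0 <= C & forall k t, 0 <= t <= T ->
  N2 (ex t - app k t) <= C * tk k /\ N2 (drift (ex t) - drift (app k t)) <= C * tk k.
Proof.
move=> T0; have r0 := rate_ge0 mu0 sp0 w0B0 w0B1 T0.
set C0 := 8 * rate mu sp B0 B1 T * mu.
have C00 : 0 <= C0 by rewrite /C0; apply: mulr_ge0; [rewrite mulr_ge0|exact: ltW].
exists (C0 * (1 + 2 * mu)); first by rewrite mulr_ge0// addr_ge0// mulr_ge0// ltW.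
move=> k t /andP[t0 tT].
have h1 : N2 (ex t - app k t) <= C0 * tk k.
  rewrite /C0 -mulrA [mu * _]mu_tau//.
  exact: approx_limit.
have Ck : 0 <= C0 * tk k by rewrite mulr_ge0// ltW.
have lMf := @lift_lip R 1 rM ler01 lM rM0 (ex t) (app k t).
rewrite mul1r -/M in lMf.
have Cm : 0 <= C0 * tk k * mu by rewrite mulr_ge0// ltW.
split; first by rewrite (le_trans h1)//; lra.
have -> : drift (ex t) - drift (app k t) = mu *: ((M (ex t) - M (app k t)) - (ex t - app k t)).
  by rewrite /drift -scalerBr; congr (_ *: _); rewrite opprD addrACA [in RHS]opprD.
rewrite N2Z (gtr0_norm mu0).
have h2 : N2 ((M (ex t) - M (app k t)) - (ex t - app k t)) <= 2 * (C0 * tk k).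
  rewrite (le_trans (seminormB N2D' N2Z' _ _))//.
  by have := le_trans lMf h1; lra.
have := ler_wpM2l (ltW mu0) h2; lra.
Qed.

Let N1_fst (f : LL R) : N1 f.1 <= N2 f.
Proof. by rewrite lerDl N1_ge0. Qed.
Let N1_snd (f : LL R) : N1 f.2 <= N2 f.
Proof. by rewrite lerDr N1_ge0. Qed.

Let m_step (F : LL R -> L1 R) k : measurable_fun [set: R * R] (fun p => F (app k p.1) p.2).
Proof.
apply: (@measurable_step _ (fun t => Num.truncn (t / tau mu k))
  (fun n => F (iter n (approx_step lM rM0 mu sp k) w0))).
  exact: measurable_truncn_div (tau_gt0 mu0 k).
by move=> n; exact: measurable_L1.
Qed.

Let m_eu : measurable_fun [set: R * R] (fun p => eu p.1 p.2).
Proof. exact: (@measurable_exact_u R rM lM rM0 cM mu sp U w0 mu0 w0U). Qed.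
Let m_ey : measurable_fun [set: R * R] (fun p => ey p.1 p.2).
Proof. exact: (@measurable_exact_y R rM lM rM0 cM mu sp U w0 mu0 w0U). Qed.
Let m_e1 : measurable_fun [set: R * R] e1.
Proof. exact: measurable_funD. Qed.
Let m_e2 : measurable_fun [set: R * R] e2.
Proof. exact: measurable_funB. Qed.

Let m_rM (pr : R * R -> R) : continuous pr ->
  measurable_fun [set: R * R] (fun p => pr (rM (e1 p, e2 p))).
Proof.
move=> cpr.
have m : measurable_fun [set: R * R] (pr \o rM).
  apply: continuous_measurable_plane => z; apply: continuous_comp; last exact: cpr.
  exact: (l1_lip_continuous lM).
exact: (measurableT_comp m (measurable_fun_pair m_e1 m_e2)).
Qed.

Section TestFunction.
Variable phi : R * R -> R.
Hypotheses (C1phi : C1_plane phi) (cphi : compact_support phi).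

Let slice_le (f g : L1 R) (q : R -> R) (b : R) :
  (forall x, q x = (f - g) x) -> N1 (f - g) <= b -> (\int[leb]_x `|q x|%:E <= b%:E)%E.
Proof.
move=> e h; rewrite -lee_fin EFin_N1 in h; apply: le_trans h.
by under eq_integral do rewrite e.
Qed.

Lemma exact_weak_fst :
  [/\ leb2.-integrable setT (EFin \o (fun p => (0 <= p.1)%R%:R *
        (e1 p * transport_derivative phi sp p
         + mu * ((rM (e1 p, e2 p)).1 - e1 p) * phi p))),
      leb.-integrable setT (EFin \o (fun x => w0.1 x * phi (0, x))) &
      \int[leb2]_p ((0 <= p.1)%R%:R * (e1 p * transport_derivative phi sp p
         + mu * ((rM (e1 p, e2 p)).1 - e1 p) * phi p))
      + \int[leb]_x (w0.1 x * phi (0, x)) = 0].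
Proof.
apply: (@transport_weak_form R sp bound (fun k p => (app k p.1).1 p.2)
  (fun k p => (drift (app k p.1)).1 p.2) e1 _ w0.1 tk) => //.
- by move=> k; exact: (m_step (fun f => (drift f).1)).
- apply: measurable_funM => //; apply: measurable_funB => //.
  by apply: (m_rM (pr := fst)) => z; exact: cvg_fst.
- exact: measurable_L1.
- move=> k p; have [h _] := app_bound k p.1 p.2; rewrite (le_trans h)//.
  by have := bound_ge; have := U0; lra.
- by move=> k p; have [] := drift_bound k p.1 p.2.
- by move=> p; have [h _] := exact_bound p; exact: le_trans bound_ge.
- by move=> p; have [] := exact_drift_bound p.
- move=> x; have [h _] := trapped_bound x w0U; rewrite (le_trans h)//.
  by have := bound_ge; have := U0; lra.
- move=> k p p0; rewrite /= app_next// -[LHS]/((app k p.1).1 (p.2 + sp * tk k - sp * tk k)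
    + tk k * (drift (app k p.1)).1 (p.2 + sp * tk k - sp * tk k)).
  by rewrite addrK.
- by move=> k t x t0 tt; rewrite /= app_init.
move=> T T0; have [C C0 hC] := app_cvg T0; exists C => // k t tT.
have [h1 h2] := hC k t tT; split.
  apply: (slice_le (f := (ex t).1) (g := (app k t).1)) => //.
  exact: le_trans (N1_fst _) h1.
apply: (slice_le (f := (drift (ex t)).1) (g := (drift (app k t)).1)) => //.
exact: le_trans (N1_fst _) h2.
Qed.

Lemma exact_weak_snd :
  [/\ leb2.-integrable setT (EFin \o (fun p => (0 <= p.1)%R%:R *
        (e2 p * transport_derivative phi (- sp) p
         + mu * ((rM (e1 p, e2 p)).2 - e2 p) * phi p))),
      leb.-integrable setT (EFin \o (fun x => w0.2 x * phi (0, x))) &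
      \int[leb2]_p ((0 <= p.1)%R%:R * (e2 p * transport_derivative phi (- sp) p
         + mu * ((rM (e1 p, e2 p)).2 - e2 p) * phi p))
      + \int[leb]_x (w0.2 x * phi (0, x)) = 0].
Proof.
apply: (@transport_weak_form R (- sp) bound (fun k p => (app k p.1).2 p.2)
  (fun k p => (drift (app k p.1)).2 p.2) e2 _ w0.2 tk) => //.
- by move=> k; exact: (m_step (fun f => (drift f).2)).
- apply: measurable_funM => //; apply: measurable_funB => //.
  by apply: (m_rM (pr := snd)) => z; exact: cvg_snd.
- exact: measurable_L1.
- move=> k p; have [_ h] := app_bound k p.1 p.2; rewrite (le_trans h)//.
  by have := bound_ge; have := U0; lra.
- by move=> k p; have [] := drift_bound k p.1 p.2.
- by move=> p; have [_ h] := exact_bound p; exact: le_trans bound_ge.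
- by move=> p; have [] := exact_drift_bound p.
- move=> x; have [_ h] := trapped_bound x w0U; rewrite (le_trans h)//.
  by have := bound_ge; have := U0; lra.
- move=> k p p0; rewrite /= app_next// -[LHS]/((app k p.1).2 (p.2 + - sp * tk k + sp * tk k)
    + tk k * (drift (app k p.1)).2 (p.2 + - sp * tk k + sp * tk k)).
  by rewrite mulNr subrK.
- by move=> k t x t0 tt; rewrite /= app_init.
move=> T T0; have [C C0 hC] := app_cvg T0; exists C => // k t tT.
have [h1 h2] := hC k t tT; split.
  apply: (slice_le (f := (ex t).2) (g := (app k t).2)) => //.
  exact: le_trans (N1_snd _) h1.
apply: (slice_le (f := (drift (ex t)).2) (g := (drift (app k t)).2)) => //.
exact: le_trans (N1_snd _) h2.
Qed.

Let half_plane_integral (F : R * R -> R) :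
  \int[leb2]_(p in @closed_half_plane R) F p = \int[leb2]_p ((0 <= p.1)%R%:R * F p).
Proof.
rewrite Rintegral_mkcond; apply: eq_Rintegral => p _; rewrite patchE.
rewrite mem_setE (_ : (p \in _) = (0 <= p.1)%R)//.
by case: (0 <= p.1)%R; rewrite ?mul1r ?mul0r.
Qed.

(** Half the sum and [sp / 2] times the difference of the two transport identities; conservation by
    [rM] cancels the sources in the sum. *)
Lemma exact_weak_form :
  \int[leb2]_(p in @closed_half_plane R)
    (eu p.1 p.2 * d1 phi p + sp * ey p.1 p.2 * d2 phi p)
  + \int[leb]_x ((w0.1 x + w0.2 x) / 2 * phi (0, x)) = 0 /\
  \int[leb2]_(p in @closed_half_plane R)
    (sp * ey p.1 p.2 * d1 phi p + sp ^+ 2 * eu p.1 p.2 * d2 phi p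
     + mu * (flux sp (rM (e1 p, e2 p)) - sp * ey p.1 p.2) * phi p)
  + \int[leb]_x (flux sp (w0.1 x, w0.2 x) * phi (0, x)) = 0.
Proof.
have [i1 j1 h1] := exact_weak_fst; have [i2 j2 h2] := exact_weak_snd.
rewrite !half_plane_integral.
set F1 := fun p => (0 <= p.1)%R%:R * _ in i1 h1.
set F2 := fun p => (0 <= p.1)%R%:R * _ in i2 h2.
have comb (a b : R) : \int[leb2]_p (a * F1 p + b * F2 p) +
   \int[leb]_x (a * (w0.1 x * phi (0, x)) + b * (w0.2 x * phi (0, x))) = 0.
  have z1 : leb2.-integrable setT (EFin \o (fun p => a * F1 p)) by apply: (integrableZl _ a i1).
  have z2 : leb2.-integrable setT (EFin \o (fun p => b * F2 p)) by apply: (integrableZl _ b i2).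
  have z3 : leb.-integrable setT (EFin \o (fun x => a * (w0.1 x * phi (0, x)))) by apply: (integrableZl _ a j1).
  have z4 : leb.-integrable setT (EFin \o (fun x => b * (w0.2 x * phi (0, x)))) by apply: (integrableZl _ b j2).
  rewrite (RintegralD measurableT z1 z2) (RintegralD measurableT z3 z4).
  rewrite !RintegralZl//.
  by rewrite addrACA -!mulrDr h1 h2 !mulr0 addr0.
have cs p := cM (e1 p, e2 p).
split.
  rewrite -[RHS](comb 2^-1 2^-1); congr (_ + _); last first.
    by apply: eq_Rintegral => x _; ring.
  apply: eq_Rintegral => p _; rewrite /F1 /F2 /transport_derivative.
  have -> : (rM (e1 p, e2 p)).1 = e1 p + e2 p - (rM (e1 p, e2 p)).2.
    by have := cs p; rewrite /= => <-; rewrite addrK.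
  by rewrite /e1 /e2; field.
rewrite -[RHS](comb (sp / 2) (- (sp / 2))); congr (_ + _); last first.
  by apply: eq_Rintegral => x _; rewrite /flux/=; ring.
apply: eq_Rintegral => p _; rewrite /F1 /F2 /transport_derivative /flux.
by rewrite /e1 /e2; field.
Qed.

End TestFunction.
End ExactWeakForm.

(** * Error estimate in Riemann coordinates *)

Section SchemeError.
Context (R : realType).
Local Notation bv := (bv_modulus (@N2 R) (@Tr R)).
Variables (G : R -> R -> R) (eqA : R -> R) (gu b0 beta s : R).
Hypotheses (s0 : 0 < s) (b00 : 0 < b0) (gs : gu <= s * b0) (beta0 : 0 < beta).
Hypothesis Gu : forall u u' v, `|G u v - G u' v| <= gu * `|u - u'|.
Hypothesis Gv : forall u v v' : R, v' <= v ->
  b0 * (v - v') <= G u v - G u v' <= beta * (v - v').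
Hypothesis GA : forall u, G u (eqA u) = 0.
Hypothesis A0 : eqA 0 = 0.
Variables (U B0 B1 eps : R) (w0 : LL R).
Hypotheses (eps0 : 0 < eps).
Hypotheses (w0B0 : N2 w0 <= B0) (w0B1 : bv B1 w0) (w0U : trapped U w0).

Definition rate_mu := beta / eps.

Lemma rate_mu_gt0 : 0 < rate_mu. Proof. exact: divr_gt0. Qed.

Let rMlip := maxwellian_lip s0 b00 gs beta0 Gu Gv.
Let rM0 := maxwellian0 beta s GA A0.
Let rMc := @maxwellian_conservative R G beta s.

Definition solution : R -> LL R :=
  exact rMlip rM0 rMc rate_mu_gt0 (ltW s0) w0B0 w0B1 w0U.

Let N2D' := @N2D R.
Let N2Z' := @N2Z R.
Let Sh0' := @Sh0 R.
Let ShD' := @ShD R.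
Let N2Sh' := @N2_Sh R.
Let TrSh' := @Tr_Sh R.
Let N2ShTr' := @N2_Sh_Tr R.

Let B1_ge0 : 0 <= B1.
Proof. exact: (bv_modulus_ge0 N2D' N2Z' w0B1). Qed.

Let B0_ge0 : 0 <= B0.
Proof. by rewrite (le_trans _ w0B0)//; exact: (seminorm_ge0 N2D' N2Z'). Qed.

Section Mesh.
Variables (dt dx : R).
Hypotheses (dt0 : 0 < dt) (dx0 : 0 < dx) (cfl : s * dt / dx < 1).

Let lam := s * dt / dx.
Let b := rate_mu * dt.

Let b_ge0 : 0 <= b. Proof. by rewrite mulr_ge0// ltW// rate_mu_gt0. Qed.

Let lam01 : 0 <= lam <= 1.
Proof. by rewrite (ltW cfl) andbT mulr_ge0 ?invr_ge0 ?mulr_ge0// ltW. Qed.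

Let rel_lip := relaxation_lip s0 b00 gs beta0 Gu Gv GA b_ge0.
Let rel0 := relaxation0 beta s GA A0 b.
Let gain_lip := relaxation_gain_lip s0 b00 gs beta0 Gu Gv GA b_ge0.
Let gain0 := relaxation_gain0 beta s GA A0 b.

Let e := expR (- b).

Let e1 : 0 <= 1 - e.
Proof. by rewrite subr_ge0 -expR0 ler_expR oppr_le0. Qed.

Definition relax : LL R -> LL R := lift ler01 rel_lip rel0.
Let gain : LL R -> LL R := lift e1 gain_lip gain0.

Let relaxE f : relax f = e *: f + gain f.
Proof.
congr pair; apply: L1_ext => x.
  by rewrite -[LHS]/((relaxation G eqA beta s b (f.1 x, f.2 x)).1) relaxation_split.
by rewrite -[LHS]/((relaxation G eqA beta s b (f.1 x, f.2 x)).2) relaxation_split.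
Qed.

(** Shifts of functions by [dx] replace shifts of the cell index. Started from cell averages this
    reproduces the grid values, while it also applies to [w0] itself, so that the projection error
    can be split off by contraction. *)
Definition grid_step (f : LL R) : LL R := relax (upwind (@Sh R) lam dx f).

Definition projected : LL R := (projection dx0 w0.1, projection dx0 w0.2).

Definition discrete (n : nat) : LL R := iter n grid_step projected.

Let relax_lip : seminorm_lip (@N2 R) 1 relax.
Proof. exact: lift_lip. Qed.

Let grid_step_lip : seminorm_lip (@N2 R) 1 grid_step.
Proof.
move=> f g; rewrite (le_trans (relax_lip _ _))// !mul1r.
by have := upwind_lip N2D' N2Z' N2Sh' dx lam01 f g; rewrite mul1r.
Qed.

Let relax_0 : relax 0 = 0.
Proof.
congr pair; apply: L1_ext => x.
  by rewrite -[LHS]/((relaxation G eqA beta s b 0).1) rel0.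
by rewrite -[LHS]/((relaxation G eqA beta s b 0).2) rel0.
Qed.

Let grid_step0 : grid_step 0 = 0.
Proof.
have u0 : upwind (@Sh R) lam dx (0 : LL R) = 0.
  by have := upwindB (@Sh R) lam dx (0 : LL R) 0; rewrite !subrr => <-.
by rewrite /grid_step u0 relax_0.
Qed.

Lemma discrete_le n : N2 (discrete n) <= B0.
Proof.
apply: (@le_trans _ _ (N2 projected)); last first.
  by apply: le_trans w0B0; rewrite /N2 lerD// N1_projection.
rewrite /discrete; elim: n => // n IH; rewrite iterS (le_trans _ IH)//.
by have := grid_step_lip (iter n grid_step projected) 0; rewrite grid_step0 !subr0 mul1r.
Qed.

Let projected_dist : N2 (projected - w0) <= 4 * B1 * dx.
Proof.
have [h1 h2] : (forall y, N1 (shift1 (- y) w0.1 - w0.1) <= B1 * `|y|) /\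
    (forall y, N1 (shift1 (- y) w0.2 - w0.2) <= B1 * `|y|).
  by split => y; apply: le_trans (w0B1 y); rewrite /N2 ?lerDl ?lerDr N1_ge0.
have := N1_projection_dist dx0 h1; have := N1_projection_dist dx0 h2.
rewrite /N2 => k1 k2; apply: (le_trans (lerD k2 k1)); lra.
Qed.

Let transport_error (t T : R) : 0 <= t -> t <= T ->
  N2 (iter (Num.truncn (t / dt)) grid_step w0
      - iter (Num.truncn (t / dt)) (fun f => relax (Sh (s * dt) f)) w0)
  <= (1 + rate_mu * T) * (B1 * (Num.sqrt dx * (s * T + 1) / 2)).
Proof.
move=> t0 tT; have T0 : 0 <= T := le_trans t0 tT.
set n := Num.truncn _.
have nT : n%:R * dt <= T by exact: truncn_le_div.
have sd0 : 0 < Num.sqrt dx by rewrite sqrtr_gt0.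
have sd2 : Num.sqrt dx * Num.sqrt dx = dx by rewrite -expr2 sqr_sqrtr// ltW.
have lamdx : lam * dx = s * dt by rewrite /lam divfK// gt_eqF.
set err := Num.sqrt dx * (s * T + 1) / 2.
have err0 : 0 <= err.
  by rewrite /err !mulr_ge0 ?invr_ge0 ?addr_ge0 ?mulr_ge0// ltW.
have herr j (f : LL R) C : bv C f -> (j <= n)%N ->
    N2 (iter j (upwind (@Sh R) lam dx) f - Sh (j%:R * (lam * dx)) f) <= C * err.
  move=> fC jn.
  (* The choice [del = sqrt dx] balances the variance, at most [s * T * dx], against [del / 2]. *)
  have := upwind_transport_error N2D' N2Z' Sh0' ShD' N2Sh' N2ShTr' dx lam01 j fC sd0.
  move/le_trans; apply; rewrite ler_wpM2l//; first exact: (bv_modulus_ge0 N2D' N2Z' fC).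
  have jT : j%:R * (s * dt) <= s * T.
    rewrite mulrCA ler_pM2l// (le_trans _ nT)// ler_pM2r// ler_nat//.
  have h1 : j%:R * (lam * (1 - lam) * dx ^+ 2) <= s * T * dx.
    rewrite (_ : _ * _ = (j%:R * (s * dt)) * dx * (1 - lam)); last first.
      by rewrite -lamdx; ring.
    have /andP[l0 l1] := lam01.
    rewrite -[leRHS]mulr1 ler_pM//; first by rewrite !mulr_ge0// ltW.
    - by rewrite subr_ge0.
    - by rewrite ler_pM2r.
    by rewrite lerBlDr lerDl.
  have -> : err = s * T * dx / (2 * Num.sqrt dx) + Num.sqrt dx / 2.
    rewrite /err -{2}sd2; move: sd0; move: (Num.sqrt dx) => q q0.
    by field; rewrite gt_eqF.
  by rewrite lerD2r ler_pM2r// invr_gt0 mulr_gt0.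
have gainT y g : gain (Tr y g) = Tr y (gain g) := lift_Tr e1 gain_lip gain0 y g.
have e0 : 0 <= e := expR_ge0 _.
have h := upwind_relaxation_error N2D' N2Z' ShD' N2Sh' TrSh' lam01 e0 e1
  (subrKC _ _) (lift_lip e1 gain_lip gain0) gainT w0B1 herr (leqnn (0 + n)%N).
have g1 : (fun f => e *: upwind (@Sh R) lam dx f + gain (upwind (@Sh R) lam dx f)) = grid_step.
  by apply/funext => f; rewrite /grid_step relaxE.
have g2 : (fun f => e *: Sh (lam * dx) f + gain (Sh (lam * dx) f)) =
    (fun f => relax (Sh (s * dt) f)).
  by apply/funext => f; rewrite relaxE lamdx.
rewrite -/gain g1 g2 mul0r Sh0 in h; apply: (le_trans h).
apply: ler_wpM2r; first exact: mulr_ge0.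
rewrite lerD2l.
(* The relaxation mass accumulated over [n] steps is thus at most [n * b <= rate_mu * T]: one power
   of [1 / eps] only. *)
have eb : 1 - e <= b by have := expR_ge1Dx (- b); rewrite -/e; lra.
have r0 := ltW rate_mu_gt0.
apply: (@le_trans _ _ (n%:R * b)); first exact: ler_wpM2l.
by rewrite /b mulrCA ler_wpM2l.
Qed.

Let time_error (t T : R) : 0 <= t -> t <= T ->
  N2 (iter (Num.truncn (t / dt)) (fun f => relax (Sh (s * dt) f)) w0 - solution t)
  <= (8 * T * rate_mu + 2) * (rate_mu * B0 + s * B1) * dt.
Proof.
move=> t0 tT; rewrite /solution.
apply: exact_consistent => //.
  by move=> f g; rewrite (le_trans (relax_lip _ _))// -raddfB N2_Sh mul1r.
move=> f fB0 fB1.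
apply: (relaxation_consistent N2D' N2Z' N2Sh' N2ShTr' _ (ltW rate_mu_gt0) (ltW s0)
  (ltW dt0) fB0 fB1); first exact: lift_lip.
move=> g; apply: N2_le_l1; first by rewrite mulr_ge0// sqr_ge0.
move=> x.
exact: (relaxation_consistent_l1 s0 b00 gs beta0 Gu Gv GA A0 b_ge0 (g.1 x, g.2 x)).
Qed.

Lemma mesh_error (t T : R) : 0 <= t -> t <= T ->
  N2 (discrete (Num.truncn (t / dt)) - solution t) <=
    4 * B1 * dx + (1 + rate_mu * T) * (B1 * (Num.sqrt dx * (s * T + 1) / 2))
    + (8 * T * rate_mu + 2) * (rate_mu * B0 + s * B1) * dt.
Proof.
move=> t0 tT; set n := Num.truncn _.
have h1 : N2 (discrete n - iter n grid_step w0) <= 4 * B1 * dx.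
  apply: le_trans projected_dist.
  by have := seminorm_lip1_iter n grid_step_lip projected w0; rewrite mul1r.
have h2 := transport_error t0 tT; have h3 := time_error t0 tT.
rewrite -/n in h2 h3.
apply: (le_trans (seminorm_triangle N2D' (iter n grid_step w0) _ _)).
rewrite -[leRHS]addrA; apply: (lerD h1).
apply: (le_trans (seminorm_triangle N2D' (iter n (fun f => relax (Sh (s * dt) f)) w0) _ _)).
exact: lerD.
Qed.

End Mesh.

(** The summands come from the projection of the data, upwind transport, time discretization, and
    the crude [L^1] bound used when [sqrt dx] exceeds [eps]. *)
Definition error_constant (T epsmax : R) : R :=
  4 * B1 * epsmax ^+ 2 + (epsmax + beta * T) * (B1 * ((s * T + 1) / 2))
  + (8 * T * beta + 2 * epsmax) * (beta * B0 + s * B1 * epsmax) / s + 2 * B0.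

Lemma scheme_error (dt dx t T epsmax : R) (dt0 : 0 < dt) (dx0 : 0 < dx)
    (cfl : s * dt / dx < 1) : 0 <= t -> t <= T -> eps <= epsmax ->
  N2 (discrete dt0 dx0 (Num.truncn (t / dt)) - solution t)
  <= error_constant T epsmax / eps * Num.sqrt dx.
Proof.
move=> t0 tT em; have T0 : 0 <= T := le_trans t0 tT.
have em0 : 0 < epsmax := lt_le_trans eps0 em.
set q := Num.sqrt dx.
have q0 : 0 < q by rewrite sqrtr_gt0.
have q2 : q * q = dx by rewrite -expr2 sqr_sqrtr// ltW.
set c1 := 4 * B1 * epsmax ^+ 2.
set c2 := (epsmax + beta * T) * (B1 * ((s * T + 1) / 2)).
set c3 := (8 * T * beta + 2 * epsmax) * (beta * B0 + s * B1 * epsmax) / s.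
have c10 : 0 <= c1 by rewrite /c1 mulr_ge0 ?sqr_ge0// mulr_ge0.
have sT0 : 0 <= s * T by rewrite mulr_ge0// ltW.
have bT0 : 0 <= beta * T by rewrite mulr_ge0// ltW.
have c20 : 0 <= c2 by rewrite !mulr_ge0 ?addr_ge0 ?invr_ge0// ltW.
have d0 : 0 <= beta * B0 + s * B1 * epsmax by rewrite addr_ge0 ?mulr_ge0// ltW.
have d1 : 0 <= 8 * T * beta + 2 * epsmax by rewrite addr_ge0 ?mulr_ge0// ltW.
have c30 : 0 <= c3 by rewrite !mulr_ge0// invr_ge0 ltW.
rewrite /error_constant -/c1 -/c2 -/c3 mulrAC ler_pdivlMr//.
have [qe|qe] := leP q eps; last first.
  have h : N2 (discrete dt0 dx0 (Num.truncn (t / dt)) - solution t) <= 2 * B0.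
    rewrite (le_trans (seminormB N2D' N2Z' _ _))// mulr2n mulrDl !mul1r lerD//.
      exact: discrete_le.
    exact: exact_le tT T0.
  apply: (@le_trans _ _ (2 * B0 * q)).
    apply: ler_pM => //; [exact: (seminorm_ge0 N2D' N2Z')|exact: ltW|exact: ltW].
  by rewrite ler_pM2r// lerDr !addr_ge0.
have h := mesh_error dt0 dx0 cfl t0 tT.
have dts : dt <= q * eps / s.
  rewrite ler_pdivlMr// mulrC (@le_trans _ _ dx)//.
    by rewrite -[leRHS]mul1r -ler_pdivrMr// ltW.
  by rewrite -q2 ler_pM2l.
have k1 : 4 * B1 * dx * eps <= c1 * q.
  have : q * eps <= epsmax ^+ 2.
    have qm := le_trans qe em.
    by rewrite expr2; apply: ler_pM => //; exact: ltW.
  have Bq : 0 <= 4 * B1 * q by rewrite !mulr_ge0// ltW.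
  by move/(ler_wpM2l Bq); rewrite -q2 /c1; lra.
have k2 : (1 + rate_mu * T) * (B1 * (q * (s * T + 1) / 2)) * eps <= c2 * q.
  have e1 : (1 + rate_mu * T) * eps = eps + beta * T.
    by rewrite /rate_mu; field; rewrite gt_eqF.
  have x0 : 0 <= B1 * (q * (s * T + 1) / 2).
    by rewrite !mulr_ge0 ?invr_ge0 ?addr_ge0// ltW.
  have : (eps + beta * T) * (B1 * (q * (s * T + 1) / 2)) <=
     (epsmax + beta * T) * (B1 * (q * (s * T + 1) / 2)) by rewrite ler_wpM2r// lerD2r.
  rewrite (_ : (1 + _) * _ * eps = (1 + rate_mu * T) * eps * (B1 * (q * (s * T + 1) / 2))).
    by rewrite e1 /c2; lra.
  by ring.
(* The two factors [rate_mu = beta / eps] are absorbed by the explicit [eps] and by the one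
   contained in [dt <= q * eps / s]. *)
have k3 : (8 * T * rate_mu + 2) * (rate_mu * B0 + s * B1) * dt * eps <= c3 * q.
  have y0 : 0 <= (8 * T * rate_mu + 2) * (rate_mu * B0 + s * B1) * eps.
    have m0 := ltW rate_mu_gt0.
    have y1 : 0 <= 8 * T * rate_mu + 2 by rewrite addr_ge0// mulr_ge0// mulr_ge0.
    have y2 : 0 <= rate_mu * B0 + s * B1 by rewrite addr_ge0// mulr_ge0// ltW.
    by apply: mulr_ge0; [exact: mulr_ge0|exact: ltW].
  apply: (@le_trans _ _ ((8 * T * beta + 2 * eps) * (beta * B0 + s * B1 * eps) / s * q)).
    have := ler_wpM2l y0 dts; rewrite mulrAC; move=> /le_trans; apply.
    rewrite le_eqVlt; apply/orP; left; apply/eqP.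
    by rewrite /rate_mu; field; rewrite !gt_eqF.
  rewrite ler_pM2r// /c3 ler_pM2r ?invr_gt0// ler_pM//.
  - by rewrite addr_ge0 ?mulr_ge0// ltW.
  - by rewrite addr_ge0 ?mulr_ge0// ltW.
  - by rewrite lerD2l ler_pM2l.
  by rewrite lerD2l ler_wpM2l// mulr_ge0// ltW.
apply: (@le_trans _ _ (c1 * q + c2 * q + c3 * q)).
  apply: (le_trans (ler_wpM2r (ltW eps0) h)); rewrite -/q.
  rewrite [leLHS](mulrDl _ _ eps) [X in X + _ <= _](mulrDl _ _ eps).
  exact: (lerD (lerD k1 k2) k3).
by rewrite -!mulrDl ler_pM2r// lerDl mulr_ge0.
Qed.

End SchemeError.

(** * Grid scheme and its reconstruction *)

Section Interfaces.
Context (R : realType).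
Local Notation mu := (@lebesgue_measure R).
Variables (dt dx : R).
Hypotheses (dt0 : 0 < dt) (dx0 : 0 < dx).

Definition interfaces : set R := range (interface dx).

Lemma countable_interfaces : countable interfaces.
Proof. exact: (sub_countable (card_image_le _ _) (countableP _)). Qed.

Lemma measurable_interfaces : measurable interfaces.
Proof. exact: countable_measurable countable_interfaces. Qed.

(** Cells being open, the reconstruction vanishes at the interfaces; this factor records the null
    set on which it differs from the value at [cell_index]. *)
Definition off_interfaces (x : R) : R := \1_(~` interfaces) x.

Lemma measurable_off_interfaces : measurable_fun [set: R] off_interfaces.
Proof. by apply: measurable_indic; apply: measurableC; exact: measurable_interfaces. Qed.

Lemma off_interfaces_ae : {ae mu, forall x, off_interfaces x = 1}.
Proof.
exists interfaces; split.
- exact: measurable_interfaces.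
- exact: (countable_lebesgue_measure0 countable_interfaces).
move=> x /= h; apply: contrapT => hx; apply: h.
by rewrite /off_interfaces indicE mem_set.
Qed.

Lemma cell_off_interfaces x j : cell_index dx x = j ->
  \1_(cell dx j) x = off_interfaces x.
Proof.
move=> e; rewrite /off_interfaces !indicE; congr (_ %:R).
have := cell_index_eq dx0 x j; rewrite e eqxx => /esym/andP[h1 h2].
case: (boolP (x \in ~` interfaces)) => hx; last first.
  rewrite memNset// /cell/= in_itv/= => /andP[h3 h4].
  move: hx; rewrite notin_setE/= => /contrapT[i _ ix].
  move: h3 h4; rewrite -ix /interface !ltr_pM2r// !ltrD2r !ltr_int => h3 h4.
  by move: h3; rewrite ltrBlDr ltzD1 leNgt h4.
rewrite mem_set//; rewrite /cell/= in_itv/= h2 andbT lt_neqAle h1 andbT.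
apply/eqP => hxe; move: hx; rewrite inE/=; apply.
by exists (j - 1).
Qed.

Lemma reconstructE (w : nat -> int -> R) (t x : R) : 0 <= t ->
  reconstruct dt dx w (t, x) =
  w (Num.truncn (t / dt)) (cell_index dx x) * off_interfaces x.
Proof.
move=> t0; set n := Num.truncn _; set j := cell_index dx x.
have tn : n%:R * dt <= t < n.+1%:R * dt.
  by rewrite -ler_pdivlMr// -ltr_pdivrMr// truncn_itv// divr_ge0// ltW.
(* Only the term [(n, j)] can be nonzero, so the sum over all indices has finite support; at an
   interface that term vanishes as well. *)
rewrite /reconstruct -(fsbig_widen [set (n, j)])//.
  rewrite fsbig_set1/= (@cell_off_interfaces x j)//.
  by rewrite indicE mem_set ?mulr1// /= in_itv/= tn.
move=> -[m i] /= [_ hmi].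
have [mi|xi] := eqVneq i j; last first.
  rewrite [\1_(cell dx i) x]indicE memNset ?mulr0 ?mul0r// => /(cell_index_cell dx0) e.
  by move/eqP: xi; apply; rewrite -e.
rewrite [\1_(`[_, _[%classic) t]indicE memNset ?mulr0// /= in_itv/= => /andP[h1 h2].
apply: hmi; rewrite mi; congr pair; apply/eqP; rewrite eq_sym.
rewrite truncn_eq ?divr_ge0 ?(ltW dt0)//.
by rewrite ler_pdivlMr// ltr_pdivrMr// h1.
Qed.

End Interfaces.

Section GridScheme.
Context (R : realType).
Local Notation bv := (bv_modulus (@N2 R) (@Tr R)).
Variables (G : R -> R -> R) (eqA : R -> R) (gu b0 beta s : R).
Hypotheses (s0 : 0 < s) (b00 : 0 < b0) (gs : gu <= s * b0) (beta0 : 0 < beta).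
Hypothesis Gu : forall u u' v, `|G u v - G u' v| <= gu * `|u - u'|.
Hypothesis Gv : forall u v v' : R, v' <= v ->
  b0 * (v - v') <= G u v - G u v' <= beta * (v - v').
Hypothesis GA : forall u, G u (eqA u) = 0.
Hypothesis A0 : eqA 0 = 0.
Variables (U eps : R) (w0 : LL R).
Hypotheses (eps0 : 0 < eps) (w0U : trapped U w0).
Variables (dt dx : R).
Hypotheses (dt0 : 0 < dt) (dx0 : 0 < dx) (cfl : s * dt / dx < 1).
Variables (calR : R * R -> R) (A : R -> R) (a : R) (u0 v0 : R -> R).
Hypotheses (sa : s = Num.sqrt a).
Hypothesis calRG : forall u v, `|u| <= U -> `|v| <= 2 * U * s -> calR (u, v) = G u v.
Hypothesis AeqA : forall u, `|u| <= U -> A u = eqA u.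
Hypothesis u0_avg : forall j, cell_average dx u0 j =
  dens (cell_average dx w0.1 j, cell_average dx w0.2 j).
Hypothesis v0_avg : forall j, cell_average dx v0 j =
  flux s (cell_average dx w0.1 j, cell_average dx w0.2 j).

Let lam01 : 0 <= s * dt / dx <= 1.
Proof. by rewrite (ltW cfl) andbT mulr_ge0 ?invr_ge0 ?mulr_ge0// ltW. Qed.

Let state n := discrete s0 b00 gs beta0 Gu Gv GA A0 w0 eps0 dt0 dx0 n.
Let sch := scheme calR A a beta eps dt dx u0 v0.

Let a_s2 : a = s ^+ 2.
Proof.
(* [Num.sqrt] is [0] on negative numbers, so a positive square root forces [a] to be nonnegative. *)
rewrite sa sqr_sqrtr// leNgt; apply/negP => a0.
by have := s0; rewrite sa ltr0_sqrtr ?ltxx.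
Qed.

Lemma projected_trapped : trapped U (projected w0 dx0).
Proof.
have [c [d [e1 e2 l1c l1d h]]] := w0U; exists c, d; split=> // x.
split; [apply: projection_ubound|apply: projection_ubound|apply: projection_lbound|
  apply: projection_lbound] => y; by have [] := h y.
Qed.

Lemma state_trapped n : trapped U (state n).
Proof.
rewrite /state /discrete; elim: n => [|n IH]; first exact: projected_trapped.
rewrite iterS; apply: trapped_lift.
  exact: relaxation_conservative.
exact: trapped_upwind.
Qed.

(** In Riemann coordinates the centred step with viscosity [sqrt a] is diagonal and becomes the
    upwind average. Quantifying over [x] lets the induction reach the neighbouring cells through
    [x - dx] and [x + dx]. Trapping of the transported state permits replacing [calR] and [A] by [G]
    and [eqA]. *)
Lemma scheme_state n x :
  sch n (cell_index dx x) = (dens ((state n).1 x, (state n).2 x),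
                             flux s ((state n).1 x, (state n).2 x)).
Proof.
elim: n x => [|n IH] x; first by rewrite /sch /= u0_avg v0_avg.
set f := state n; pose g := upwind (@Sh R) (s * dt / dx) dx f.
have fU : trapped U g by apply: trapped_upwind => //; exact: state_trapped.
have g1 : g.1 x = (1 - s * dt / dx) * f.1 x + s * dt / dx * f.1 (x - dx) by [].
have g2 : g.2 x = (1 - s * dt / dx) * f.2 x + s * dt / dx * f.2 (x + dx) by [].
have tr : transport_step a dt dx (sch n) (cell_index dx x) =
    (dens (g.1 x, g.2 x), flux s (g.1 x, g.2 x)).
  rewrite g1 g2 /transport_step /= -sa -cell_indexB// -cell_indexD// !IH -/f a_s2.
  by rewrite /dens /flux/=; congr pair; field; rewrite gt_eqF.
have hu : `|dens (g.1 x, g.2 x)| <= U.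
  have h := trapped_density x fU; rewrite /dens normrM (@ger0_norm _ 2^-1)//.
  by rewrite ler_pdivrMr// mulrC.
have hv : `|flux s (g.1 x, g.2 x)| <= 2 * U * s.
  have [h1 h2] := trapped_bound x fU.
  rewrite /flux !normrM (gtr0_norm s0) (@ger0_norm _ 2^-1)// mulrC ler_pM2r//.
  rewrite ler_pdivrMr//; have := ler_normB (g.1 x) (g.2 x); lra.
have sE : state n.+1 = relax s0 b00 gs beta0 Gu Gv GA A0 eps0 dt0 g by [].
rewrite -[LHS]/(relaxation_step calR A beta eps dt (transport_step a dt dx (sch n) (cell_index dx x))).
have e12 : ((state n.+1).1 x, (state n.+1).2 x) =
    relaxation G eqA beta s (rate_mu beta eps * dt) (g.1 x, g.2 x).
  by rewrite sE; exact: liftE.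
have b_eq : rate_mu beta eps * dt = beta * dt / eps by rewrite /rate_mu mulrAC.
rewrite tr e12 /relaxation_step /relaxation /relax_map calRG// AeqA//.
move: hu hv; set u := dens _; set v := flux _ _ => hu hv.
rewrite /relaxed_flux b_eq; set e := expR _.
by rewrite /dens /flux /=; congr pair; field; rewrite ?gt_eqF.
Qed.

End GridScheme.

(** * Truncation of the source term and of the data *)

Section Regularization.
Context (R : realType).

Definition clip (N x : R) : R := Num.max (- N) (Num.min N x).

Lemma clip_bound (N x : R) : 0 <= N -> `|clip N x| <= N.
Proof.
move=> N0; rewrite ler_norml /clip le_max lexx/= ge_max ge_min lexx/= andbT.
by rewrite ge0_cp.
Qed.

Lemma clip_id (N x : R) : `|x| <= N -> clip N x = x.
Proof.
rewrite ler_norml => /andP[h1 h2].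
by rewrite /clip (min_idPr h2) (max_idPr h1).
Qed.

Lemma clip_le (N x y : R) : x <= y -> 0 <= clip N y - clip N x <= y - x.
Proof.
rewrite /clip; case: (leP N x) => hx; case: (leP N y) => hy;
  rewrite ?maxEle; do 2 ?case: ifPn; rewrite -?ltNge => *; apply/andP; split; lra.
Qed.

Lemma clip_dist (N x y : R) : `|clip N x - clip N y| <= `|x - y|.
Proof.
wlog xy : x y / x <= y => [hw|].
  by have [/hw|/ltW/hw] := leP x y; rewrite // distrC (distrC y).
have /andP[h1 h2] := clip_le N xy.
by rewrite distrC (distrC x) (ger0_norm h1) ger0_norm// subr_ge0.
Qed.

Lemma clip0 (N : R) : 0 <= N -> clip N 0 = 0.
Proof. by move=> N0; rewrite clip_id// normr0. Qed.

Lemma vertical_increment (phi : R * R -> R) (x y y' : R) : C1_plane phi -> y < y' ->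
  exists2 z, y <= z <= y' & phi (x, y') - phi (x, y) = d2 phi (x, z) * (y' - y).
Proof.
move=> [dphi _ _] yy.
have hd z : is_derive z (1 : R) (fun z => phi (x, z)) (d2 phi (x, z)).
  set q := (x, z).
  have dq : derivable phi q (0, 1) by exact: diff_derivable.
  have eqf : (fun h : R => h^-1 *: ((phi \o shift q) (h *: ((0, 1) : R * R)) - phi q)) =
      (fun h : R => h^-1 *: (((fun z => phi (x, z)) \o shift z) (h *: (1 : R)) - phi (x, z))).
    apply/funext => h /=; congr (_ *: (phi _ - _)).
    by rewrite /q; congr pair; rewrite /= -[_ *: _]/(_ * _) ?mulr0 ?add0r.
  apply: DeriveDef.
    by rewrite /derivable -eqf.
  by rewrite /derive -eqf.
have [|z] := MVT_segment (ltW yy) (fun z _ => hd z).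
  apply: derivable_within_continuous => z _; by case: (hd z).
by rewrite in_itv/= => hz e; exists z.
Qed.

Lemma horizontal_increment (phi : R * R -> R) (x x' y : R) : C1_plane phi -> x < x' ->
  exists2 z, x <= z <= x' & phi (x', y) - phi (x, y) = d1 phi (z, y) * (x' - x).
Proof.
move=> C1phi xx; have tau0 : 0 < x' - x by rewrite subr_gt0.
have [th /andP[h0 h1] e] := test_increment 0 C1phi (x, y) tau0.
exists (x + th); first by rewrite lerDl h0/= addrC -lerBrDr.
move: e; rewrite /transport_derivative/= !mul0r !addr0 (addrC x) subrK => ->.
by rewrite mulrC.
Qed.

Variables (calR : R * R -> R) (A g beta0 H : R -> R) (N0 a0 a beta : R).
Hypotheses (hC1 : C1_plane calR) (hE : equilibrium calR A)
  (hD : gradient_bounds calR g beta0 H) (hbeta : 0 < beta)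
  (hP : parameter_choice A g beta0 H N0 a0 a beta) (N0_ge0 : 0 <= N0).

Let U := Ubound N0 a0.
Let V := Vbound A N0 a0.
Let s := Num.sqrt a.

Lemma Ubound_ge0 : 0 <= U.
Proof. by rewrite mulr_ge0// addr_ge0// invr_ge0 sqrtr_ge0. Qed.

Lemma Ubound_le_Vbound : U <= V.
Proof.
rewrite lerDl mulr_ge0 ?invr_ge0 ?sqrtr_ge0// /Fbound.
set E := [set _ | _ in _].
(* [sup] is [0] by default when there is no supremum, which is nonnegative all the same. *)
have [hs|/sup_out->//] := pselect (has_sup E).
apply: ub_le_sup; first by case: hs.
exists 0; first by rewrite /= normr0 Ubound_ge0.
by have [_ -> _] := hE; rewrite normr0.
Qed.

(** Evaluating [calR] at [clip U u] makes the local bounds at level [V >= U] global in [u] without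
    changing [calR] where the solutions live. In [v] the bounds are already uniform. *)
Lemma regularization : exists (G : R -> R -> R) (eqA : R -> R) (gu b0 : R),
  [/\ 0 < b0 /\ gu <= s * b0,
      forall u u' v, `|G u v - G u' v| <= gu * `|u - u'|,
      forall u v v' : R, v' <= v -> b0 * (v - v') <= G u v - G u v' <= beta * (v - v'),
      (forall u, G u (eqA u) = 0) /\ eqA 0 = 0 &
      (forall u v, `|u| <= U -> `|v| <= 2 * U * s -> calR (u, v) = G u v) /\
      (forall u, `|u| <= U -> A u = eqA u)].
Proof.
have [_ A0 hA] := hE; have [hs hb] := hP.
have s0 : 0 <= s := sqrtr_ge0 _.
(* For [N0 = 0] the radius [V] may be [0], where the gradient bounds say nothing. Only the state
   [(0, 0)] then matters, and the linear source [beta * v] agrees with [calR] there. *)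
move: N0_ge0; rewrite le_eqVlt => /predU1P[N00|N0_gt0].
  have U0 : U = 0 by rewrite /U /Ubound -N00 mulr0.
  exists (fun _ v => beta * v), (fun _ => 0), 0, beta; split.
  - by split => //; rewrite mulr_ge0// ltW.
  - by move=> u u' v; rewrite subrr normr0 mul0r.
  - by move=> u v v' _; rewrite -mulrBr lexx.
  - by split => // u; rewrite mulr0.
  split => [u v|u]; rewrite U0.
    rewrite mulr0 mul0r !normr_le0 => /eqP-> /eqP->.
    by rewrite mulr0; apply/hA.
  by rewrite normr_le0 => /eqP->.
have U_gt0 : 0 < U by rewrite mulr_gt0// addr_gt0// invr_gt0 sqrtr_gt0.
have V_gt0 : 0 < V := lt_le_trans U_gt0 Ubound_le_Vbound.
have clipV u : - V <= clip U u <= V.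
  by rewrite -ler_norml (le_trans (clip_bound _ _) Ubound_le_Vbound)// ltW.
have bounds := hD V_gt0.
have gV : 0 <= g V.
  have [h _ _ _] := bounds (clip U 0) 0 (clipV 0); exact: le_trans h.
have bV : 0 < beta0 V by have [_ h _ _] := bounds (clip U 0) 0 (clipV 0).
have lip u u' v : - V <= u -> u <= u' -> u' <= V ->
    `|calR (u', v) - calR (u, v)| <= g V * (u' - u).
  move=> h1; rewrite le_eqVlt => /predU1P[->|uu] h2.
    by rewrite !subrr normr0 mulr0.
  have [z /andP[z1 z2] ->] := horizontal_increment v hC1 uu.
  rewrite normrM (@gtr0_norm _ (u' - u)) ?subr_gt0// ler_pM2r ?subr_gt0//.
  by have [] := bounds z v; rewrite // (le_trans h1 z1) (le_trans z2 h2).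
exists (fun u v => calR (clip U u, v)), (fun u => A (clip U u)), (g V), (beta0 V); split.
- split=> //; rewrite -ler_pdivrMr// ltW//.
  by move: hs; rewrite gt_max => /andP[].
- move=> u u' v; wlog uu : u u' / u <= u' => [hw|].
    by have [/hw|/ltW/hw] := leP u u'; rewrite // distrC (distrC u').
  have /andP[c0 c1] := clip_le U uu.
  have /andP[k1 k2] := clipV u; have /andP[k3 k4] := clipV u'.
  rewrite distrC (distrC u) (@ger0_norm _ (u' - u)) ?subr_ge0//.
  apply: (le_trans (lip _ _ v k1 _ k4)); first by rewrite -subr_ge0.
  by rewrite ler_wpM2l.
- move=> u v v'; rewrite le_eqVlt => /predU1P[->|vv].
    by rewrite !subrr !mulr0 lexx.
  have [z _ ->] := vertical_increment (clip U u) hC1 vv.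
  have [_ _ h1 h2] := bounds (clip U u) z (clipV u).
  by rewrite !ler_pM2r ?subr_gt0// h1 hb.
- split=> [u|]; first exact/hA.
  by rewrite clip0// ltW.
split=> [u v hu _|u hu]; by rewrite clip_id.
Qed.

End Regularization.

Section InitialData.
Context (R : realType).
Local Notation mu := (@lebesgue_measure R).
Local Notation bv := (bv_modulus (@N2 R) (@Tr R)).

Lemma ae_imply (P Q : R -> Prop) : (forall x, P x -> Q x) ->
  {ae mu, forall x, P x} -> {ae mu, forall x, Q x}.
Proof.
move=> PQ [N [mN N0 h]]; exists N; split=> // x /= nq.
by apply: h => /= p; exact/nq/PQ.
Qed.

Lemma norm_infty_ae (f : R -> R) (N : R) : (norm_infty f <= N%:E)%E ->
  {ae mu, forall x, `|f x| <= N}.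
Proof.
(* The infinite norm unfolds to an essential supremum only on a space of positive measure. *)
have mu0 : (0 < mu [set: R])%E.
  apply: (@lt_le_trans _ _ (mu `[0%R, 1%R]%classic)); last by apply: le_measure; rewrite ?inE.
  by rewrite lebesgue_measure_itv/= lte01 oppr0 adde0.
rewrite /norm_infty unlock /= mu0 => /ess_supP.
by apply: ae_imply => x; rewrite /= lee_fin.
Qed.

Lemma ae_eq_Rintegral (D : set R) (f h : R -> R) : measurable D ->
  measurable_fun [set: R] f -> measurable_fun [set: R] h ->
  {ae mu, forall x, f x = h x} ->
  \int[mu]_(x in D) f x = \int[mu]_(x in D) h x.
Proof.
move=> mD mf mh fh; congr fine; apply: ae_eq_integral => //.
- by apply/measurable_EFinP; exact: measurable_funTS.
- by apply/measurable_EFinP; exact: measurable_funTS.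
by apply: ae_imply fh => x e _ /=; rewrite e.
Qed.

Lemma ae_eq_norm1 (f h : R -> R) :
  measurable_fun [set: R] f -> measurable_fun [set: R] h ->
  {ae mu, forall x, f x = h x} -> norm1 f = norm1 h.
Proof.
move=> mf mh fh; rewrite /norm1 !Lnorm1; apply: ae_eq_integral => //.
- by apply: measurableT_comp => //; exact/measurable_EFinP.
- by apply: measurableT_comp => //; exact/measurable_EFinP.
by apply: ae_imply fh => x e _ /=; rewrite e.
Qed.

Lemma norm1_L1 (f : L1 R) : norm1 f = (N1 f)%:E.
Proof. by rewrite /norm1 Lnorm1 EFin_N1. Qed.

Lemma norm1_ge0 (f : R -> R) : (0 <= norm1 f)%E.
Proof. by rewrite /norm1 Lnorm1; exact: integral_ge0. Qed.

Lemma ae_eq_variation (f h : R -> R) :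
  measurable_fun [set: R] f -> measurable_fun [set: R] h ->
  {ae mu, forall x, f x = h x} -> Defs.variation f = Defs.variation h.
Proof.
move=> mf mh fh; rewrite /Defs.variation; congr ereal_sup.
apply: eq_imagel => phi [[_ cphi] _ _]; congr (_%:E).
have mphi : measurable_fun [set: R] (derive1 phi).
  exact: continuous_measurable_fun.
apply: ae_eq_Rintegral => //; try exact: measurable_funM.
by apply: ae_imply fh => x ->.
Qed.

Lemma variation_ge0 (f : R -> R) : (0 <= Defs.variation f)%E.
Proof.
apply: ereal_sup_ubound; exists (fun _ => 0).
  split; last by move=> x; rewrite normr0.
    split; first by move=> x; exact: derivable_cst.
    rewrite (_ : derive1 _ = fun _ => 0); first exact: cst_continuous.
    by apply/funext => x; rewrite derive1E derive_cst.
  rewrite /compact_support (_ : [set _ | _] = set0) ?closure0; first exact: compact0.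
  by apply/seteqP; split=> x //=; rewrite eqxx.
rewrite (_ : derive1 _ = fun _ => 0); last by apply/funext => x; rewrite derive1E derive_cst.
by under eq_Rintegral do rewrite mulr0; rewrite /Rintegral integral0.
Qed.

Lemma measurable_clip (N : R) (f : R -> R) :
  measurable_fun [set: R] f -> measurable_fun [set: R] (fun x => clip N (f x)).
Proof.
by move=> mf; apply: measurable_maxr => //; exact: measurable_minr.
Qed.

(** Barriers require bounds at every point, while [norm_infty] gives them almost everywhere.
    Clipping changes [f] on a null set, which neither [norm1] nor the distributional variation can
    see. *)
Lemma bounded_representative (f : R -> R) (N M : R) : 0 <= N ->
  mu.-integrable setT (EFin \o f) -> (norm_infty f <= N%:E)%E ->
  (norm1 f + Defs.variation f <= M%:E)%E ->
  exists h : L1 R, [/\ {ae mu, forall x, f x = h x}, forall x, `|h x| <= N,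
    N1 h <= M & forall y, N1 (shift1 (- y) h - h) <= M * `|y|].
Proof.
move=> N0 fi fN fM.
have mf : measurable_fun [set: R] f by apply/measurable_EFinP; exact: (measurable_int _ fi).
have ih : mu.-integrable setT (EFin \o (fun x => clip N (f x))).
  apply: (@dominated_integrable_fun _ (measurableTypeR R) R mu _ f) => //.
    exact: measurable_clip.
  by move=> x; have := clip_dist N (f x) 0; rewrite clip0// !subr0.
pose h := mkL1 ih.
have fh : {ae mu, forall x, f x = h x}.
  by apply: ae_imply (norm_infty_ae fN) => x hx; rewrite /h /= clip_id.
have mh : measurable_fun [set: R] h := measurable_L1 h.
exists h; split => //.
- by move=> x; exact: clip_bound.
- rewrite -lee_fin -norm1_L1 -(ae_eq_norm1 mf mh fh); apply: le_trans fM.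
  by rewrite leeDl// variation_ge0.
apply: variation_modulus; rewrite -(ae_eq_variation mf mh fh); apply: le_trans fM.
by rewrite leeDr// norm1_ge0.
Qed.

Lemma riemann_data (u0 v0 : R -> R -> R) (N0 a0 s : R) :
  bounded_in_BV u0 -> bounded_in_BV v0 ->
  N0%:E = maxe (sup_norm_family u0) (sup_norm_family v0) ->
  0 < a0 -> 0 < s -> Num.sqrt a0 <= s ->
  0 <= N0 /\ exists B0 B1 : R, exists w : R -> LL R, forall eps, 0 < eps ->
  [/\ N2 (w eps) <= B0, bv B1 (w eps), trapped (Ubound N0 a0) (w eps),
      {ae mu, forall x, u0 eps x = dens ((w eps).1 x, (w eps).2 x)} &
      {ae mu, forall x, v0 eps x = flux s ((w eps).1 x, (w eps).2 x)}].
Proof.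
move=> [iu [Mu hu]] [iv [Mv hv]] hN a00 s0 as_.
have supu eps : 0 < eps -> (norm_infty (u0 eps) <= N0%:E)%E.
  move=> e0; rewrite hN le_max; apply/orP; left.
  by apply: ereal_sup_ubound; exists eps.
have supv eps : 0 < eps -> (norm_infty (v0 eps) <= N0%:E)%E.
  move=> e0; rewrite hN le_max; apply/orP; right.
  by apply: ereal_sup_ubound; exists eps.
have N0_ge0 : 0 <= N0.
  by rewrite -lee_fin; apply: le_trans (supu 1 ltr01); exact: Lnorm_ge0.
split => //; exists (2 * (Mu + s^-1 * Mv)), (2 * (Mu + s^-1 * Mv)).
have s'0 : 0 < s^-1 by rewrite invr_gt0.
set B := 2 * _.
suff h (eps : R) : exists w : LL R, 0 < eps -> [/\ N2 w <= B, bv B w, trapped (Ubound N0 a0) w,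
    {ae mu, forall x, u0 eps x = dens (w.1 x, w.2 x)} &
    {ae mu, forall x, v0 eps x = flux s (w.1 x, w.2 x)}].
  by have [w hw] := choice h; exists w.
have [e0|e0] := ltP 0 eps; last by exists 0.
have [u [eu uN uM uV]] := bounded_representative N0_ge0 (iu _ e0) (supu _ e0) (hu _ e0).
have [v [ev vN vM vV]] := bounded_representative N0_ge0 (iv _ e0) (supv _ e0) (hv _ e0).
exists (u + s^-1 *: v, u - s^-1 *: v) => _; split.
- have h1 : N1 (u + s^-1 *: v) <= N1 u + s^-1 * N1 v.
    by rewrite (le_trans (N1D _ _))// N1Z (gtr0_norm s'0).
  have h2 : N1 (u - s^-1 *: v) <= N1 u + s^-1 * N1 v.
    by rewrite -scaleNr (le_trans (N1D _ _))// N1Z normrN (gtr0_norm s'0).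
  have h3 := ler_wpM2l (ltW s'0) vM.
  by apply: (le_trans (lerD h1 h2)); rewrite /B; lra.
- move=> y; rewrite /N2.
  have eq1 : (Tr y (u + s^-1 *: v, u - s^-1 *: v) - (u + s^-1 *: v, u - s^-1 *: v)).1 =
      (shift1 (- y) u - u) + s^-1 *: (shift1 (- y) v - v).
    by apply: L1_ext => x; rewrite !(L1D, L1N, L1Z, shift1E)/=; ring.
  have eq2 : (Tr y (u + s^-1 *: v, u - s^-1 *: v) - (u + s^-1 *: v, u - s^-1 *: v)).2 =
      (shift1 (- y) u - u) + (- s^-1) *: (shift1 (- y) v - v).
    by apply: L1_ext => x; rewrite !(L1D, L1N, L1Z, shift1E)/=; ring.
  rewrite eq1 eq2.
  have h1 := N1D (shift1 (- y) u - u) (s^-1 *: (shift1 (- y) v - v)).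
  have h2 := N1D (shift1 (- y) u - u) ((- s^-1) *: (shift1 (- y) v - v)).
  rewrite N1Z (gtr0_norm s'0) in h1; rewrite N1Z normrN (gtr0_norm s'0) in h2.
  have h3 := ler_wpM2l (ltW s'0) (vV y); have h4 := uV y.
  by apply: (le_trans (lerD h1 h2)); rewrite /B; lra.
(* This is the origin of [Ubound]: the Riemann components are at most [N0 + N0 / s], and
   [sqrt a0 <= s]. The initial barriers are the constant states [(U, U)] and [(- U, - U)]. *)
- have bU x : N0 + s^-1 * `|v x| <= Ubound N0 a0.
    rewrite /Ubound mulrDl mul1r lerD2l ler_pM ?(ltW s'0)//.
    by rewrite lef_pV2 ?posrE ?sqrtr_gt0.
  have U0 : 0 <= Ubound N0 a0 by rewrite (le_trans _ (bU 0))// addr_ge0// mulr_ge0// ltW.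
  exists (Ubound N0 a0, Ubound N0 a0), (- Ubound N0 a0, - Ubound N0 a0); split => /=.
  + by ring.
  + by ring.
  + by rewrite /l1/= ger0_norm//; lra.
  + by rewrite /l1/= normrN ger0_norm//; lra.
  move=> x; have := bU x; have := uN x; have := ler_norm (u x); have := ler_norm (- u x).
  have := ler_wpM2l (ltW s'0) (ler_norm (v x)).
  have := ler_wpM2l (ltW s'0) (ler_norm (- v x)); rewrite !normrN.
  by move=> *; split; lra.
- by apply: ae_imply eu => x ->; rewrite /dens/= ?(L1D, L1N, L1Z); field; rewrite gt_eqF.
by apply: ae_imply ev => x ->; rewrite /flux/= ?(L1D, L1N, L1Z); field; rewrite gt_eqF.
Qed.

End InitialData.

(** * Convergence *)

Section Convergence.
Context (R : realType).
Local Notation leb := (@lebesgue_measure R).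
Local Notation leb2 := (@lebesgue_plane R).
Local Notation bv := (bv_modulus (@N2 R) (@Tr R)).
Variables (G : R -> R -> R) (eqA : R -> R) (gu b0 beta s : R).
Hypotheses (s0 : 0 < s) (b00 : 0 < b0) (gs : gu <= s * b0) (beta0 : 0 < beta).
Hypothesis Gu : forall u u' v, `|G u v - G u' v| <= gu * `|u - u'|.
Hypothesis Gv : forall u v v' : R, v' <= v ->
  b0 * (v - v') <= G u v - G u v' <= beta * (v - v').
Hypothesis GA : forall u, G u (eqA u) = 0.
Hypothesis A0 : eqA 0 = 0.
Variables (U B0 B1 eps : R) (w0 : LL R).
Hypotheses (eps0 : 0 < eps) (w0B0 : N2 w0 <= B0) (w0B1 : bv B1 w0)
  (w0U : trapped U w0).
Variables (calR : R * R -> R) (A : R -> R) (a : R) (u0 v0 : R -> R).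
Hypothesis sa : s = Num.sqrt a.
Hypothesis calRG : forall u v, `|u| <= U -> `|v| <= 2 * U * s -> calR (u, v) = G u v.
Hypothesis AeqA : forall u, `|u| <= U -> A u = eqA u.
Hypotheses (mu0 : measurable_fun [set: R] u0) (mv0 : measurable_fun [set: R] v0).
Hypothesis u0E : {ae leb, forall x, u0 x = dens (w0.1 x, w0.2 x)}.
Hypothesis v0E : {ae leb, forall x, v0 x = flux s (w0.1 x, w0.2 x)}.

Let rMlip := maxwellian_lip s0 b00 gs beta0 Gu Gv.
Let rM0 := maxwellian0 beta s GA A0.
Let rMc := @maxwellian_conservative R G beta s.
Let mu := rate_mu beta eps.
Let mu_gt0 : 0 < mu := rate_mu_gt0 beta0 eps0.

Definition limit_u (p : R * R) : R := exact_u rMlip rM0 mu s w0 p.1 p.2.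
Definition limit_v (p : R * R) : R := s * exact_y rMlip rM0 mu s w0 p.1 p.2.

Let sol := solution s0 b00 gs beta0 Gu Gv GA A0 eps0 w0B0 w0B1 w0U.

Let limit_u_bound p : `|limit_u p| <= U.
Proof. exact: (@exact_u_bound R _ rMlip rM0 rMc mu s U w0 mu_gt0 w0U). Qed.

Let limit_v_bound p : `|limit_v p| <= 2 * U * s.
Proof.
rewrite /limit_v normrM (gtr0_norm s0) mulrC ler_pM2r//.
exact: (@exact_y_bound R _ rMlip rM0 rMc mu s U w0 mu_gt0 w0U).
Qed.

Let m_limit_u : measurable_fun [set: R * R] limit_u.
Proof. exact: (@measurable_exact_u R _ rMlip rM0 rMc mu s U w0 mu_gt0 w0U). Qed.

Let m_limit_v : measurable_fun [set: R * R] limit_v.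
Proof.
apply: measurable_funM => //.
exact: (@measurable_exact_y R _ rMlip rM0 rMc mu s U w0 mu_gt0 w0U).
Qed.

Let a_s2 : a = s ^+ 2.
Proof.
rewrite sa sqr_sqrtr// leNgt; apply/negP => a0.
by have := s0; rewrite sa ltr0_sqrtr ?ltxx.
Qed.

Let m_w1 : measurable_fun [set: R] w0.1 := measurable_L1 w0.1.
Let m_w2 : measurable_fun [set: R] w0.2 := measurable_L1 w0.2.

Let m_dens : measurable_fun [set: R] (fun x => dens (w0.1 x, w0.2 x)).
Proof. by apply: measurable_funM => //; exact: measurable_funD. Qed.

Let m_flux : measurable_fun [set: R] (fun x => flux s (w0.1 x, w0.2 x)).
Proof.
by apply: measurable_funM => //; apply: measurable_funM => //; exact: measurable_funB.
Qed.

Let bounded_measurable_ae (f : R * R -> R) (K : R) :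
  measurable_fun [set: R * R] f -> (forall p, `|f p| <= K) -> bounded_measurable f.
Proof.
move=> mf fK; split => //; exists K; exists set0; split => //.
by move=> p /= []; rewrite fK.
Qed.

(** By the choice of [maxwellian] the drift of the flux is [- G / eps], and [G] equals [calR] along
    the limit because its bounds hold at every point. *)
Lemma limit_weak_solution : weak_solution calR a eps u0 v0 limit_u limit_v.
Proof.
split; [exact: bounded_measurable_ae m_limit_u limit_u_bound|
  exact: bounded_measurable_ae m_limit_v limit_v_bound|].
move=> phi C1phi cphi.
have mphi0 : measurable_fun [set: R] (fun x => phi (0, x)).
  apply: (measurableT_comp (continuous_measurable_plane (test_continuous C1phi))).
  exact: pair1_measurable.
have [h1 h2] := exact_weak_form rMlip rM0 rMc mu_gt0 (ltW s0) w0B0 w0B1 w0U C1phi cphi.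
split.
  rewrite -[RHS]h1; congr (_ + _).
  apply: ae_eq_Rintegral => //; [exact: measurable_funM|exact: measurable_funM|].
  by apply: ae_imply u0E => x ->.
rewrite -[RHS]h2; congr (_ + _); last first.
  apply: ae_eq_Rintegral => //; [exact: measurable_funM|exact: measurable_funM|].
  by apply: ae_imply v0E => x ->.
apply: eq_Rintegral => p _; rewrite calRG// a_s2.
have bN0 : beta != 0 by rewrite gt_eqF.
have eN0 : eps != 0 by rewrite gt_eqF.
have sN0 : s != 0 by rewrite gt_eqF.
set e1 := (X in flux s (maxwellian G beta s X)).
have du : dens e1 = limit_u p by rewrite /e1 /limit_u /dens/=; field.
have dv : flux s e1 = limit_v p by rewrite /e1 /limit_v /flux/=; field.
rewrite /maxwellian /relax_map du dv.
rewrite -[X in X * d1 phi p]/(limit_v p) -[exact_u _ _ _ _ _ _ _]/(limit_u p).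
rewrite [in RHS]/flux/= -/(limit_v p) /mu /rate_mu.
by field; rewrite bN0 eN0 sN0.
Qed.

Let cell_avgE dx (f : R -> R) (h : L1 R) j :
  measurable_fun [set: R] f -> {ae leb, forall x, f x = h x} ->
  cell_average dx f j = cell_average dx h j.
Proof.
move=> mf fh; congr (_ * _); apply: ae_eq_Rintegral => //; first exact: measurable_itv.
exact: measurable_L1.
Qed.

Let densL : L1 R := 2^-1 *: (w0.1 + w0.2).
Let fluxL : L1 R := (s / 2) *: (w0.1 - w0.2).

Let cell_average_lin dx (f h : L1 R) (c d : R) (k : L1 R) j :
  (forall x, k x = c * f x + d * h x) ->
  cell_average dx k j = c * cell_average dx f j + d * cell_average dx h j.
Proof.
move=> hk; rewrite /cell_average.
have i (q : L1 R) : leb.-integrable (cell dx j) (EFin \o q).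
  by apply: integrableS (L1_integrable q) => //; exact: measurable_itv.
have mc : measurable (cell dx j) by exact: measurable_itv.
have i1 : leb.-integrable (cell dx j) (EFin \o (fun x => c * f x)).
  by apply: (@integrableZl _ (measurableTypeR R) R leb (cell dx j) mc c _ (i f)).
have i2 : leb.-integrable (cell dx j) (EFin \o (fun x => d * h x)).
  by apply: (@integrableZl _ (measurableTypeR R) R leb (cell dx j) mc d _ (i h)).
under eq_Rintegral do rewrite hk.
rewrite RintegralD// !RintegralZl//; try exact: i.
by ring.
Qed.

Section Mesh.
Variables (dt dx : R).
Hypotheses (dt0 : 0 < dt) (dx0 : 0 < dx) (cfl : s * dt / dx < 1).

Let uh := num_u calR A a beta eps dt dx u0 v0.
Let vh := num_v calR A a beta eps dt dx u0 v0.
Let state n := discrete s0 b00 gs beta0 Gu Gv GA A0 w0 eps0 dt0 dx0 n.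

Let u0_avg j : cell_average dx u0 j =
  dens (cell_average dx w0.1 j, cell_average dx w0.2 j).
Proof.
rewrite (@cell_avgE dx u0 densL)//; last first.
  by apply: ae_imply u0E => x ->; rewrite /densL L1Z L1D /dens/= mulrC.
rewrite (@cell_average_lin dx w0.1 w0.2 2^-1 2^-1)//.
  by rewrite /dens/=; ring.
by move=> x; rewrite /densL L1Z L1D mulrDr.
Qed.

Let v0_avg j : cell_average dx v0 j =
  flux s (cell_average dx w0.1 j, cell_average dx w0.2 j).
Proof.
rewrite (@cell_avgE dx v0 fluxL)//; last first.
  by apply: ae_imply v0E => x ->; rewrite /fluxL L1Z L1D L1N /flux/=; ring.
rewrite (@cell_average_lin dx w0.1 w0.2 (s / 2) (- (s / 2)))//.
  by rewrite /flux/=; ring.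
by move=> x; rewrite /fluxL L1Z L1D L1N; ring.
Qed.

Let grid n x := scheme_state s0 b00 gs beta0 Gu Gv GA A0 eps0 w0U dt0 dx0 cfl sa
  calRG AeqA u0_avg v0_avg n x.

Lemma num_uE t x : 0 <= t -> uh (t, x) =
  dens ((state (Num.truncn (t / dt))).1 x, (state (Num.truncn (t / dt))).2 x)
  * off_interfaces dx x.
Proof. by move=> t0; rewrite /uh /num_u reconstructE// grid. Qed.

Lemma num_vE t x : 0 <= t -> vh (t, x) =
  flux s ((state (Num.truncn (t / dt))).1 x, (state (Num.truncn (t / dt))).2 x)
  * off_interfaces dx x.
Proof. by move=> t0; rewrite /vh /num_v reconstructE// grid. Qed.

Let m_state_dens n : measurable_fun [set: R]
  (fun x => dens ((state n).1 x, (state n).2 x) * off_interfaces dx x).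
Proof.
apply: measurable_funM; last exact: measurable_off_interfaces.
by apply: measurable_funM => //; apply: measurable_funD; exact: measurable_L1.
Qed.

Let m_state_flux n : measurable_fun [set: R]
  (fun x => flux s ((state n).1 x, (state n).2 x) * off_interfaces dx x).
Proof.
apply: measurable_funM; last exact: measurable_off_interfaces.
apply: measurable_funM => //; apply: measurable_funM => //.
by apply: measurable_funB; exact: measurable_L1.
Qed.

Let slice_u t : measurable_fun [set: R] (fun x => limit_u (t, x)).
Proof. exact: (measurableT_comp m_limit_u (pair1_measurable t)). Qed.

Let slice_v t : measurable_fun [set: R] (fun x => limit_v (t, x)).
Proof. exact: (measurableT_comp m_limit_v (pair1_measurable t)). Qed.

Let err_u t : L1 R := 2^-1 *:
  ((state (Num.truncn (t / dt)) - sol t).1 + (state (Num.truncn (t / dt)) - sol t).2).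
Let err_v t : L1 R := (s / 2) *:
  ((state (Num.truncn (t / dt)) - sol t).1 - (state (Num.truncn (t / dt)) - sol t).2).

Let err_uE t x : err_u t x =
  dens ((state (Num.truncn (t / dt))).1 x, (state (Num.truncn (t / dt))).2 x)
  - limit_u (t, x).
Proof.
rewrite /err_u /dens; move: (Num.truncn _) => n.
rewrite -[LHS]/(2^-1 * (((state n).1 x - (limit_u (t, x) + exact_y rMlip rM0 mu s w0 t x))
  + ((state n).2 x - (limit_u (t, x) - exact_y rMlip rM0 mu s w0 t x)))) /=.
by field.
Qed.

Let err_vE t x : err_v t x =
  flux s ((state (Num.truncn (t / dt))).1 x, (state (Num.truncn (t / dt))).2 x)
  - limit_v (t, x).
Proof.
rewrite /err_v /flux /limit_v; move: (Num.truncn _) => n.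
rewrite -[LHS]/(s / 2 * (((state n).1 x - (limit_u (t, x) + exact_y rMlip rM0 mu s w0 t x))
  - ((state n).2 x - (limit_u (t, x) - exact_y rMlip rM0 mu s w0 t x)))) /=.
by field.
Qed.

Lemma norm1_num_u t : 0 <= t ->
  norm1 (fun x => uh (t, x) - limit_u (t, x)) = (N1 (err_u t))%:E.
Proof.
move=> t0; rewrite -norm1_L1; apply: ae_eq_norm1.
- rewrite (_ : (fun x => uh (t, x) - _) = fun x =>
    dens ((state (Num.truncn (t / dt))).1 x, (state (Num.truncn (t / dt))).2 x)
    * off_interfaces dx x - limit_u (t, x)); first exact: measurable_funB.
  by apply/funext => x; rewrite num_uE.
- exact: measurable_L1.
apply: ae_imply (off_interfaces_ae dx) => x hx.
by rewrite num_uE// hx mulr1 err_uE.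
Qed.

Lemma norm1_num_v t : 0 <= t ->
  norm1 (fun x => vh (t, x) - limit_v (t, x)) = (N1 (err_v t))%:E.
Proof.
move=> t0; rewrite -norm1_L1; apply: ae_eq_norm1.
- rewrite (_ : (fun x => vh (t, x) - _) = fun x =>
    flux s ((state (Num.truncn (t / dt))).1 x, (state (Num.truncn (t / dt))).2 x)
    * off_interfaces dx x - limit_v (t, x)); first exact: measurable_funB.
  by apply/funext => x; rewrite num_vE.
- exact: measurable_L1.
apply: ae_imply (off_interfaces_ae dx) => x hx.
by rewrite num_vE// hx mulr1 err_vE.
Qed.

Definition rate_constant (T epsmax : R) : R :=
  (1 + s) * error_constant beta s B0 B1 T epsmax.

Lemma norm1_error t T epsmax : 0 <= t -> t <= T -> eps <= epsmax ->
  N1 (err_u t) + N1 (err_v t) <= rate_constant T epsmax / eps * Num.sqrt dx.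
Proof.
move=> t0 tT em.
have h := scheme_error s0 b00 gs beta0 Gu Gv GA A0 eps0 w0B0 w0B1 w0U dt0 dx0 cfl t0 tT em.
rewrite -/(state _) -/sol in h.
set d := state _ - sol t in h *.
have h1 : N1 (err_u t) <= 2^-1 * N2 d.
  apply: N1_leD => // x; rewrite L1Z L1D normrM ger0_norm// ler_wpM2l//.
  exact: ler_normD.
have h2 : N1 (err_v t) <= s / 2 * N2 d.
  have s2 : 0 <= s / 2 by rewrite divr_ge0// ltW.
  apply: N1_leD => // x; rewrite L1Z L1D L1N normrM ger0_norm// ler_wpM2l//.
  exact: ler_normB.
apply: (le_trans (lerD h1 h2)); rewrite -mulrDl.
have d0 : 0 <= N2 d by rewrite addr_ge0// N1_ge0.
apply: (@le_trans _ _ ((1 + s) * N2 d)).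
  by rewrite ler_wpM2r//; have := s0; lra.
rewrite /rate_constant -!mulrA ler_pM2l ?addr_gt0//.
by rewrite mulrA.
Qed.

Let mn : measurable_fun [set: R] (fun t : R => Num.truncn (t / dt)).
Proof. exact: measurable_truncn_div. Qed.

Let grid_u (p : R * R) :=
  dens ((state (Num.truncn (p.1 / dt))).1 p.2, (state (Num.truncn (p.1 / dt))).2 p.2)
  * off_interfaces dx p.2 - limit_u p.

Let grid_v (p : R * R) :=
  flux s ((state (Num.truncn (p.1 / dt))).1 p.2, (state (Num.truncn (p.1 / dt))).2 p.2)
  * off_interfaces dx p.2 - limit_v p.

Let m_grid_u : measurable_fun [set: R * R] grid_u.
Proof.
apply: measurable_funB => //.
exact: (measurable_step mn m_state_dens).
Qed.

Let m_grid_v : measurable_fun [set: R * R] grid_v.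
Proof.
apply: measurable_funB => //.
exact: (measurable_step mn m_state_flux).
Qed.

Lemma measurable_num_u :
  measurable_fun (@closed_half_plane R) (fun p => uh p - limit_u p).
Proof.
apply: (eq_measurable_fun grid_u); last exact: measurable_funTS.
by move=> [t x]; rewrite inE => t0; rewrite num_uE.
Qed.

Lemma measurable_num_v :
  measurable_fun (@closed_half_plane R) (fun p => vh p - limit_v p).
Proof.
apply: (eq_measurable_fun grid_v); last exact: measurable_funTS.
by move=> [t x]; rewrite inE => t0; rewrite num_vE.
Qed.

Lemma plane_error (T : R) : 0 <= T ->
  (\int[leb2]_(p in [set p | (0 <= p.1 <= T)%R]) `|uh p - limit_u p|%:E
     <= (T * (rate_constant T eps / eps * Num.sqrt dx))%:E)%E /\
  (\int[leb2]_(p in [set p | (0 <= p.1 <= T)%R]) `|vh p - limit_v p|%:E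
     <= (T * (rate_constant T eps / eps * Num.sqrt dx))%:E)%E.
Proof.
move=> T0; set c := _ / _ * _.
have c0 : 0 <= c.
  by apply: le_trans (norm1_error T0 (lexx T) (lexx eps)); rewrite addr_ge0// N1_ge0.
(* The numerical solution is identified with a function measurable on the plane only for nonnegative
   times, so the integral is moved to that function [f] before integrating slice by slice. *)
have strip (q f : R * R -> R) (e : R -> L1 R) :
    measurable_fun [set: R * R] f ->
    (forall p, 0 <= p.1 -> q p = f p) ->
    (forall t, 0 <= t <= T -> N1 (e t) <= c) ->
    (forall t, 0 <= t -> norm1 (fun x => q (t, x)) = (N1 (e t))%:E) ->
    (\int[leb2]_(p in [set p | (0 <= p.1 <= T)%R]) `|q p|%:E <= (T * c)%:E)%E.
  move=> mf qf ec qe.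
  have -> : (\int[leb2]_(p in [set p | (0 <= p.1 <= T)%R]) `|q p|%:E =
      \int[leb2]_(p in [set p | (0 <= p.1 <= T)%R]) `|f p|%:E)%E.
    by apply: eq_integral => p; rewrite inE/= => /andP[p0 _]; rewrite qf.
  apply: integral_strip_le => // t /andP[t0 tT].
  have := qe t t0; rewrite /norm1 Lnorm1 => hq.
  have -> : (\int[leb]_x `|f (t, x)|%:E = \int[leb]_x `|q (t, x)|%:E)%E.
    by apply: eq_integral => x _; rewrite qf.
  by rewrite -[X in (X <= _)%E]/(\int[leb]_x `|(EFin \o (fun x => q (t, x))) x|)%E hq
    lee_fin ec// t0.
split.
  apply: (strip (fun p => uh p - limit_u p) grid_u err_u) => //.
  - by move=> [t x] /= t0; rewrite num_uE.
  - move=> t /andP[t0 tT].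
    apply: le_trans (norm1_error t0 tT (lexx eps)); by rewrite lerDl N1_ge0.
  - by move=> t t0; rewrite norm1_num_u.
apply: (strip (fun p => vh p - limit_v p) grid_v err_v) => //.
- by move=> [t x] /= t0; rewrite num_vE.
- move=> t /andP[t0 tT].
  apply: le_trans (norm1_error t0 tT (lexx eps)); by rewrite lerDr N1_ge0.
- by move=> t t0; rewrite norm1_num_v.
Qed.

End Mesh.

Lemma measurable_closed_half_plane : measurable (@closed_half_plane R).
Proof.
rewrite (_ : @closed_half_plane R = `[0, +oo[%classic `*` [set: R]).
  exact: measurableX.
by apply/seteqP; split=> p /=; rewrite in_itv/= andbT => // -[].
Qed.

Let cvg_of_strip (q : R * R -> R * R -> R) (w : R * R -> R) :
  (forall T, 0 <= T -> exists c : R, forall h, admissible_mesh a h ->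
    measurable_fun (@closed_half_plane R) (fun p => q h p - w p) /\
    (\int[leb2]_(p in [set p | (0 <= p.1 <= T)%R]) `|q h p - w p|%:E
      <= (c * Num.sqrt h.2)%:E)%E) ->
  cvg_L1loc a q w.
Proof.
move=> hq K cK KH.
have [M [Mr hM]] := compact_bounded cK.
pose T := `|M| + 1.
have T0 : 0 <= T by rewrite addr_ge0.
have KT : K `<=` [set p | 0 <= p.1 <= T].
  move=> p Kp; rewrite /= (KH p Kp)/=.
  have : `|p| <= T by apply: hM => //; rewrite (le_lt_trans (ler_norm M))// ltrDl.
  by rewrite prod_normE ge_max => /andP[h _]; rewrite (le_trans (ler_norm _)).
have [c hc] := hq T T0.
apply: (@squeeze_cvge _ _ _ _ (fun _ => 0%E) _ (fun h => (c * Num.sqrt h.2)%:E)).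
- near=> h.
  have mh : admissible_mesh a h by near: h; exact: withinT.
  have [mqw hh] := hc h mh.
  apply/andP; split; first exact: integral_ge0.
  apply: le_trans hh; apply: ge0_subset_integral => //.
  + by apply: closed_measurable_plane; apply: compact_closed => //; exact: norm_hausdorff.
  + exact: measurable_strip.
  apply/measurable_EFinP; apply: measurableT_comp => //.
  apply: (@measurable_funS _ _ (measurableTypeR R * measurableTypeR R)%type _ _ _ _ _ _ mqw).
    exact: measurable_closed_half_plane.
  by move=> p /= /andP[].
- exact: cvg_cst.
rewrite -[X in _ --> X]/(0%:E).
apply: cvg_EFin; first exact: nearW.
have e : c * Num.sqrt ((0, 0) : R * R).2 = 0 by rewrite sqrtr0 mulr0.
rewrite -[X in _ --> X]e.
apply: cvgM; first exact: cvg_cst.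
apply: cvg_within_filter.
have cs : {for ((0, 0) : R * R), continuous (fun h : R * R => Num.sqrt h.2)}.
  by apply: (@continuous_comp _ _ _ snd Num.sqrt); [exact: cvg_snd|exact: sqrt_continuous].
exact: cs.
Unshelve. all: by end_near. Qed.

Lemma numerical_cvg :
  cvg_L1loc a (fun h => num_u calR A a beta eps h.1 h.2 u0 v0) limit_u /\
  cvg_L1loc a (fun h => num_v calR A a beta eps h.1 h.2 u0 v0) limit_v.
Proof.
split; apply: cvg_of_strip => T T0; exists (T * (rate_constant T eps / eps)).
  move=> h [h1 h2 _]; rewrite -sa => cfl; split; first exact: measurable_num_u.
  by rewrite -mulrA; have [] := plane_error h1 h2 cfl T0.
move=> h [h1 h2 _]; rewrite -sa => cfl; split; first exact: measurable_num_v.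
by rewrite -mulrA; have [] := plane_error h1 h2 cfl T0.
Qed.

End Convergence.

Theorem theorem2p4 (R : realType)
    (u0 v0 : R -> R -> R) (N0 : R)
    (calR : R * R -> R) (A g beta0 H : R -> R) (a0 a beta : R)
    (hu0 : bounded_in_BV u0) (hv0 : bounded_in_BV v0)
    (hN0 : N0%:E = maxe (sup_norm_family u0) (sup_norm_family v0))
    (hC1 : C1_plane calR)
    (hE : equilibrium calR A)
    (hD : gradient_bounds calR g beta0 H)
    (ha0 : 0 < a0) (ha : 0 < Num.sqrt a) (hbeta : 0 < beta)
    (hP : parameter_choice A g beta0 H N0 a0 a beta) :
  exists u v : R -> R * R -> R,
    (forall eps : R, 0 < eps ->
       [/\ weak_solution calR a eps (u0 eps) (v0 eps) (u eps) (v eps),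
           cvg_L1loc a
             (fun h => num_u calR A a beta eps h.1 h.2 (u0 eps) (v0 eps))
             (u eps) &
           cvg_L1loc a
             (fun h => num_v calR A a beta eps h.1 h.2 (u0 eps) (v0 eps))
             (v eps)]) /\
    (forall t : R, 0 <= t -> forall epsmax : R, 0 < epsmax ->
       exists C : R, forall eps : R, 0 < eps -> eps <= epsmax ->
       forall dt dx : R, admissible_mesh a (dt, dx) ->
         let uh := num_u calR A a beta eps dt dx (u0 eps) (v0 eps) in
         let vh := num_v calR A a beta eps dt dx (u0 eps) (v0 eps) in
         (norm1 (fun x => uh (t, x) - u eps (t, x))%R
            + norm1 (fun x => vh (t, x) - v eps (t, x))%R
          <= (C / eps)%:E
             * (dt%:E * (norm1 (fun x => v0 eps x - A (u0 eps x))%R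
                           * eps^-1%:E + 1)
                + (Num.sqrt dx)%:E))%E).
Proof.
have as_ : Num.sqrt a0 <= Num.sqrt a.
  by case: hP => + _; rewrite gt_max => /andP[/ltW].
have [N0_ge0 [B0 [B1 [w hw]]]] := riemann_data hu0 hv0 hN0 ha0 ha as_.
have [G [eqA [gu [b0 [[b00 gs] Gu Gv [GA A0] [calRG AeqA]]]]]] :=
  regularization hC1 hE hD hbeta hP N0_ge0.
have mu0 eps : 0 < eps -> measurable_fun [set: R] (u0 eps).
  by move=> e0; apply/measurable_EFinP; exact: (measurable_int _ (hu0.1 eps e0)).
have mv0 eps : 0 < eps -> measurable_fun [set: R] (v0 eps).
  by move=> e0; apply/measurable_EFinP; exact: (measurable_int _ (hv0.1 eps e0)).
exists (fun eps => limit_u ha b00 gs hbeta Gu Gv GA A0 eps (w eps)),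
  (fun eps => limit_v ha b00 gs hbeta Gu Gv GA A0 eps (w eps)).
split=> [eps e0|t t0 epsmax em0].
  have [wB0 wB1 wU wu wv] := hw eps e0.
  have [cu cv] := numerical_cvg ha b00 gs hbeta Gu Gv GA A0 e0 wB0 wB1 wU
    erefl calRG AeqA (mu0 _ e0) (mv0 _ e0) wu wv.
  split => //.
  exact: (limit_weak_solution ha b00 gs hbeta Gu Gv GA A0 e0 wB0 wB1 wU
    erefl calRG (mu0 _ e0) (mv0 _ e0) wu wv).
(* [B0] and [B1] bound the data for all [eps] at once and [epsmax] bounds the positive powers of
   [eps], so the constant depends neither on [eps] nor on the mesh. *)
pose C := rate_constant beta (Num.sqrt a) B0 B1 t epsmax.
exists `|C| => eps e0 em dt dx [/= dt0 dx0 _ cfl].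
have [wB0 wB1 wU wu wv] := hw eps e0.
rewrite (norm1_num_u ha b00 gs hbeta Gu Gv GA A0 e0 wB0 wB1 wU
    erefl calRG AeqA (mu0 _ e0) (mv0 _ e0) wu wv dt0 dx0 cfl t0).
rewrite (norm1_num_v ha b00 gs hbeta Gu Gv GA A0 e0 wB0 wB1 wU
    erefl calRG AeqA (mu0 _ e0) (mv0 _ e0) wu wv dt0 dx0 cfl t0).
(* The estimate is established with [sqrt dx] alone, the CFL condition having converted [dt]; the
   term in [dt] on the right is nonnegative. *)
apply: (@le_trans _ _ ((`|C| / eps)%:E * (Num.sqrt dx)%:E)%E).
  rewrite -EFinD -EFinM lee_fin.
  apply: (le_trans (norm1_error ha b00 gs hbeta Gu Gv GA A0 e0 wB0 wB1 wU
    dt0 dx0 cfl t0 (lexx t) em)).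
  by rewrite ler_wpM2r ?sqrtr_ge0// ler_pM2r ?invr_gt0// ler_norm.
apply: lee_wpmul2l; first by rewrite lee_fin divr_ge0// ltW.
rewrite leeDr//; apply: mule_ge0; first by rewrite lee_fin ltW.
by apply: adde_ge0 => //; apply: mule_ge0; [exact: norm1_ge0|rewrite lee_fin invr_ge0 ltW].
Qed.
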